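(* Let $d,T\ge3$ and define $$A_\Delta=2\log(d)+1,\quad c_\Delta=3+2\zeta_1(d)\le5,\quad \mu=\min\Big\{\frac{\sqrt{A_\Delta d}}{\sqrt T\,c_\Delta},\frac12\Big\},\quad \alpha=\mu,\quad \gamma=\frac1{\sqrt{48}(1+\sqrt2)G\sqrt{dT}},$$ $$G_\Delta^\alpha=1+\log(d/\alpha),\quad N=\Big\lceil\tfrac12\log_2\Big(1+\frac{2G_\Delta^\alpha T}{A_\Delta}\Big)\Big\rceil+1,\quad \eta_{(k)}=2^{k-1}\sqrt{\frac{A_\Delta}{6(1+\sqrt2)^2G^2dT}},\ k=1,\dots,N.$$ Let $c=(1/d,\dots,1/d)^\top$ and $\mathcal X_\alpha=\{(1-\alpha)x+\alpha c:x\in\Delta_d\}$. Let the loss functions $f_1,\dots,f_T$ be convex and $G$-Lipschitz with respect to the $\ell_1$-norm on an open convex set $\mathcal U\subseteq\mathbb R^d$ satisfying $$\mathcal X_\alpha+\mu\mathbb B_1^d\subseteq\mathcal U .$$ Run the algorithm PBMD (described in the context) on $\mathcal X_\alpha$ with these parameters, common initialization $y^1=c$, and entropy regularizer $\psi(x)=\sum_{j=1}^dx_j\log x_j$. Then, for every comparator sequence $u^1,\dots,u^T\in\Delta_d$, with $\mathcal P_{T,1}=\sum_{t=1}^{T-1}\|u^{t+1}-u^t\|_1$, $$\mathbb E\Big[\sum_{t=1}^T\Big(\frac{f_t(x^{t,+})+f_t(x^{t,-})}{2}-f_t(u^t)\Big)\Big]=\mathcal O\Big(G\sqrt{d\log(d)\,T\log(T)\,(1+\mathcal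 P_{T,1})}\Big),$$ where the expectation is taken with respect to all the randomness $s^1,\dots,s^T$, and $\mathcal O(\cdot)$ hides an absolute constant.
   Context: Setting: $T$ is the number of iterations. At each iteration $t$ an adversary selects a convex loss function $f_t$ on $\mathbb R^d$, unknown to the learner; the learner queries two points $x^{t,+},x^{t,-}$ and observes only $f_t(x^{t,+})$ and $f_t(x^{t,-})$. The comparators are constrained to the simplex $\Delta_d$, but the queried points need only lie in $\mathcal U$, not in $\Delta_d$. Notation: $\Delta_d=\{x\in\mathbb R^d:x\ge0,\ \sum_{j=1}^dx_j=1\}$; $\mathbb B_1^d=\{x\in\mathbb R^d:\|x\|_1\le1\}$; $\partial\mathbb B_1^d=\{x\in\mathbb R^d:\|x\|_1=1\}$; $\log$ is the natural logarithm, $0\log0=0$; $\zeta_1(d)=d/(d+1)$; $\operatorname{sign}$ acts componentwise with $\operatorname{sign}(0)=1$; the Bregman divergence is $B_\psi(x;y)=\psi(x)-\psi(y)-\langle\nabla\psi(y),x-y\rangle$. Algorithm PBMD (inputs: smoothing parameter $\mu$, shrinkage parameter $\alpha$, weight update parameter $\gamma$, number of base learners $N$, step sizes $\eta_{(1)},\dots,\eta_{(N)}$, regularizer $\psi$, initial point $y^1\in\mathcal X_\alpha$). Initialize $y_{(k)}^1=y^1$ and $\omega_{(k)}^1=\frac{N+1}{N}\frac1{k(k+1)}$ for $k=1,\dots,N$. For $t=1,\dots,T$: set $y^t=\sum_{k=1}^N\omega_{(k)}^ty_{(k)}^t$; draw $s^t$ from the uniform distribution on $\partial\mathbb B_1^d$;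 play $x^{t,\pm}=y^t\pm\mu s^t$; set $g^t=\frac{d}{2\mu}\big(f_t(x^{t,+})-f_t(x^{t,-})\big)\operatorname{sign}(s^t)$ and $\varphi^t(y)=\langle g^t,y-y^t\rangle$; update $$\omega_{(k)}^{t+1}=\frac{\omega_{(k)}^t\exp(-\gamma\varphi^t(y_{(k)}^t))}{\sum_{j=1}^N\omega_{(j)}^t\exp(-\gamma\varphi^t(y_{(j)}^t))},\qquad y_{(k)}^{t+1}=\operatorname*{argmin}_{y\in\mathcal X_\alpha}\ \langle g^t,y\rangle+\frac1{\eta_{(k)}}B_\psi(y;y_{(k)}^t).$$ *)

(* Defs.v *)
From HB Require Import structures.
From mathcomp Require Import all_boot all_order all_algebra.
From mathcomp Require Import all_classical all_reals all_analysis.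

Set Implicit Arguments.
Unset Strict Implicit.
Unset Printing Implicit Defensive.

Import Order.TTheory GRing.Theory Num.Theory.
Import numFieldNormedType.Exports.

Local Open Scope classical_set_scope.
Local Open Scope ring_scope.

(* R^d is 'rV[R]_d.  Time is a 1-based natural number t = 1, ..., T and base
   learners are numbered k = 1, ..., N; sequences indexed by nat are only ever
   constrained on these ranges. *)

Section Geometry.
Context {R : realType} {d : nat}.
Implicit Types (x y : 'rV[R]_d).

Definition dotp x y : R := \sum_(j < d) x 0 j * y 0 j.

Definition l1norm x : R := \sum_(j < d) `|x 0 j|.

Definition l1_ball : set 'rV[R]_d := [set x | l1norm x <= 1].

Definition simplex : set 'rV[R]_d :=
  [set x | (forall j, 0 <= x 0 j) /\ \sum_(j < d) x 0 j = 1].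

Definition barycenter : 'rV[R]_d := \row_(j < d) d%:R^-1.

Definition shrunk_simplex (alpha : R) : set 'rV[R]_d :=
  [set (1 - alpha) *: x + alpha *: barycenter | x in simplex].

Definition sign1 (r : R) : R := if r < 0 then -1 else 1.

Definition signv x : 'rV[R]_d := \row_(j < d) sign1 (x 0 j).

Definition grad (psi : 'rV[R]_d -> R) x : 'rV[R]_d :=
  \row_(j < d) 'D_(delta_mx 0 j) psi x.

Definition bregman (psi : 'rV[R]_d -> R) x y : R :=
  psi x - psi y - dotp (grad psi y) (x - y).

(* The library's [ln 0 = 0] gives the convention 0 log 0 = 0. *)
Definition neg_entropy x : R := \sum_(j < d) x 0 j * ln (x 0 j).

Definition l1_lipschitz (G : R) (U : set 'rV[R]_d) (f : 'rV[R]_d -> R) :=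
  forall x y, U x -> U y -> `|f x - f y| <= G * l1norm (x - y).

Definition is_argmin (X : set 'rV[R]_d) (F : 'rV[R]_d -> R) y :=
  X y /\ forall z, X z -> F y <= F z.

Definition borel : set (set 'rV[R]_d) := <<s [set A | open A] >>.

End Geometry.

Section UniformSphere.
Context {R : realType}.

(* Integral over R^n of a nonnegative Borel function of n real variables, as an
   iterated one-dimensional Lebesgue integral (Tonelli). *)
Fixpoint lebesgue_int (n : nat) (F : seq R -> \bar R) : \bar R :=
  if n is m.+1 then
    (\int[@lebesgue_measure R]_(x in setT) lebesgue_int m (fun v => F (x :: v)))%E
  else F [::].

(* Surface area of the part of the l1-sphere that lies in A.  The sphere is the
   union of the graphs of v |-> 1 - |v|_1 and v |-> -(1 - |v|_1) over the unit
   l1-ball of R^(d-1); both functions have gradient with entries +1 or -1 almost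
   everywhere, so the area element sqrt (1 + |gradient|_2^2) dv is
   sqrt d dv. *)
Definition l1_sphere_area (d : nat) (A : set 'rV[R]_d) : \bar R :=
  lebesgue_int d.-1 (fun v =>
    let r := \sum_(a <- v) `|a| in
    let pt z : 'rV[R]_d := \row_(j < d) (rcons v z)`_j in
    (if r <= 1 then
       Num.sqrt d%:R * (\1_A (pt (1 - r)) + \1_A (pt (- (1 - r))))
     else 0)%:E).

Definition l1_sphere_uniform (d : nat) (A : set 'rV[R]_d) : R :=
  fine (l1_sphere_area A) / fine (l1_sphere_area [set: 'rV[R]_d]).

End UniformSphere.

Section Randomness.
Context {disp : measure_display} {Omega : measurableType disp} {R : realType}.
Context {d : nat}.
Variables (P : probability Omega R) (T : nat).

(* s 1, ..., s T are independent draws from the uniform distribution on the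
   l1-sphere.  Taking some of the A t equal to the whole space gives the product
   rule for every subfamily. *)
Record uniform_draws (s : nat -> Omega -> 'rV[R]_d) : Prop := UniformDraws {
  draws_measurable : forall t A, (1 <= t <= T)%N -> borel A ->
    measurable (s t @^-1` A);
  draws_uniform : forall t A, (1 <= t <= T)%N -> borel A ->
    P (s t @^-1` A) = (l1_sphere_uniform A)%:E;
  draws_independent : forall A : nat -> set 'rV[R]_d, (forall t, borel (A t)) ->
    fine (P (\bigcap_(t in [set t | (1 <= t <= T)%N]) (s t @^-1` A t))) =
    \prod_(1 <= t < T.+1) fine (P (s t @^-1` A t))
}.

(* The sigma-algebra generated by s 1, ..., s (t - 1). *)
Definition past (s : nat -> Omega -> 'rV[R]_d) (t : nat) : set (set Omega) :=
  <<s [set E | exists i A, [/\ (1 <= i < t)%N, borel A & E = s i @^-1` A]] >>.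

(* The adversary may choose the t-th loss after seeing the first t - 1 rounds,
   hence as a function of s 1, ..., s (t - 1).  Losses fixed in advance are those
   not depending on the sample point. *)
Definition nonanticipating (s : nat -> Omega -> 'rV[R]_d)
    (f : nat -> Omega -> 'rV[R]_d -> R) :=
  forall t, (1 <= t <= T)%N -> forall (x : 'rV[R]_d) (B : set R),
    measurable B -> past s t [set w | B (f t w x)].

End Randomness.

(* One run of PBMD, for a given sequence s of sampled directions.
   yb k t and om k t are the iterate and the weight of base learner k at
   time t. *)
Record PBMD_run (R : realType) (d T : nat) (mu gamma : R) (N : nat)
    (eta : nat -> R) (psi : 'rV[R]_d -> R) (X : set 'rV[R]_d) (y1 : 'rV[R]_d)
    (f : nat -> 'rV[R]_d -> R) (s xp xm y g : nat -> 'rV[R]_d)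
    (yb : nat -> nat -> 'rV[R]_d) (om : nat -> nat -> R) : Prop := PBMDRun {
  run_init_iterate : forall k, (1 <= k <= N)%N -> yb k 1%N = y1;
  run_init_weight : forall k, (1 <= k <= N)%N ->
    om k 1%N = N.+1%:R / N%:R * (k * k.+1)%:R^-1;
  run_average : forall t, (1 <= t <= T)%N ->
    y t = \sum_(1 <= k < N.+1) om k t *: yb k t;
  run_plus : forall t, (1 <= t <= T)%N -> xp t = y t + mu *: s t;
  run_minus : forall t, (1 <= t <= T)%N -> xm t = y t - mu *: s t;
  run_gradient : forall t, (1 <= t <= T)%N ->
    g t = (d%:R / (2 * mu) * (f t (xp t) - f t (xm t))) *: signv (s t);
  run_weight : forall t k, (1 <= t <= T)%N -> (1 <= k <= N)%N ->
    let phi z := dotp (g t) (z - y t) in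
    om k t.+1 = om k t * expR (- gamma * phi (yb k t)) /
      \sum_(1 <= j < N.+1) om j t * expR (- gamma * phi (yb j t));
  run_iterate : forall t k, (1 <= t <= T)%N -> (1 <= k <= N)%N ->
    is_argmin X (fun z => dotp (g t) z + (eta k)^-1 * bregman psi z (yb k t))
      (yb k t.+1)
}.

(* Main.v *)
(* Pathwise, exponential weights over a dyadic grid of step sizes lose only
   log N / gamma against the mirror-descent learner whose step size suits the
   path length, and on the shrunk simplex the gradient of the entropy is bounded
   by log (d / alpha), so that moving comparators cost that much times their path
   length.  It remains to control the estimator g^t in expectation.
   Bias: for convex f, the increment over a shift v of the integral of f over the
   unit l1-ball dominates the integral over the l1-sphere of f z <sign z, v>.
   This form of the divergence theorem follows from one-dimensional convexity in
   each coordinate, without differentiability; applied to z |-> f (y + mu z) and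
   to z |-> f (y - mu z) it gives
   f_t y - f_t u <= E [<g^t, y - u> | past] + 2 G mu.
   Variance: the two-point difference is odd in s^t and changes by at most
   4 G mu |s_j| when the sign of s_j is flipped, so the Efron-Stein inequality
   over the signs and E s_j^2 = 2 / (d (d + 1)) give
   E max_j |g^t_j|^2 <= 2 d G^2. *)

Require Import Defs.
From HB Require Import structures.
From mathcomp Require Import all_boot all_order all_algebra.
From mathcomp Require Import all_classical all_reals all_analysis.
From mathcomp Require Import measurable_realfun ring lra.

Set Implicit Arguments.
Unset Strict Implicit.
Unset Printing Implicit Defensive.

Import Order.TTheory GRing.Theory Num.Theory.
Import numFieldNormedType.Exports.

Local Open Scope classical_set_scope.
Local Open Scope ring_scope.

(** * Borel vectors and convex functions *)

(** Three obstacles shape the development. The sphere law is an iterated integral, so moments and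
    the divergence inequality are proved for recursively defined integrals, by induction on the
    dimension. The last coordinate is determined by the others up to sign; in the plane, exchanging
    it with the integrated one is a change of variable, not an application of Tonelli. Next, the
    iterates are specified only as minimisers, which says nothing about their measurability: the
    minimiser is shown to be a Lipschitz function of [ln y - eta * g], hence every iterate is a
    measurable function of the earlier draws, and independence then allows the past to be frozen
    while the current draw is integrated out. Finally, the losses are Lipschitz on [U] alone while
    comparators may lie outside it, so the regret is only bounded above and is compared with an
    integrable majorant. Two sources produce the logarithms in the rate: [1 / alpha] is at most
    [5 T], so [ln (d / alpha)] costs a factor of order [ln d ln T] under the root, and the selection
    among the learners costs [ln N], which is bounded crudely by a multiple of [sqrt (ln T)]. *)

Notation borel_rV R d := (g_sigma_algebraType [set A : set 'rV[R]_d | open A]).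

Section borel_vectors.
Context {R : realType}.
Local Notation RR := (measurableTypeR R).

Definition rat_cube d (qk : 'rV[rat]_d * nat) : set 'rV[R]_d :=
  [set y | forall j, `|y 0 j - ratr (qk.1 0 j)| < qk.2.+1%:R^-1].

(** Rational centres and radii [1/(k+1)] form a countable base of the topology; this is what reduces
    measurability of vectors to that of their coordinates. *)
Lemma open_rat_cube d (A : set 'rV[R]_d) x : open A -> A x ->
  exists qk, rat_cube qk x /\ rat_cube qk `<=` A.
Proof.
move=> oA Ax; have /nbhs_ballP[e /= e0 eA] : nbhs x A by exact: open_nbhs_nbhs.
have [k ke] : exists k : nat, k.+1%:R^-1 < e / 2.
  have e20 : 0 < e / 2 by rewrite divr_gt0.
  have [k _ /(_ k (leqnn k))] := near_infty_natSinv_lt (PosNum e20).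
  by exists k.
have /choice[q qP] : forall j, exists q : rat, `|x 0 j - ratr q| < k.+1%:R^-1.
  move=> j; have : x 0 j - k.+1%:R^-1 < x 0 j + k.+1%:R^-1.
    by rewrite ltrD2l gtrN// invr_gt0.
  by move=> /rat_in_itvoo[q]; rewrite in_itv/= -ltr_distlC => xq; exists q.
exists (\row_j q j, k); split => [j|y /= yq]; first by rewrite mxE.
apply: eA; split => // i j; rewrite ord1 /ball/= .
rewrite -(subrK (ratr (q j)) (x 0 j)) -addrA.
apply: (le_lt_trans (ler_normD _ _)).
have := yq j; rewrite /= mxE distrC => yj; have xj := qP j.
by rewrite [ltRHS]splitr; apply: ltrD; exact: lt_trans ke.
Qed.

Lemma measurable_rV dX (X : measurableType dX) d (h : X -> 'rV[R]_d) :
  (forall j, measurable_fun setT (fun x => h x 0 j : RR)) ->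
  measurable_fun setT (h : X -> borel_rV R d).
Proof.
move=> mh; apply: (@measurability _ _ X (borel_rV R d) setT h [set A : set 'rV[R]_d | open A]) => //.
move=> _ [A oA <-]; rewrite setTI.
(* An open set is the countable union of the rational cubes that it contains; the other cubes
   contribute the empty set. *)
have -> : h @^-1` A = \bigcup_(qk in setT)
    (if `[< rat_cube qk `<=` A >] then h @^-1` (rat_cube qk) else set0).
  apply/seteqP; split => [x Ax|x [qk _]].
    by have [qk [qx qA]] := open_rat_cube oA Ax; exists qk => //; rewrite asboolT.
  by case: ifPn => // /asboolP qA /qA.
apply: countable_bigcupT_measurable => // qk; case: ifPn => // _.
have -> : h @^-1` (rat_cube qk) = \bigcap_(j in setT)
   [set x | `|h x 0 j - ratr (qk.1 0 j)| < qk.2.+1%:R^-1].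
  by apply/seteqP; split => [x Ax j _|x Ax j]; exact: Ax.
apply: fin_bigcap_measurable => // j _.
have mlt : measurable_fun setT
    (fun x => `|h x 0 j - ratr (qk.1 0 j)| < qk.2.+1%:R^-1).
  apply: measurable_fun_ltr => //.
  by apply: measurableT_comp => //; apply: measurable_funB => //; exact: mh.
by have := mlt measurableT [set true]; rewrite setTI; exact.
Qed.

Lemma continuous_measurable_rV d (h : 'rV[R]_d -> R) : continuous h ->
  measurable_fun setT (h : borel_rV R d -> R).
Proof.
move=> ch; apply: (@measurability _ _ (borel_rV R d) RR setT h (@RGenOInfty.G R)).
  exact: RGenOInfty.measurableE.
move=> _ [_ [a ->] <-]; rewrite setTI; apply: sub_sigma_algebra => /=.
by apply: open_comp => [x _|]; [exact: ch|exact: interval_open].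
Qed.

Lemma measurable_coord d (j : 'I_d) :
  measurable_fun setT (fun v : borel_rV R d => v 0 j : R).
Proof. by apply: continuous_measurable_rV => v; exact: coord_continuous. Qed.

Lemma measurable_coord_comp dX (X : measurableType dX) d (h : X -> borel_rV R d) j :
  measurable_fun setT h -> measurable_fun setT (fun x => h x 0 j : R).
Proof. by move=> mh; exact: (measurableT_comp (measurable_coord j) mh). Qed.

End borel_vectors.

(** Stands in for the limit [h -> 0] in first-order arguments. Restricting to [h <= 1] lets [h]
    serve as the weight of a convex combination. *)
Lemma ler_linear_eps (R : realType) (a b c : R) :
  (forall h, 0 < h <= 1 -> a <= b + h * c) -> a <= b.
Proof.
move=> abc; apply/ler_addgt0Pr => e e0.
have c1 : 0 < `|c| + 1 by rewrite ltr_wpDl.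
pose h := Num.min 1 (e / (`|c| + 1)).
have h0 : 0 < h by rewrite lt_min ltr01 divr_gt0.
have h1 : h <= 1 by rewrite ge_min lexx.
have he : h <= e / (`|c| + 1) by rewrite ge_min lexx orbT.
apply: (le_trans (abc h _)); first by rewrite h0 h1.
rewrite lerD2l (le_trans (ler_norm _))// normrM (gtr0_norm h0).
move: he; rewrite ler_pdivlMr//; have := normr_ge0 c; nra.
Qed.

Section l1_norm.
Context {R : realType} {d : nat}.
Implicit Types (x y z : 'rV[R]_d) (a : R).

Lemma l1norm_ge0 x : 0 <= l1norm x.
Proof. exact: sumr_ge0. Qed.

Lemma l1normN x : l1norm (- x) = l1norm x.
Proof. by apply: eq_bigr => j _; rewrite mxE normrN. Qed.

Lemma l1normZ a x : l1norm (a *: x) = `|a| * l1norm x.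
Proof. by rewrite /l1norm mulr_sumr; apply: eq_bigr => j _; rewrite mxE normrM. Qed.

Lemma l1normD x y : l1norm (x + y) <= l1norm x + l1norm y.
Proof. by rewrite -big_split/=; apply: ler_sum => j _; rewrite mxE ler_normD. Qed.

Lemma l1normB x y : l1norm (x - y) <= l1norm x + l1norm y.
Proof. by rewrite -(l1normN y) l1normD. Qed.

Lemma l1norm0 : l1norm (0 : 'rV[R]_d) = 0.
Proof. by rewrite /l1norm big1// => j _; rewrite mxE normr0. Qed.

Lemma l1norm_le_coord x a : (forall j, `|x 0 j| <= a) -> l1norm x <= d%:R * a.
Proof.
move=> xa; apply: (@le_trans _ _ (\sum_(j < d) a)); first exact: ler_sum.
by rewrite sumr_const card_ord mulr_natl.
Qed.

Lemma dotp_le (g x : 'rV[R]_d) M : (forall j, `|g 0 j| <= M) ->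
  `|dotp g x| <= M * l1norm x.
Proof.
move=> gM; apply: (le_trans (ler_norm_sum _ _ _)); rewrite mulr_sumr.
by apply: ler_sum => j _; rewrite normrM ler_wpM2r.
Qed.

Lemma dotpBr (g x y : 'rV[R]_d) : dotp g (x - y) = dotp g x - dotp g y.
Proof. by rewrite -sumrB; apply: eq_bigr => j _; rewrite !mxE mulrBr. Qed.

Lemma dotpZl a (g x : 'rV[R]_d) : dotp (a *: g) x = a * dotp g x.
Proof. by rewrite mulr_sumr; apply: eq_bigr => j _; rewrite mxE mulrA. Qed.

Lemma rV_sum_coord x : x = \sum_(j < d) x 0 j *: delta_mx 0 j.
Proof. by rewrite {1}(row_sum_delta x). Qed.

End l1_norm.

(** * Convexity: Jensen's inequality, local Lipschitz bounds, continuity *)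

Section convex_functions.
Context {R : realType} {d : nat}.
Implicit Types (x y z : 'rV[R]_d) (f : 'rV[R]_d -> R).

Definition cvx f := forall x y (t : R), 0 <= t <= 1 ->
  f (t *: x + (1 - t) *: y) <= t * f x + (1 - t) * f y.

Lemma convex_function_cvx f : convex_function setT f -> cvx f.
Proof.
move=> cf x y t t01; have := cf (Itv01 (proj1 (andP t01)) (proj2 (andP t01))) x y.
by rewrite !inE => /(_ I I).
Qed.

Lemma cvx_shift f a (c : R) : cvx f -> cvx (fun x => f (a + c *: x)).
Proof.
move=> cf x y t t01; have := cf (a + c *: x) (a + c *: y) t t01.
congr (f _ <= _); apply/rowP => j; rewrite !mxE; ring.
Qed.

(** The mass missing from the weights is placed at the origin, where [f] is nonpositive. The
    induction splits off one weight and renormalises the others by [1 - w i], so a weight equal to 1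
    needs its own case. *)
Lemma cvx_jensen f (I : Type) (r : seq I) (w : I -> R) (x : I -> 'rV[R]_d) :
  cvx f -> f 0 <= 0 -> (forall i, 0 <= w i) -> \sum_(i <- r) w i <= 1 ->
  f (\sum_(i <- r) w i *: x i) <= \sum_(i <- r) w i * f (x i).
Proof.
move=> cf f0 w0; elim: r w w0 => [|i r IH] w w0; first by rewrite !big_nil.
rewrite !big_cons => w1.
have wi1 : w i <= 1.
  by apply: le_trans w1; rewrite lerDl sumr_ge0.
have [wi|wi] := eqVneq (w i) 1.
  have sw0 : \sum_(j <- r) w j = 0.
    by apply/eqP; rewrite eq_le sumr_ge0// andbT; move: w1; rewrite wi gerDl.
  have wf (h : I -> R) : \sum_(j <- r) w j * h j = 0.
    elim: r {IH w1} sw0 => [|k r IH]; first by rewrite !big_nil.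
    rewrite !big_cons => /eqP; rewrite paddr_eq0// ?sumr_ge0// => /andP[/eqP-> /eqP/IH->].
    by rewrite mul0r addr0.
  have -> : \sum_(j <- r) w j *: x j = 0.
    apply/rowP => k; rewrite summxE mxE -[RHS](wf (fun j => x j 0 k)).
    by apply: eq_bigr => j _; rewrite mxE.
  by rewrite wf !addr0 wi scale1r mul1r.
have wi0 : 0 < 1 - w i by rewrite subr_gt0 lt_neqAle wi.
pose w' j := w j / (1 - w i).
have w'0 j : 0 <= w' j by rewrite divr_ge0// ltW.
have w'1 : \sum_(j <- r) w' j <= 1.
  by rewrite -mulr_suml ler_pdivrMr// mul1r lerBrDl.
have := cf (x i) (\sum_(j <- r) w' j *: x j) (w i); rewrite w0 wi1 => /(_ isT).
rewrite scaler_sumr.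
have -> : \sum_(j <- r) (1 - w i) *: (w' j *: x j) = \sum_(j <- r) w j *: x j.
  by apply: eq_bigr => j _; rewrite scalerA mulrC mulfVK// gt_eqF.
move=> h; apply: (le_trans h); rewrite lerD2l.
apply: (@le_trans _ _ ((1 - w i) * \sum_(j <- r) w' j * f (x j))).
  by rewrite ler_wpM2l ?IH// ltW.
rewrite mulr_sumr; apply: ler_sum => j _.
by rewrite mulrA [X in X * _]mulrC mulfVK// gt_eqF.
Qed.

(** A point of the l1-ball around [x] is a convex combination of [x] and the [2d] vertices
    [x + r e_j], [x - r e_j], so Jensen bounds the increment from above. The lower bound follows
    because [x] is the midpoint of [x + z] and [x - z]. *)
Lemma cvx_local_lipschitz f x (r : R) : cvx f -> 0 < r ->
  exists2 M, 0 <= M & forall z, l1norm z <= r ->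
    `|f (x + z) - f x| <= l1norm z / r * M.
Proof.
move=> cf r0.
pose e j : 'rV[R]_d := r *: delta_mx 0 j.
pose M := \sum_(j < d) (`|f (x + e j) - f x| + `|f (x - e j) - f x|).
have M0 : 0 <= M by apply: sumr_ge0 => j _; rewrite addr_ge0.
exists M => //.
have up z : l1norm z <= r -> f (x + z) - f x <= l1norm z / r * M.
  move=> zr; pose g y := f (x + 1 *: y) - f x.
  have cg : cvx g.
    move=> a b t t01; rewrite /g.
    by have := cvx_shift x 1 cf a b t01; lra.
  have g0 : g 0 <= 0 by rewrite /g scaler0 addr0 subrr.
  pose w j := `|z 0 j| / r.
  pose y j := if 0 <= z 0 j then e j else - e j.
  have zE : z = \sum_(j < d) w j *: y j.
    rewrite [LHS]rV_sum_coord; apply: eq_bigr => j _; rewrite /w /y /e.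
    case: ifPn => z0; first by rewrite scalerA ger0_norm// mulfVK ?gt_eqF.
    rewrite ltr0_norm ?ltNge// scalerN scalerA -scaleNr; congr (_ *: _).
    by field; rewrite gt_eqF.
  have w0 j : 0 <= w j by rewrite divr_ge0// ltW.
  have w1 : \sum_(j < d) w j <= 1 by rewrite -mulr_suml ler_pdivrMr// mul1r.
  have := @cvx_jensen g _ (index_enum 'I_d) w y cg g0 w0 w1.
  rewrite -zE /g scale1r => /le_trans; apply.
  rewrite -/(l1norm z) /l1norm !mulr_suml; apply: ler_sum => j _.
  rewrite -/(w j) ler_wpM2l// scale1r.
  apply: (@le_trans _ _ (`|f (x + e j) - f x| + `|f (x - e j) - f x|)).
    by rewrite /y; case: ifPn => _; rewrite (le_trans (ler_norm _))// ?lerDl ?lerDr.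
  by rewrite /M (bigD1 j)//= lerDl sumr_ge0// => k _; rewrite addr_ge0.
move=> z zr; rewrite ler_norml up// andbT lerNl.
have := up (- z); rewrite l1normN => /(_ zr).
have h01 : 0 <= (1 / 2 : R) <= 1 by lra.
have := cf (x + z) (x - z) (1 / 2 : R) h01.
have -> : (1 / 2 : R) *: (x + z) + (1 - 1 / 2) *: (x - z) = x.
  by apply/rowP => j; rewrite !mxE; lra.
by lra.
Qed.

Lemma cvx_continuous f : cvx f -> continuous f.
Proof.
move=> cf x; have [M M0 fM] := cvx_local_lipschitz x cf ltr01.
move=> A /nbhs_ballP[e /= e0 eA].
have d0 : 0 < d%:R * (1 + M) + 1 :> R.
  by rewrite ltr_pwDr// mulr_ge0// addr_ge0.
pose del := Num.min 1 e / (d%:R * (1 + M) + 1).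
have del0 : 0 < del by rewrite divr_gt0// lt_min ltr01.
apply/nbhs_ballP; exists del => //= y [_ xy]; apply: eA; rewrite /ball/=.
have yx : l1norm (y - x) <= d%:R * del.
  apply: l1norm_le_coord => j; rewrite !mxE distrC ltW//.
  exact: (xy 0 j).
have m1 : Num.min 1 e <= 1 by rewrite ge_min lexx.
have me : Num.min 1 e <= e by rewrite ge_min lexx orbT.
have m0 : 0 < Num.min 1 e by rewrite lt_min ltr01.
have yx1 : l1norm (y - x) * (1 + M) < Num.min 1 e.
  apply: (@le_lt_trans _ _ (d%:R * del * (1 + M))).
    by rewrite ler_wpM2r// addr_ge0.
  rewrite /del mulrAC mulrA ltr_pdivrMr// mulrC ltr_pM2l// mulrC.
  by rewrite ltrDl.
have l0 := l1norm_ge0 (y - x).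
have yx2 : l1norm (y - x) <= 1.
  have := mulr_ge0 l0 M0; lra.
have := fM (y - x) yx2; rewrite (addrC x) subrK distrC divr1.
have := mulr_ge0 l0 M0; lra.
Qed.

Lemma cvx_bounded f (r : R) : cvx f ->
  exists2 M, 0 <= M & forall z, l1norm z <= r -> `|f z| <= M.
Proof.
move=> cf; pose r' := `|r| + 1.
have r0 : 0 < r' by rewrite ltr_wpDl.
have [M M0 fM] := cvx_local_lipschitz 0 cf r0.
exists (`|f 0| + M); first by rewrite addr_ge0.
move=> z zr; have zr' : l1norm z <= r'.
  by rewrite (le_trans zr)// (le_trans (ler_norm _))// lerDl.
have := fM z zr'; rewrite add0r => h.
rewrite -[f z](subrK (f 0)) addrC (le_trans (ler_normD _ _))// lerD2l (le_trans h)//.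
by rewrite ler_piMl// ler_pdivrMr// mul1r.
Qed.

End convex_functions.

(** * Iterated integrals over the ball and the sphere *)

Section lebesgue_invariance.
Local Open Scope ereal_scope.
Context {R : realType}.
Local Notation mu := (@lebesgue_measure R).
Local Notation RR := (measurableTypeR R).

Lemma pushforward_shift (c : R) (A : set R) : measurable A ->
  pushforward mu ((fun x => x + c)%R : RR -> RR) A = mu A.
Proof.
move=> mA; have mc : measurable_fun setT ((fun x => x + c)%R : RR -> RR).
  exact: measurable_funD.
apply/esym/lebesgue_measure_unique => //= _ [[a b]] _ <-.
rewrite /pushforward.
have -> : (fun x : R => x + c)%R @^-1` [set` `]a, b]] = `](a - c)%R, (b - c)%R]%classic.
  by apply/seteqP; split => x /=; rewrite !in_itv/= ltrBlDr lerBrDr.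
rewrite !lebesgue_measure_itv/= !lte_fin ltrD2r.
by case: ifPn => // _; rewrite -!EFinB; congr (_%:E); ring.
Qed.

Lemma ge0_integral_shift (c : R) (F : R -> \bar R) :
  measurable_fun setT F -> (forall x, 0 <= F x) ->
  \int[mu]_x F (x + c)%R = \int[mu]_x F x.
Proof.
move=> mF F0; have mc : measurable_fun setT ((fun x => x + c)%R : RR -> RR).
  exact: measurable_funD.
transitivity (\int[pushforward mu ((fun x => x + c)%R : RR -> RR)]_x F x).
  by rewrite ge0_integral_pushforward// preimage_setT.
by apply: eq_measure_integral => A mA _; exact: pushforward_shift.
Qed.

Lemma ge0_integralN (F : R -> \bar R) :
  measurable_fun setT F -> (forall x, 0 <= F x) ->
  \int[mu]_x F (- x)%R = \int[mu]_x F x.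
Proof.
move=> mF F0.
transitivity (\int[pushforward mu (-%R : RR -> RR)]_x F x).
  by rewrite ge0_integral_pushforward// preimage_setT.
by apply: eq_measure_integral => A mA _; exact: lebesgue_measureN.
Qed.

Lemma ge0_integral_refl (c : R) (F : R -> \bar R) :
  measurable_fun setT F -> (forall x, 0 <= F x) ->
  \int[mu]_x F (c - x)%R = \int[mu]_x F x.
Proof.
move=> mF F0.
rewrite -(ge0_integralN mF F0) -(@ge0_integral_shift (- c) (fun x => F (- x)%R)) //.
  by apply: eq_integral => x _; rewrite opprB.
exact: measurableT_comp mF _.
Qed.

End lebesgue_invariance.

Section iterated_integrals.
Local Open Scope ereal_scope.
Context {R : realType}.
Local Notation mu := (@lebesgue_measure R).
Local Notation RR := (measurableTypeR R).

(** Integral over the l1-sphere of radius [rho] in dimension [n.+1], with respect to surface measure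
    divided by the square root of the dimension. [rho] is the radius left for the remaining
    coordinates; giving 0 once it is negative encodes the domain, so every coordinate ranges over
    the whole line and proofs go by induction on [n]. The lists have [n.+1] entries here and [n]
    entries in [ball_int]. *)
Fixpoint sphere_int (n : nat) (rho : R) (F : seq R -> \bar R) : \bar R :=
  if n is m.+1 then
    \int[mu]_x sphere_int m (rho - `|x|)%R (fun l => F (x :: l))
  else if (0 <= rho)%R then F [:: rho] + F [:: (- rho)%R] else 0.

Fixpoint ball_int (n : nat) (rho : R) (F : seq R -> \bar R) : \bar R :=
  if n is m.+1 then
    \int[mu]_x ball_int m (rho - `|x|)%R (fun l => F (x :: l))
  else if (0 <= rho)%R then F [::] else 0.

(* [F x] is jointly measurable in [x] and the first [n] entries of its list
   argument. *)
Fixpoint measurable_args (n : nat) d (X : measurableType d)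
    (F : X -> seq R -> \bar R) : Prop :=
  if n is m.+1 then
    @measurable_args m _ (X * RR)%type (fun p l => F p.1 (p.2 :: l))
  else measurable_fun setT (fun x => F x [::]).

Lemma measurable_args_comp n d (X : measurableType d) d' (Y : measurableType d')
    (phi : Y -> X) (F : X -> seq R -> \bar R) :
  measurable_fun setT phi -> measurable_args n F ->
  measurable_args n (F \o phi).
Proof.
elim: n d X d' Y phi F => [|n IH] d X d' Y phi F mphi /= mF.
  exact: (measurableT_comp mF mphi).
apply: (IH _ _ _ _ (fun p : Y * RR => (phi p.1, p.2)) _ _ mF).
by apply: measurable_fun_pair => //=; exact: measurableT_comp.
Qed.

Lemma sphere_int_ge0 n rho F : (forall l, 0 <= F l) -> 0 <= sphere_int n rho F.
Proof.
elim: n rho F => [|n IH] rho F F0 /=; first by case: ifPn => // _; rewrite adde_ge0.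
by apply: integral_ge0 => x _; exact: IH.
Qed.

Lemma ball_int_ge0 n rho F : (forall l, 0 <= F l) -> 0 <= ball_int n rho F.
Proof.
elim: n rho F => [|n IH] rho F F0 /=; first by case: ifPn.
by apply: integral_ge0 => x _; exact: IH.
Qed.

(** The parameter space is arbitrary because each integration variable becomes one more parameter
    for the inner integral; the outer integral is then measurable by Tonelli. *)
Lemma measurable_sphere_int n d (X : measurableType d) (rho : X -> R)
    (F : X -> seq R -> \bar R) :
  (forall x l, 0 <= F x l) -> measurable_fun setT rho ->
  measurable_args n.+1 F ->
  measurable_fun setT (fun x => sphere_int n (rho x) (F x)).
Proof.
elim: n d X rho F => [|n IH] d X rho F F0 mrho mF /=.
  apply: measurable_fun_ifT => //=.
    exact: measurable_fun_ler.
  have h (g : X -> RR) : measurable_fun setT g ->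
      measurable_fun setT (fun x => F x [:: g x]).
    move=> mg; have := @measurableT_comp _ _ _ _ _ _ _ _ (fun x => (x, g x)) mF.
    apply; exact: measurable_fun_pair.
  apply: emeasurable_funD; apply: h => //.
  exact: measurableT_comp.
pose G := fun p : X * RR => sphere_int n (rho p.1 - `|p.2|)%R (fun l => F p.1 (p.2 :: l)).
apply: (@measurable_fun_fubini_tonelli_F _ _ _ _ _ mu G).
- apply: IH => //.
  by apply: measurable_funB; exact: measurableT_comp.
- by move=> p; apply: sphere_int_ge0.
Qed.

Lemma measurable_ball_int n d (X : measurableType d) (rho : X -> R)
    (F : X -> seq R -> \bar R) :
  (forall x l, 0 <= F x l) -> measurable_fun setT rho ->
  measurable_args n F ->
  measurable_fun setT (fun x => ball_int n (rho x) (F x)).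
Proof.
elim: n d X rho F => [|n IH] d X rho F F0 mrho mF /=.
  apply: measurable_fun_ifT => //=.
  exact: measurable_fun_ler.
pose G := fun p : X * RR => ball_int n (rho p.1 - `|p.2|)%R (fun l => F p.1 (p.2 :: l)).
apply: (@measurable_fun_fubini_tonelli_F _ _ _ _ _ mu G).
- apply: IH => //.
  by apply: measurable_funB; exact: measurableT_comp.
- by move=> p; apply: ball_int_ge0.
Qed.

End iterated_integrals.

Section iterated_integral_theory.
Local Open Scope ereal_scope.
Context {R : realType}.
Local Notation mu := (@lebesgue_measure R).
Local Notation RR := (measurableTypeR R).
Implicit Types (F G : seq R -> \bar R) (rho : R).

Definition measurable_list (n : nat) F :=
  measurable_args n (fun _ : unit => F).

Lemma measurable_list_cons n F x :
  measurable_list n.+1 F -> measurable_list n (fun l => F (x :: l)).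
Proof.
move=> mF; pose phi := fun _ : unit => (tt, x) : unit * RR.
exact: (@measurable_args_comp _ _ _ _ _ _ phi _ _ mF).
Qed.

Lemma measurable_list_swap n F : measurable_list n.+2 F ->
  measurable_list n.+2
    (fun l => if l is x :: y :: l' then F (y :: x :: l') else F l).
Proof.
move=> mF.
pose phi := fun p : unit * RR * RR => ((p.1.1, p.2), p.1.2) : unit * RR * RR.
have mphi : measurable_fun setT phi.
  apply: measurable_fun_pair; last exact: measurableT_comp.
  by apply: measurable_fun_pair => //; exact: measurableT_comp.
exact: (measurable_args_comp mphi mF).
Qed.

Lemma measurable_sphere_slice n rho F : (forall l, 0 <= F l) ->
  measurable_list n.+2 F ->
  measurable_fun setT
    (fun x : RR => sphere_int n (rho - `|x|)%R (fun l => F (x :: l))).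
Proof.
move=> F0 mF.
pose G := fun p : unit * RR =>
  sphere_int n (rho - `|p.2|)%R (fun l => F (p.2 :: l)).
have mG : measurable_fun setT G.
  apply: measurable_sphere_int => //.
  by apply: measurable_funB => //; exact: measurableT_comp.
apply: (@measurableT_comp _ _ _ _ _ _ G _ (fun x => (tt, x)) mG).
exact: measurable_fun_pair.
Qed.

Lemma measurable_ball_slice n rho F : (forall l, 0 <= F l) ->
  measurable_list n.+1 F ->
  measurable_fun setT
    (fun x : RR => ball_int n (rho - `|x|)%R (fun l => F (x :: l))).
Proof.
move=> F0 mF.
pose G := fun p : unit * RR =>
  ball_int n (rho - `|p.2|)%R (fun l => F (p.2 :: l)).
have mG : measurable_fun setT G.
  apply: measurable_ball_int => //.
  by apply: measurable_funB => //; exact: measurableT_comp.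
apply: (@measurableT_comp _ _ _ _ _ _ G _ (fun x => (tt, x)) mG).
exact: measurable_fun_pair.
Qed.

Lemma sphere_intD n rho F G :
  (forall l, 0 <= F l) -> (forall l, 0 <= G l) ->
  measurable_list n.+1 F -> measurable_list n.+1 G ->
  sphere_int n rho (F \+ G) = sphere_int n rho F + sphere_int n rho G.
Proof.
elim: n rho F G => [|n IH] rho F G F0 G0 mF mG /=.
  by case: ifPn => _; rewrite ?adde0// addeACA.
rewrite -ge0_integralD//; try by [exact: measurable_sphere_slice | move=> *; exact: sphere_int_ge0].
by apply: eq_integral => x _; rewrite -IH//; exact: measurable_list_cons.
Qed.

Lemma ball_intD n rho F G :
  (forall l, 0 <= F l) -> (forall l, 0 <= G l) ->
  measurable_list n F -> measurable_list n G ->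
  ball_int n rho (F \+ G) = ball_int n rho F + ball_int n rho G.
Proof.
elim: n rho F G => [|n IH] rho F G F0 G0 mF mG /=.
  by case: ifPn => _; rewrite ?adde0// addeACA.
rewrite -ge0_integralD//; try by [exact: measurable_ball_slice | move=> *; exact: ball_int_ge0].
by apply: eq_integral => x _; rewrite -IH//; exact: measurable_list_cons.
Qed.

Lemma sphere_intZ n rho F (k : R) : (0 <= k)%R ->
  (forall l, 0 <= F l) -> measurable_list n.+1 F ->
  sphere_int n rho (fun l => k%:E * F l) = k%:E * sphere_int n rho F.
Proof.
move=> k0; elim: n rho F => [|n IH] rho F F0 mF /=.
  by case: ifPn => _; rewrite ?mule0// ge0_muleDr.
rewrite -ge0_integralZl_EFin//; try by [exact: measurable_sphere_slice | move=> *; exact: sphere_int_ge0].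
by apply: eq_integral => x _; rewrite -IH//; exact: measurable_list_cons.
Qed.

Lemma ball_intZ n rho F (k : R) : (0 <= k)%R ->
  (forall l, 0 <= F l) -> measurable_list n F ->
  ball_int n rho (fun l => k%:E * F l) = k%:E * ball_int n rho F.
Proof.
move=> k0; elim: n rho F => [|n IH] rho F F0 mF /=.
  by case: ifPn => _; rewrite ?mule0// ge0_muleDr.
rewrite -ge0_integralZl_EFin//; try by [exact: measurable_ball_slice | move=> *; exact: ball_int_ge0].
by apply: eq_integral => x _; rewrite -IH//; exact: measurable_list_cons.
Qed.

(** Each integrated entry consumes its absolute value of the radius and the last one exhausts it.
    Facts that hold on the sphere alone can therefore be integrated. *)
Lemma le_sphere_int n rho F G :
  (forall l, 0 <= F l) -> (forall l, 0 <= G l) ->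
  measurable_list n.+1 F -> measurable_list n.+1 G ->
  (forall l, size l = n.+1 -> (\sum_(a <- l) `|a| = rho)%R -> F l <= G l) ->
  sphere_int n rho F <= sphere_int n rho G.
Proof.
elim: n rho F G => [|n IH] rho F G F0 G0 mF mG FG /=.
  case: ifPn => // r0; apply: leeD; apply: FG => //.
    by rewrite big_seq1 ger0_norm.
  by rewrite big_seq1 normrN ger0_norm.
apply: ge0_le_integral => //; try by [exact: measurable_sphere_slice | move=> *; exact: sphere_int_ge0].
move=> x _; apply: IH => //; try by exact: measurable_list_cons.
by move=> l sl lr; apply: FG; rewrite /= ?sl// big_cons lr addrC subrK.
Qed.

Lemma le_ball_int n rho F G :
  (forall l, 0 <= F l) -> (forall l, 0 <= G l) ->
  measurable_list n F -> measurable_list n G ->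
  (forall l, size l = n -> (\sum_(a <- l) `|a| <= rho)%R -> F l <= G l) ->
  ball_int n rho F <= ball_int n rho G.
Proof.
elim: n rho F G => [|n IH] rho F G F0 G0 mF mG FG /=.
  by case: ifPn => // r0; apply: FG => //; rewrite big_nil.
apply: ge0_le_integral => //; try by [exact: measurable_ball_slice | move=> *; exact: ball_int_ge0].
move=> x _; apply: IH => //; try by exact: measurable_list_cons.
move=> l sl lr; apply: FG; rewrite /= ?sl// big_cons -lerBrDl//.
Qed.

Lemma eq_ball_int n rho F G :
  (forall l, 0 <= F l) -> (forall l, 0 <= G l) ->
  measurable_list n F -> measurable_list n G ->
  (forall l, size l = n -> F l = G l) ->
  ball_int n rho F = ball_int n rho G.
Proof.
move=> F0 G0 mF mG FG; apply/eqP; rewrite eq_le.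
by apply/andP; split; apply: le_ball_int => // l sl lr; rewrite FG.
Qed.

Lemma eq_measurable_args n dX (X : measurableType dX) (F G : X -> seq R -> \bar R) :
  (forall x l, size l = n -> F x l = G x l) ->
  measurable_args n F -> measurable_args n G.
Proof.
elim: n dX X F G => [|n IH] dX X F G FG /=.
  by congr measurable_fun; apply/funext => x; exact: FG.
by apply: IH => p l ln; apply: FG; rewrite /= ln.
Qed.

Lemma eq_measurable_list n F G : (forall l, size l = n -> F l = G l) ->
  measurable_list n F -> measurable_list n G.
Proof. by move=> FG; apply: eq_measurable_args => _ l; exact: FG. Qed.

(** Monotone convergence, once per integrated coordinate; it carries identities from simple
    functions to all nonnegative measurable functions. *)
Lemma cvg_sphere_int n rho (F_ : nat -> seq R -> \bar R) F :
  (forall k l, 0 <= F_ k l) -> (forall k, measurable_list n.+1 (F_ k)) ->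
  (forall l, nondecreasing_seq (F_ ^~ l)) ->
  (forall l, F_ k l @[k --> \oo] --> F l) ->
  sphere_int n rho (F_ k) @[k --> \oo] --> sphere_int n rho F.
Proof.
elim: n rho F_ F => [|n IH] rho F_ F F0 mF nd cvF /=.
  case: ifPn => _; last exact: cvg_cst.
  have Fge0 l : 0 <= F l.
    have <- := cvg_lim (@ereal_hausdorff R) (cvF l).
    by apply: lime_ge; [apply: cvgP (cvF l)|exact: nearW].
  by apply: cvgeD; [apply: ge0_adde_def; rewrite inE|exact: cvF|exact: cvF].
have -> : (fun x => sphere_int n (rho - `|x|) (fun l => F (x :: l)))%R =
    (fun x => limn (fun k => sphere_int n (rho - `|x|)%R
       (fun l => F_ k (x :: l)))).
  apply/funext => x; apply/esym/cvg_lim => //.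
  by apply: IH => // k; exact: measurable_list_cons.
apply: cvg_monotone_convergence => //.
- by move=> k; exact: measurable_sphere_slice.
- by move=> k x _; exact: sphere_int_ge0.
- move=> x _ k k' kk'; apply: le_sphere_int => //; try by exact: measurable_list_cons.
  by move=> l _ _; exact: nd.
Qed.

End iterated_integral_theory.

(** * Invariance of the ball and sphere integrals under sign flips and coordinate exchanges *)

Section sphere_symmetries.
Local Open Scope ereal_scope.
Context {R : realType}.
Local Notation mu := (@lebesgue_measure R).
Local Notation RR := (measurableTypeR R).
Implicit Types (F G : seq R -> \bar R) (rho : R).

Fixpoint flip_nth (j : nat) (l : seq R) {struct l} : seq R :=
  match l, j with
  | [::], _ => [::]
  | x :: l', 0%N => (- x)%R :: l'
  | x :: l', j'.+1 => x :: flip_nth j' l'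
  end.

Lemma nth_flip_nth j l i :
  ((flip_nth j l)`_i = if i == j then - l`_i else l`_i)%R.
Proof.
elim: l j i => [|x l IH] [|j] [|i] //=; rewrite ?nth_nil ?oppr0 ?if_same//.
by rewrite IH eqSS.
Qed.

Lemma sphere_int_flip n j rho F : (forall l, 0 <= F l) ->
  measurable_list n.+1 F ->
  sphere_int n rho (F \o flip_nth j) = sphere_int n rho F.
Proof.
elim: n j rho F => [|n IH] [|j] rho F F0 mF //=.
- by rewrite opprK addeC.
- transitivity (\int[mu]_x
      (fun x => sphere_int n (rho - `|x|)%R (fun l => F (x :: l))) (- x)%R).
    by apply: eq_integral => x _; rewrite normrN.
  rewrite (@ge0_integralN _ (fun x => sphere_int n (rho - `|x|)%R (fun l => F (x :: l))))//.
    exact: measurable_sphere_slice.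
  by move=> x; exact: sphere_int_ge0.
- apply: eq_integral => x _.
  by rewrite -(IH j _ (fun l => F (x :: l)))//; exact: measurable_list_cons.
Qed.

Lemma ball_int_flip n j rho F : (forall l, 0 <= F l) ->
  measurable_list n F ->
  ball_int n rho (F \o flip_nth j) = ball_int n rho F.
Proof.
elim: n j rho F => [|n IH] [|j] rho F F0 mF //=.
- transitivity (\int[mu]_x
      (fun x => ball_int n (rho - `|x|)%R (fun l => F (x :: l))) (- x)%R).
    by apply: eq_integral => x _; rewrite normrN.
  rewrite (@ge0_integralN _ (fun x => ball_int n (rho - `|x|)%R (fun l => F (x :: l))))//.
    exact: measurable_ball_slice.
  by move=> x; exact: ball_int_ge0.
- apply: eq_integral => x _.
  by rewrite -(IH j _ (fun l => F (x :: l)))//; exact: measurable_list_cons.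
Qed.

(** Finite sets are Lebesgue null; this disposes of the endpoints and of the origin wherever strict
    and weak inequalities differ. *)
Lemma ge0_eq_integral_off (s : seq R) (f g : RR -> \bar R) :
  measurable_fun setT f -> measurable_fun setT g ->
  (forall x, 0 <= f x) -> (forall x, 0 <= g x) ->
  (forall x, x \notin s -> f x = g x) ->
  \int[mu]_x f x = \int[mu]_x g x.
Proof.
move=> mf mg f0 g0 fg; apply: ge0_ae_eq_integral => //.
have cs : countable [set` s] by exact/finite_set_countable/finite_seq.
exists [set` s]; split => //.
- by apply: countable_measurable cs => t; exact: measurable_set1.
- exact: countable_lebesgue_measure0.
- move=> x /= /not_implyP[_ fgx].
  by case: (boolP (x \in s)) => // /fg.
Qed.

Definition swap2 (l : seq R) :=
  if l is x :: y :: l' then y :: x :: l' else l.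

Lemma measurable_list_swap2 n F : measurable_list n.+2 F ->
  measurable_list n.+2 (F \o swap2).
Proof. by move=> /measurable_list_swap. Qed.

Lemma ball_int_swap n rho F : (forall l, 0 <= F l) ->
  measurable_list n.+2 F ->
  ball_int n.+2 rho (F \o swap2) = ball_int n.+2 rho F.
Proof.
move=> F0 mF /=.
pose G := fun p : RR * RR =>
  ball_int n (rho - `|p.1| - `|p.2|)%R (fun l => F (p.1 :: p.2 :: l)).
rewrite (@fubini_tonelli _ _ _ _ _ mu mu G).
- apply: eq_integral => x _; apply: eq_integral => y _ /=.
  by rewrite /G/= addrAC.
- apply: measurable_ball_int => //.
    by apply: measurable_funB; [apply: measurable_funB|]; do ?exact: measurableT_comp.
  pose phi := fun p : RR * RR => ((tt, p.1), p.2).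
  have mphi : measurable_fun setT phi.
    by apply: measurable_fun_pair => //; exact: measurable_fun_pair.
  exact: (measurable_args_comp mphi mF).
- by move=> p; exact: ball_int_ge0.
Qed.

(** Folding the line at the origin removes the absolute value from radii of the form [rho - |x|]. *)
Lemma ge0_integral_fold (f : RR -> \bar R) :
  measurable_fun setT f -> (forall x, 0 <= f x) ->
  \int[mu]_x f x = \int[mu]_x (if (0 < x)%R then f x + f (- x)%R else 0).
Proof.
move=> mf f0.
have mN : measurable_fun setT (fun x : RR => f (- x)%R).
  exact: measurableT_comp.
pose fp := fun x : RR => if (0 < x)%R then f x else 0.
pose fn := fun x : RR => if (x < 0)%R then f x else 0.
have mfp : measurable_fun setT fp.
  by apply: measurable_fun_ifT => //; exact: measurable_fun_ltr.
have mfn : measurable_fun setT fn.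
  by apply: measurable_fun_ifT => //; exact: measurable_fun_ltr.
have fp0 x : 0 <= fp x by rewrite /fp; case: ifPn.
have fn0 x : 0 <= fn x by rewrite /fn; case: ifPn.
transitivity (\int[mu]_x (fp x + fn x)).
  apply: (@ge0_eq_integral_off [:: 0%R]) => //; first exact: emeasurable_funD.
    by move=> x; rewrite adde_ge0.
  move=> x; rewrite inE /fp /fn; case: ltgtP => // _ _; rewrite ?adde0 ?add0e//.
rewrite ge0_integralD// -(ge0_integralN mfn fn0) -ge0_integralD//; last 1 first.
  exact: measurableT_comp.
apply: eq_integral => x _; rewrite /fp /fn oppr_lt0.
by case: ifPn => // _; rewrite adde0.
Qed.

(** The sum over the four points of the planar l1-sphere whose first coordinate is [x] or [-x].
    Under [x -> rho - x] the two coordinates exchange their roles. *)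
Definition cross_sum rho F (x : R) : \bar R :=
  if (0 < x < rho)%R then
    F [:: x; rho - x]%R + F [:: x; - (rho - x)]%R +
    (F [:: - x; rho - x]%R + F [:: - x; - (rho - x)]%R)
  else 0.

Lemma measurable_list2 F (g h : RR -> RR) : measurable_list 2 F ->
  measurable_fun setT g -> measurable_fun setT h ->
  measurable_fun setT (fun x => F [:: g x; h x]).
Proof.
move=> mF mg mh.
have mF' : measurable_fun setT (fun p : unit * RR * RR => F [:: p.1.2; p.2]) := mF.
apply: (measurableT_comp mF' (_ : measurable_fun setT (fun x => ((tt, g x), h x)))).
by apply: measurable_fun_pair => //; exact: measurable_fun_pair.
Qed.

Lemma measurable_cross_sum rho F : measurable_list 2 F ->
  measurable_fun setT (cross_sum rho F : RR -> \bar R).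
Proof.
move=> mF; have mB : measurable_fun setT (fun x : RR => rho - x : RR)%R.
  exact: measurable_funB.
have mBN : measurable_fun setT (fun x : RR => - (rho - x) : RR)%R.
  exact: measurableT_comp.
have mN : measurable_fun setT (fun x : RR => - x : RR)%R by exact: measurableT_comp.
apply: measurable_fun_ifT => //.
  by apply: measurable_and; exact: measurable_fun_ltr.
by do ![apply: emeasurable_funD]; exact: measurable_list2.
Qed.

Lemma cross_sum_ge0 rho F x : (forall l, 0 <= F l) -> 0 <= cross_sum rho F x.
Proof. by move=> F0; rewrite /cross_sum; case: ifPn => // _; rewrite !adde_ge0. Qed.

Lemma sphere_int1E rho F : (forall l, 0 <= F l) -> measurable_list 2 F ->
  sphere_int 1 rho F = \int[mu]_x cross_sum rho F x.
Proof.
move=> F0 mF.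
have mS := measurable_sphere_slice rho F0 mF.
rewrite /= (ge0_integral_fold mS) => [|x]; last exact: sphere_int_ge0.
apply: (@ge0_eq_integral_off [:: rho]) => //.
- apply: measurable_fun_ifT => //; first exact: measurable_fun_ltr.
  apply: emeasurable_funD => //.
  exact: (measurableT_comp mS).
- exact: measurable_cross_sum.
- move=> x; case: ifPn => // _.
  by rewrite adde_ge0//; exact: sphere_int_ge0.
- by move=> x; exact: cross_sum_ge0.
move=> x; rewrite inE => xr; rewrite /cross_sum; case: ifPn => //= x0.
rewrite normrN gtr0_norm// subr_ge0 le_eqVlt (negbTE xr)/=.
by case: ifPn => //; rewrite adde0.
Qed.

(** In the plane one coordinate is integrated and the other is determined by it, so Tonelli does not
    apply; the reflection [x -> rho - x] of the folded integral performs the exchange. *)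
Lemma sphere_int_swap1 rho F : (forall l, 0 <= F l) ->
  measurable_list 2 F ->
  sphere_int 1 rho (F \o swap2) = sphere_int 1 rho F.
Proof.
move=> F0 mF; rewrite sphere_int1E//; last 2 first.
- by move=> l; exact: F0.
- exact: measurable_list_swap2.
rewrite sphere_int1E//.
rewrite -[RHS](@ge0_integral_refl _ rho (cross_sum rho F))//; last 2 first.
- exact: measurable_cross_sum.
- by move=> x; exact: cross_sum_ge0.
apply: eq_integral => x _; rewrite /cross_sum/= subr_gt0 subKr.
rewrite ltrBlDl ltrDr andbC; case: ifPn => // _.
by rewrite addeACA.
Qed.

(** From dimension three on, the first two coordinates are both integrated and Tonelli exchanges
    them; the planar case is separate. *)
Lemma sphere_int_swap n rho F : (forall l, 0 <= F l) ->
  measurable_list n.+2 F ->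
  sphere_int n.+1 rho (F \o swap2) = sphere_int n.+1 rho F.
Proof.
case: n => [|n] F0 mF; first exact: sphere_int_swap1.
rewrite /=.
pose G := fun p : RR * RR =>
  sphere_int n (rho - `|p.1| - `|p.2|)%R (fun l => F (p.1 :: p.2 :: l)).
rewrite (@fubini_tonelli _ _ _ _ _ mu mu G).
- apply: eq_integral => x _; apply: eq_integral => y _ /=.
  by rewrite /G/= addrAC.
- apply: measurable_sphere_int => //.
    by apply: measurable_funB; [apply: measurable_funB|]; do ?exact: measurableT_comp.
  pose phi := fun p : RR * RR => ((tt, p.1), p.2).
  have mphi : measurable_fun setT phi.
    by apply: measurable_fun_pair => //; exact: measurable_fun_pair.
  exact: (@measurable_args_comp _ n.+1 _ _ _ _ phi
    (fun (p : unit * RR * RR) l => F (p.1.2 :: p.2 :: l)) mphi mF).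
- by move=> p; exact: sphere_int_ge0.
Qed.

Lemma measurable_list_swapP n F G : (forall x y l, G (x :: y :: l) = F (y :: x :: l)) ->
  measurable_list n.+2 F -> measurable_list n.+2 G.
Proof.
move=> GF /measurable_list_swap2.
have -> // : measurable_list n.+2 (F \o swap2) = measurable_list n.+2 G.
rewrite /measurable_list/=; congr measurable_args.
by apply/funext => p; apply/funext => l; rewrite GF.
Qed.

Lemma ball_int_swapP n rho F G : (forall l, 0 <= F l) ->
  (forall x y l, G (x :: y :: l) = F (y :: x :: l)) -> measurable_list n.+2 F ->
  ball_int n.+2 rho G = ball_int n.+2 rho F.
Proof.
move=> F0 GF mF; rewrite -(ball_int_swap rho F0 mF).
apply: eq_integral => x _; apply: eq_integral => y _.
by congr ball_int; apply/funext => l; rewrite GF.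
Qed.

Lemma sphere_int_swapP n rho F G : (forall l, 0 <= F l) ->
  (forall x y l, G (x :: y :: l) = F (y :: x :: l)) -> measurable_list n.+2 F ->
  sphere_int n.+1 rho G = sphere_int n.+1 rho F.
Proof.
move=> F0 GF mF; rewrite -(sphere_int_swap rho F0 mF).
apply: eq_integral => x _; case: n mF => [|n] mF /=; first by rewrite !GF.
apply: eq_integral => y _.
by congr sphere_int; apply/funext => l; rewrite GF.
Qed.

End sphere_symmetries.

(** * The divergence inequality for functions convex in one coordinate *)

Section convex_increment.
Local Open Scope ereal_scope.
Context {R : realType}.
Local Notation mu := (@lebesgue_measure R).
Local Notation RR := (measurableTypeR R).
Implicit Types (rho : R).

Lemma integral_if_cst (h k : R) : (0 <= h)%R ->
  \int[mu]_x (if (0 < x <= h)%R then k%:E else 0) = (h * k)%:E.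
Proof.
move=> h0; transitivity (\int[mu]_(x in `]0%R, h]%classic) (cst k%:E x)).
  rewrite [RHS]integral_mkcond; apply: eq_integral => x _.
  by rewrite patchE mem_setE in_itv.
rewrite integral_cst//= lebesgue_measure_itv/= lte_fin sube0.
case: ltgtP h0 => // [h0|<-] _; first by rewrite -EFinM mulrC.
by rewrite mule0 mul0r.
Qed.

(** Moving the interval [[-rho, rho]] by [h] gains the integral [K] of [u] over [(rho, rho + h]] and
    loses the integral [J] over [(-rho, h - rho]]. At equal offset, convexity makes the gain minus
    the loss at least [u rho - u (- rho)]. Everything is kept additive because the integrals are
    extended reals. *)
Lemma ball_int_chord (rho h : R) (u : R -> R) : (0 <= rho)%R -> (0 <= h)%R ->
  (forall x, 0 <= u x)%R -> measurable_fun setT (u : RR -> R) ->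
  (forall r : R, exists M : R, forall x : R, `|x| <= r -> u x <= M)%R ->
  (forall a c t : R, 0 <= c -> 0 <= t ->
     u (a + c) + u (a + t) <= u (a + c + t) + u a)%R ->
  \int[mu]_x (if (0 <= rho - `|x|)%R then (u x)%:E else 0) + (h * u rho)%:E <=
  \int[mu]_x (if (0 <= rho - `|x|)%R then (u (x + h))%:E else 0)
    + (h * u (- rho))%:E.
Proof.
move=> r0 h0 u0 mu' bu cu.
have mue : measurable_fun setT (fun x : RR => (u x)%:E) by exact/measurable_EFinP.
have mif (P : RR -> bool) (v : RR -> RR) : measurable_fun setT P ->
    measurable_fun setT v ->
    measurable_fun setT (fun x : RR => if P x then (u (v x))%:E else 0).
  by move=> mP mv; apply: measurable_fun_ifT => //; exact: (measurableT_comp mue).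
have if0 (b : bool) x : 0 <= (if b then (u x)%:E else 0).
  by case: b; rewrite ?lee_fin.
have mball c : measurable_fun setT (fun x : RR => 0 <= rho - `|x - c|)%R.
  apply: measurable_fun_ler => //; apply: measurable_funB => //.
  by apply: measurableT_comp => //; exact: measurable_funB.
have mint c : measurable_fun setT (fun x : RR => 0 < x - c <= h)%R.
  by apply: measurable_and; [apply: measurable_fun_ltr|apply: measurable_fun_ler] => //;
    exact: measurable_funB.
have m1 : measurable_fun setT
    (fun x : RR => if (0 <= rho - `|x - h|)%R then (u x)%:E else 0).
  exact: (mif _ id).
have m2 c : measurable_fun setT
    (fun x : RR => if (0 < x - c <= h)%R then (u x)%:E else 0).
  exact: (mif _ id).
set A := (X in X + _ <= _); set B := (X in _ <= X + _).
pose J := \int[mu]_x (if (0 < x <= h)%R then (u (x + - rho))%:E else 0).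
pose K := \int[mu]_x (if (0 < x <= h)%R then (u (x + rho))%:E else 0).
have BE : B = \int[mu]_x (if (0 <= rho - `|x - h|)%R then (u x)%:E else 0).
  rewrite -[RHS](ge0_integral_shift h m1)//.
  by apply: eq_integral => x _; rewrite addrK.
have JE : J = \int[mu]_x (if (0 < x - - rho <= h)%R then (u x)%:E else 0).
  rewrite -[RHS](ge0_integral_shift (- rho) (m2 _))//.
  by apply: eq_integral => x _; rewrite addrK.
have KE : K = \int[mu]_x (if (0 < x - rho <= h)%R then (u x)%:E else 0).
  rewrite -[RHS](ge0_integral_shift rho (m2 _))//.
  by apply: eq_integral => x _; rewrite addrK.
have mA : measurable_fun setT
    (fun x : RR => if (0 <= rho - `|x|)%R then (u x)%:E else 0).
  apply: (mif _ id) => //.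
  by have := mball 0%R; under eq_fun do rewrite subr0.
(* Both sides integrate [u] over [[-rho, rho + h]], cut at [h - rho] on the left and at [rho] on the
   right; the integrands agree away from the four endpoints. *)
have BJ : B + J = A + K.
  rewrite BE JE KE -!ge0_integralD//.
  apply: (@ge0_eq_integral_off _ [:: - rho; h - rho; rho; rho + h]%R).
  - exact: emeasurable_funD.
  - exact: emeasurable_funD.
  - by move=> x; rewrite adde_ge0.
  - by move=> x; rewrite adde_ge0.
  move=> x; rewrite !inE !negb_or => /and4P[/eqP x1 /eqP x2 /eqP x3 /eqP x4].
  rewrite !subr_ge0 !ler_norml.
  by do 4! [case: ifPn => ?]; rewrite ?adde0 ?add0e//; exfalso; lra.
have mc (v : R -> RR) : measurable_fun setT (v : RR -> RR) ->
    measurable_fun setT (fun x : RR => if (0 < x <= h)%R then (u (v x))%:E else 0).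
  move=> mv; apply: mif => //; have := mint 0%R.
  by under eq_fun do rewrite subr0.
have mcc (k : R) : measurable_fun setT (fun x : RR => if (0 < x <= h)%R then k%:E else 0).
  apply: measurable_fun_ifT => //; have := mint 0%R.
  by under eq_fun do rewrite subr0.
(* Finiteness, from boundedness of [u] on bounded sets, is what permits cancelling [J] at the
   end. *)
have Jfin : J \is a fin_num.
  have [M uM] := bu (rho + h)%R.
  have /andP[M0 _] : (0 <= M)%R && true.
    rewrite andbT (le_trans (u0 0%R))// uM// normr0 addr_ge0//.
  rewrite ge0_fin_numE; last by apply: integral_ge0 => x _; case: ifPn; rewrite ?lee_fin.
  apply: (@le_lt_trans _ _ (h * M)%:E); last exact: ltry.
  rewrite -integral_if_cst//; apply: ge0_le_integral => //.
  - by apply: mc; exact: measurable_funD.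
  - move=> x _; case: ifPn => // /andP[x0 xh]; rewrite lee_fin uM//.
    by rewrite ler_norml; lra.
have JK : J + (h * u rho)%:E <= K + (h * u (- rho))%:E.
  have mJ : measurable_fun setT
      (fun x : RR => if (0 < x <= h)%R then (u (x + - rho))%:E else 0).
    by apply: mc; exact: measurable_funD.
  have mK : measurable_fun setT
      (fun x : RR => if (0 < x <= h)%R then (u (x + rho))%:E else 0).
    by apply: mc; exact: measurable_funD.
  have ic0 c x : 0 <= (if (0 < x <= h)%R then (u c)%:E else 0) by [].
  rewrite -!integral_if_cst// /J /K -!ge0_integralD//.
  apply: ge0_le_integral => //.
  - by move=> x _; case: ifPn; rewrite ?adde0// -EFinD lee_fin addr_ge0.
  - exact: emeasurable_funD.
  - exact: emeasurable_funD.
  - move=> x _; case: ifPn => // /andP[x0 xh]; rewrite -!EFinD lee_fin.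
    have r2 : (0 <= rho + rho)%R by exact: addr_ge0.
    have := cu (- rho)%R _ _ r2 (ltW x0).
    have -> : (- rho + (rho + rho) = rho)%R by ring.
    by rewrite (addrC (- rho)%R x) (addrC rho x); lra.
rewrite -(leeD2rE _ _ Jfin).
rewrite [leRHS]addeAC BJ -[leRHS]addeA -[leLHS]addeA; apply: leeD2l.
by rewrite addeC.
Qed.

Fixpoint add_nth (j : nat) (h : R) (l : seq R) {struct l} : seq R :=
  match l, j with
  | [::], _ => [::]
  | x :: l', 0%N => (x + h)%R :: l'
  | x :: l', j'.+1 => x :: add_nth j' h l'
  end.

Lemma nth_add_nth j h l i : (j < size l)%N ->
  ((add_nth j h l)`_i = l`_i + (if i == j then h else 0))%R.
Proof.
elim: l j i => [|x l IH] [|j] [|i] //= jl; rewrite ?addr0 ?IH//.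
Qed.

(** Convexity along the j-th entry expressed as monotone increments: this form involves shifts only,
    which act directly on lists. *)
Definition convex_at (j : nat) (F : seq R -> R) :=
  forall (l : seq R) (c t : R), (0 <= c)%R -> (0 <= t)%R ->
  (F (add_nth j c l) + F (add_nth j t l) <= F (add_nth j (c + t)%R l) + F l)%R.

Definition bounded_on_balls (F : seq R -> R) := forall r : R, exists M : R,
  forall l : seq R, (\sum_(a <- l) `|a| <= r)%R -> (F l <= M)%R.

Lemma bounded_on_balls_cons F x :
  bounded_on_balls F -> bounded_on_balls (fun l => F (x :: l)).
Proof.
move=> bF r; have [M FM] := bF (`|x| + r)%R.
by exists M => l lr; apply: FM; rewrite big_cons lerD2l.
Qed.

(** A divergence theorem in one coordinate direction: the ball is sliced into segments parallel to
    axis [j], each segment obeys [ball_int_chord], and the segment endpoints sweep the two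
    half-spheres. The induction integrates over the other coordinates. *)
Lemma sphere_ball_increment n j rho (h : R) (F : seq R -> R) :
  (j <= n)%N -> (0 <= h)%R -> (forall l, 0 <= F l)%R ->
  bounded_on_balls F -> convex_at j F ->
  measurable_list n.+1 (fun l => (F l)%:E) ->
  measurable_list n.+1 (fun l => (F (add_nth j h l))%:E) ->
  measurable_list n.+1 (fun l => if (0 < l`_j)%R then (F l)%:E else 0) ->
  measurable_list n.+1 (fun l => if (l`_j < 0)%R then (F l)%:E else 0) ->
  ball_int n.+1 rho (fun l => (F l)%:E) +
    h%:E * sphere_int n rho (fun l => if (0 < l`_j)%R then (F l)%:E else 0) <=
  ball_int n.+1 rho (fun l => (F (add_nth j h l))%:E) +
    h%:E * sphere_int n rho (fun l => if (l`_j < 0)%R then (F l)%:E else 0).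
Proof.
have if0 (b : bool) (x : R) : (0 <= x)%R -> 0 <= (if b then x%:E else 0).
  by case: b; rewrite ?lee_fin.
move=> jn h0; elim: n j jn rho F => [|n IH] j jn rho F F0 bF cF mF mFh mFp mFn.
  move: j jn cF mFh mFp mFn => [|//] _ cF mFh mFp mFn /=.
  have [r0|r0] := leP 0%R rho; last first.
    rewrite !mule0 !adde0.
    under eq_integral => x _.
      rewrite ifF; last by apply/negbTE; rewrite -ltNge subr_lt0 (lt_le_trans r0).
      over.
    by rewrite integral0_eq//; apply: integral_ge0 => x _; case: ifPn; rewrite ?lee_fin.
  have mF1 : measurable_fun setT (fun p : unit * RR => (F [:: p.2])%:E) := mF.
  have mu1 : measurable_fun setT (fun x : RR => F [:: x]).
    apply/measurable_EFinP.
    apply: (measurableT_comp mF1 (_ : measurable_fun setT (fun x : RR => (tt, x)))).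
    exact: measurable_fun_pair.
  have chord : \int[mu]_x (if (0 <= rho - `|x|)%R then (F [:: x])%:E else 0) +
      (h * F [:: rho])%:E <=
      \int[mu]_x (if (0 <= rho - `|x|)%R then (F [:: x + h])%:E else 0)%R +
      (h * F [:: - rho])%:E.
    apply: (@ball_int_chord rho h (fun x => F [:: x])) => //.
    - move=> r; have [M FM] := bF r; exists M => x xr.
      by apply: FM; rewrite big_seq1.
    - by move=> a c t c0 t0; have := cF [:: a] c t c0 t0; rewrite /= !addrA.
  case: ltgtP r0 => // [r0|r0] _.
    by rewrite oppr_gt0 oppr_lt0 r0 ltNge (ltW r0)/= adde0 add0e -!EFinM.
  (* At radius 0 the strict sign tests annihilate the sphere terms, while both chord terms are [h *
     F [:: 0]] and cancel. *)
  move: chord; rewrite -r0 oppr0 ltxx !adde0 !mule0 !adde0.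
  by rewrite leeD2rE.
have tail k (F' : seq R -> R) : (k <= n)%N -> (forall l, 0 <= F' l)%R ->
    bounded_on_balls F' -> convex_at k.+1 F' ->
    measurable_list n.+2 (fun l => (F' l)%:E) ->
    measurable_list n.+2 (fun l => (F' (add_nth k.+1 h l))%:E) ->
    measurable_list n.+2 (fun l => if (0 < l`_k.+1)%R then (F' l)%:E else 0) ->
    measurable_list n.+2 (fun l => if (l`_k.+1 < 0)%R then (F' l)%:E else 0) ->
    ball_int n.+2 rho (fun l => (F' l)%:E) +
    h%:E * sphere_int n.+1 rho (fun l => if (0 < l`_k.+1)%R then (F' l)%:E else 0) <=
    ball_int n.+2 rho (fun l => (F' (add_nth k.+1 h l))%:E) +
    h%:E * sphere_int n.+1 rho (fun l => if (l`_k.+1 < 0)%R then (F' l)%:E else 0).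
  move=> kn F'0 bF' cF' mF' mF'h mF'p mF'n.
  have ef l : 0 <= (F' l)%:E by rewrite lee_fin.
  have efh l : 0 <= (F' (add_nth k.+1 h l))%:E by rewrite lee_fin.
  have efp l : 0 <= (if (0 < l`_k.+1)%R then (F' l)%:E else 0) by exact: if0.
  have efn l : 0 <= (if (l`_k.+1 < 0)%R then (F' l)%:E else 0) by exact: if0.
  have mb := measurable_ball_slice rho ef mF'.
  have mbh := measurable_ball_slice rho efh mF'h.
  have msp := measurable_sphere_slice rho efp mF'p.
  have msn := measurable_sphere_slice rho efn mF'n.
  have b0 x := ball_int_ge0 n.+1 (rho - `|x|)%R (fun l => ef (x :: l)).
  have bh0 x := ball_int_ge0 n.+1 (rho - `|x|)%R (fun l => efh (x :: l)).
  have sp0 x := sphere_int_ge0 n (rho - `|x|)%R (fun l => efp (x :: l)).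
  have sn0 x := sphere_int_ge0 n (rho - `|x|)%R (fun l => efn (x :: l)).
  have h0e : 0 <= h%:E by rewrite lee_fin.
  have hp0 x := mule_ge0 h0e (sp0 x).
  have hn0 x := mule_ge0 h0e (sn0 x).
  have mhp := measurable_funeM h%:E msp.
  have mhn := measurable_funeM h%:E msn.
  rewrite /= in mb mbh msp msn b0 bh0 sp0 sn0 hp0 hn0 mhp mhn *.
  rewrite -!ge0_integralZl_EFin// -!ge0_integralD//.
  apply: ge0_le_integral => //.
  - by move=> x _; exact: adde_ge0.
  - exact: emeasurable_funD.
  - exact: emeasurable_funD.
  - move=> x _.
    have := IH k kn (rho - `|x|)%R (fun l => F' (x :: l)); apply.
    + by move=> l; exact: F'0.
    + exact: bounded_on_balls_cons.
    + by move=> l c t c0 t0; exact: (cF' (x :: l)).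
    + exact: (@measurable_list_cons _ n.+1 _ x mF').
    + exact: (@measurable_list_cons _ n.+1 _ x mF'h).
    + exact: (@measurable_list_cons _ n.+1 _ x mF'p).
    + exact: (@measurable_list_cons _ n.+1 _ x mF'n).
(* The induction integrates out the head entry, so it cannot treat that entry itself as the
   distinguished one; exchanging the first two entries moves it to position 1. *)
case: j jn cF mFh mFp mFn => [_|j jn] cF mFh mFp mFn; last exact: tail.
pose F' := F \o swap2.
have ef l : 0 <= (F l)%:E by rewrite lee_fin.
have efh l : 0 <= (F (add_nth 0 h l))%:E by rewrite lee_fin.
have efp l : 0 <= (if (0 < l`_0)%R then (F l)%:E else 0) by exact: if0.
have efn l : 0 <= (if (l`_0 < 0)%R then (F l)%:E else 0) by exact: if0.
have b1 : ball_int n.+2 rho (fun l => (F' l)%:E) =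
  ball_int n.+2 rho (fun l => (F l)%:E) by exact: ball_int_swapP.
have b2 : ball_int n.+2 rho (fun l => (F' (add_nth 1 h l))%:E) =
  ball_int n.+2 rho (fun l => (F (add_nth 0 h l))%:E).
  exact: (ball_int_swapP _ efh).
have s1 : sphere_int n.+1 rho (fun l => if (0 < l`_1)%R then (F' l)%:E else 0) =
    sphere_int n.+1 rho (fun l => if (0 < l`_0)%R then (F l)%:E else 0).
  exact: (sphere_int_swapP _ efp).
have s2 : sphere_int n.+1 rho (fun l => if (l`_1 < 0)%R then (F' l)%:E else 0) =
    sphere_int n.+1 rho (fun l => if (l`_0 < 0)%R then (F l)%:E else 0).
  exact: (sphere_int_swapP _ efn).
have := tail 0%N F'; rewrite b1 b2 s1 s2; apply => //.
- by move=> l; exact: F0.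
- move=> r; have [M FM] := bF r; exists M => -[|x [|y l]] lr; apply: FM => //.
  by move: lr; rewrite !big_cons addrCA.
- by move=> [|x [|y l]] c t c0 t0; rewrite /F'/= ?lexx//; exact: (cF (y :: x :: l) c t c0 t0).
- exact: measurable_list_swapP mF.
- exact: measurable_list_swapP mFh.
- exact: measurable_list_swapP mFp.
- exact: measurable_list_swapP mFn.
Qed.

End convex_increment.

(** * Masses, second moments and null sets of the sphere integral *)

Section sphere_moments.
Local Open Scope ereal_scope.
Context {R : realType}.
Local Notation mu := (@lebesgue_measure R).
Local Notation RR := (measurableTypeR R).
Implicit Types (rho : R).

Lemma measurable_pow m : measurable_fun setT (fun x : RR => x ^+ m : RR)%R.
Proof. by have := @measurable_funX _ RR R setT (fun x => x) m; apply. Qed.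

Lemma integral_monomial (rho k : R) m : (0 <= rho)%R ->
  \int[mu]_(x in `[0%R, rho]) (k * x ^+ m)%:E =
  (k * rho ^+ m.+1 / m.+1%:R)%:E.
Proof.
rewrite le_eqVlt => /predU1P[<-|r0].
  by rewrite set_itv1 integral_set1 expr0n mulr0 mul0r.
have dX := @exprn_derivable R m.+1.
have cX n : continuous (fun x : R => (k / n.+1%:R) * x ^+ n.+1)%R.
  by move=> x; apply: cvgM; [exact: cvg_cst|exact: exprn_continuous].
rewrite (@continuous_FTC2 _ _ (fun x => (k / m.+1%:R) * x ^+ m.+1)%R)//.
- by rewrite expr0n mulr0 sube0 mulrAC.
- apply: continuous_subspaceT => x.
  by apply: cvgM; [exact: cvg_cst|exact: exprn_continuous].
- split.
  + by move=> x _; apply: derivableM => //; exact: derivable_cst.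
  + by apply: cvg_at_right_filter; exact: cX.
  + by apply: cvg_at_left_filter; exact: cX.
- move=> x _; rewrite derive1Ml// exp_derive1/= /GRing.scale/= mulrA mulfVK//.
Qed.

(** Monomials in the remaining radius, cut off at negative radii, form a family closed under
    integrating out one coordinate. *)
Definition monomial_at (k : R) m rho := if (0 <= rho)%R then (k * rho ^+ m)%:E else 0.

(** After folding and the reflection [x -> rho - x], the tent becomes twice a monomial on
    [[0, rho]]. Each integrated coordinate thus raises the degree by one and divides by the new
    degree, which is the origin of the factorials below. *)
Lemma integral_tent (rho k : R) m : (0 <= k)%R ->
  \int[mu]_x monomial_at k m (rho - `|x|)%R =
  monomial_at (2 * k / m.+1%:R) m.+1 rho.
Proof.
move=> k0; rewrite /monomial_at; case: ifPn => [r0|]; last first.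
  rewrite -ltNge => r0; apply: integral0_eq => x _; rewrite ifF//.
  by apply/negbTE; rewrite -ltNge subr_lt0 (lt_le_trans r0).
pose q := fun x : RR => if (0 <= rho - `|x|)%R then (k * (rho - `|x|) ^+ m)%:E else 0.
have mq : measurable_fun setT q.
  have mr : measurable_fun setT (fun x : RR => rho - `|x| : R)%R.
    by apply: measurable_funB => //; exact: measurableT_comp.
  apply: measurable_fun_ifT => //; first exact: measurable_fun_ler.
  apply/measurable_EFinP; apply: measurable_funM => //.
  exact: (measurable_funX m mr).
have q0 x : 0 <= q x.
  by rewrite /q; case: ifPn => // ?; rewrite lee_fin mulr_ge0// exprn_ge0.
rewrite (ge0_integral_fold mq q0).
pose p := fun x : RR => if (0 <= x <= rho)%R then (2 * k * x ^+ m)%:E else 0.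
have mp : measurable_fun setT p.
  apply: measurable_fun_ifT => //.
    by apply: measurable_and; exact: measurable_fun_ler.
  apply/measurable_EFinP; apply: measurable_funM => //.
have p0 x : 0 <= p x.
  by rewrite /p; case: ifPn => // /andP[? ?]; rewrite lee_fin !mulr_ge0// exprn_ge0.
transitivity (\int[mu]_x p (rho - x)%R).
  apply: (@ge0_eq_integral_off _ [:: 0%R]).
  - apply: measurable_fun_ifT => //; first exact: measurable_fun_ltr.
    by apply: emeasurable_funD => //; exact: (measurableT_comp mq).
  - by apply: (measurableT_comp mp); exact: measurable_funB.
  - by move=> x; case: ifPn => // _; rewrite adde_ge0.
  - by [].
  move=> x; rewrite inE => x0; rewrite /p /q normrN subr_ge0.
  have -> : (rho - x <= rho)%R = (0 < x)%R by rewrite gerBl le_eqVlt eq_sym (negbTE x0).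
  case: ltP => x00; last by rewrite andbF.
  rewrite andbT gtr0_norm// subr_ge0; case: ifPn => // _; last by rewrite adde0.
  by rewrite -EFinD; congr (_%:E); ring.
rewrite (ge0_integral_refl rho mp p0).
transitivity (\int[mu]_(x in `[0%R, rho]) (2 * k * x ^+ m)%:E); last first.
  by rewrite integral_monomial//; congr (_%:E); rewrite mulrAC.
rewrite [RHS]integral_mkcond; apply: eq_integral => x _.
by rewrite patchE mem_setE in_itv.
Qed.

Lemma eq_sphere_int_all n rho (F G : seq R -> \bar R) :
  F =1 G -> sphere_int n rho F = sphere_int n rho G.
Proof. by move=> /funext ->. Qed.

Lemma sphere_int0 n rho : sphere_int n rho (fun _ : seq R => 0) = 0.
Proof.
elim: n rho => [|n IH] rho /=; first by case: ifPn; rewrite ?adde0.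
by apply: integral0_eq => x _; exact: IH.
Qed.

Lemma sphere_int1 n rho : sphere_int n rho (fun _ : seq R => 1) =
  monomial_at (2 ^+ n.+1 / n`!%:R) n rho.
Proof.
elim: n rho => [|n IH] rho /=.
  by rewrite /monomial_at fact0 invr1 mulr1 expr1 expr0 mulr1.
under eq_integral do rewrite IH.
rewrite integral_tent ?divr_ge0 ?exprn_ge0//; congr monomial_at.
by rewrite factS natrM !exprS invfM; ring.
Qed.

Lemma ball_int1 n rho : ball_int n rho (fun _ : seq R => 1) =
  monomial_at (2 ^+ n / n`!%:R) n rho.
Proof.
elim: n rho => [|n IH] rho /=.
  by rewrite /monomial_at fact0 invr1 expr0 mulr1 mulr1.
under eq_integral do rewrite IH.
rewrite integral_tent ?divr_ge0 ?exprn_ge0//; congr monomial_at.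
by rewrite factS natrM !exprS invfM; ring.
Qed.

Definition row_of d (l : seq R) : 'rV[R]_d := \row_(j < d) l`_j.

(** The prefix [c x] collects the coordinates that have already become parameters; its fixed length
    [k] locates the next coordinate in the row. *)
Lemma measurable_args_row n k d dX (X : measurableType dX) (c : X -> seq R)
    (Phi : borel_rV R d -> \bar R) :
  (forall x, size (c x) = k) ->
  (forall i, measurable_fun setT (fun x => (c x)`_i : RR)) ->
  measurable_fun setT Phi ->
  measurable_args n (fun x l => Phi (row_of d (c x ++ l))).
Proof.
elim: n k dX X c => [|n IH] k dX X c ck mc mPhi /=.
  apply: (measurableT_comp mPhi); apply: measurable_rV => j.
  by under eq_fun do rewrite mxE cats0; exact: mc.
have -> : (fun (p : X * RR) l => Phi (row_of d (c p.1 ++ p.2 :: l))) =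
    (fun p l => Phi (row_of d (rcons (c p.1) p.2 ++ l))).
  by apply/funext => p; apply/funext => l; rewrite cat_rcons.
apply: (IH k.+1 _ _ (fun p : X * RR => rcons (c p.1) p.2)) => //.
  by move=> p; rewrite size_rcons ck.
move=> i; under eq_fun do rewrite nth_rcons ck.
case: (i < k)%N; first exact: (measurableT_comp (mc i)).
by case: (i == k); [exact: measurable_snd|exact: measurable_cst].
Qed.

Lemma measurable_list_row n d (Phi : borel_rV R d -> \bar R) :
  measurable_fun setT Phi -> measurable_list n (fun l => Phi (row_of d l)).
Proof.
move=> mPhi; apply: (@measurable_args_row n 0 d _ _ (fun _ => [::])) => // .
Qed.

Lemma measurable_list_nth n j (g : RR -> \bar R) : (j < n)%N ->
  measurable_fun setT g -> measurable_list n (fun l => g l`_j).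
Proof.
move=> jn mg.
have -> : (fun l => g l`_j) = (fun l => g (row_of n l 0%R (Ordinal jn))).
  by apply/funext => l; rewrite mxE.
apply: (@measurable_list_row n n (fun v : borel_rV R n => g (v 0%R (Ordinal jn)))).
exact: (measurableT_comp mg (measurable_coord _)).
Qed.

(** The base case is the two-point integral [2 rho^2]; a tent integration handles every later
    coordinate and an exchange the head. Divided by the total mass this is [2 / (d (d + 1))] with
    [d = n + 1]. *)
Lemma sphere_int_sqr n j rho : (j <= n)%N ->
  sphere_int n rho (fun l => (l`_j ^+ 2)%:E) =
  monomial_at (2 ^+ n.+2 / n.+2`!%:R) n.+2 rho.
Proof.
have msqr : measurable_fun setT (fun x : RR => (x ^+ 2)%:E).
  by apply/measurable_EFinP; exact: (@measurable_pow 2).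
have sqr0 k (l : seq R) : 0 <= (l`_k ^+ 2)%:E by rewrite lee_fin sqr_ge0.
elim: n j rho => [|n IH] j rho.
  rewrite leqn0 => /eqP-> /=; rewrite /monomial_at; case: ifPn => // _.
  by rewrite -EFinD sqrrN !factS fact0; congr (_%:E); field.
have tail k : (k <= n)%N -> sphere_int n.+1 rho (fun l => (l`_k.+1 ^+ 2)%:E) =
    monomial_at (2 ^+ n.+3 / n.+3`!%:R) n.+3 rho.
  move=> kn /=; under eq_integral do rewrite (IH k)//.
  rewrite integral_tent ?divr_ge0 ?exprn_ge0//; congr monomial_at.
  by rewrite (factS n.+2) natrM !exprS invfM; ring.
case: j => [_|j]; last exact: tail.
rewrite -(tail 0%N)//; apply: (sphere_int_swapP _ (sqr0 1%N)) => //.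
exact: (@measurable_list_nth _ 1 _ _ msqr).
Qed.

(** A coordinate that is integrated vanishes at a single point only. In dimension at least two every
    coordinate can be put in such a position. *)
Lemma sphere_int_coord0 n j rho : (j <= n.+1)%N ->
  sphere_int n.+1 rho (fun l => if l`_j == 0%R then 1 else 0) = 0.
Proof.
have mz : measurable_fun setT (fun x : RR => if x == 0%R then 1 else 0 : \bar R).
  by apply: measurable_fun_ifT => //; exact: measurable_fun_eqr.
have z0 k (l : seq R) : 0 <= (if l`_k == 0%R then 1 else 0 : \bar R) by case: ifPn.
have head m (r : R) : sphere_int m.+1 r (fun l : seq R => if l`_0 == 0%R then 1 else 0) = 0.
  transitivity (\int[mu]_x (cst 0 x : \bar R)); last exact: integral0.
  apply: (@ge0_eq_integral_off _ [:: 0%R]) => //.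
  - apply: (@measurable_sphere_slice _ m r (fun l => if l`_0 == 0%R then 1 else 0)) => //.
    exact: (@measurable_list_nth _ 0 _ _ mz).
  - by move=> x; exact: sphere_int_ge0.
  - move=> x; rewrite inE => /negbTE x0; rewrite /cst -[RHS](@sphere_int0 m (r - `|x|)%R).
    by apply: eq_sphere_int_all => l /=; rewrite x0.
elim: n j rho => [|n IH] [|j] rho jn; try exact: head.
- case: j jn => // _; rewrite -[RHS](head 0%N rho).
  apply: (sphere_int_swapP _ (z0 0%N)) => //.
  exact: (@measurable_list_nth _ 0 _ _ mz).
- by apply: integral0_eq => x _; exact: IH.
Qed.

End sphere_moments.

(** * The uniform law of the sphere *)

Section sphere_law.
Local Open Scope ereal_scope.
Context {R : realType} (n : nat).
Local Notation mu := (@lebesgue_measure R).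
Local Notation d := n.+1.
Local Notation V := (borel_rV R n.+1).

Import HBNNSimple.

(** The surface area of the unit l1-sphere divided by the square root of the dimension. *)
Definition sphere_mass : R := 2 ^+ n.+1 / n`!%:R.

Lemma sphere_mass_gt0 : (0 < sphere_mass)%R.
Proof. by rewrite divr_gt0// ?exprn_gt0// ltr0n fact_gt0. Qed.

Definition sphere_rV (Phi : V -> \bar R) : \bar R :=
  sphere_int n 1 (fun l => Phi (row_of d l)).

(** The radius is generalised from 1 to [rho] so that the head coordinate can be subtracted from it
    in the induction. *)
Lemma lebesgue_int_graph m (rho k : R) (G : seq R -> R) :
  @lebesgue_int R m (fun v =>
    let r := (\sum_(a <- v) `|a|)%R in
    (if r <= rho then k * (G (rcons v (rho - r)) + G (rcons v (- (rho - r)))) else 0)%R%:E) =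
  sphere_int m rho (fun l => (k * G l)%:E).
Proof.
elim: m rho G => [|m IH] rho G /=.
  by rewrite big_nil subr0; case: ifPn => // _; rewrite mulrDr EFinD.
apply: eq_integral => x _; rewrite -IH; congr lebesgue_int.
apply/funext => v; rewrite /= big_cons -lerBrDl opprD addrA//.
Qed.

Lemma sphere_area_sphere_rV (A : set V) : measurable A ->
  l1_sphere_area A = (Num.sqrt d%:R)%:E * sphere_rV (fun v => (\1_A v)%:E).
Proof.
move=> mA; rewrite /l1_sphere_area.
rewrite (lebesgue_int_graph n 1 _ (fun l => \1_A (row_of d l))).
rewrite /sphere_rV -sphere_intZ//.
apply: (@measurable_list_row _ d d (fun v : V => (\1_A v)%:E)).
by apply/measurable_EFinP; exact: measurable_indic.
Qed.

Lemma sphere_rV1 : sphere_rV (fun _ => 1) = sphere_mass%:E.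
Proof. by rewrite /sphere_rV sphere_int1 /monomial_at ler01 expr1n mulr1. Qed.

Lemma sphere_rV_ge0 (Phi : V -> \bar R) :
  (forall v, 0 <= Phi v) -> 0 <= sphere_rV Phi.
Proof. by move=> Phi0; exact: sphere_int_ge0. Qed.

Lemma le_sphere_rV (F G : V -> \bar R) : measurable_fun setT F ->
  measurable_fun setT G -> (forall v, 0 <= F v) -> (forall v, 0 <= G v) ->
  (forall v, l1norm (v : 'rV[R]_d) = 1%R -> F v <= G v) ->
  sphere_rV F <= sphere_rV G.
Proof.
move=> mF mG F0 G0 FG; apply: le_sphere_int => //; try exact: measurable_list_row.
move=> l ls l1; apply: FG; rewrite -l1 (big_nth 0%R) ls big_mkord.
by apply: eq_bigr => j _; rewrite mxE.
Qed.

Lemma sphere_rV_sum I (r : seq I) (F : I -> V -> \bar R) :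
  (forall i, measurable_fun setT (F i)) -> (forall i v, 0 <= F i v) ->
  sphere_rV (fun v => \sum_(i <- r) F i v) = \sum_(i <- r) sphere_rV (F i).
Proof.
move=> mF F0; elim: r => [|i r IH].
  rewrite big_nil -[RHS](@sphere_int0 R n 1).
  by apply: eq_sphere_int_all => l; rewrite big_nil.
rewrite big_cons -IH -sphere_intD//.
- by apply: eq_sphere_int_all => l /=; rewrite big_cons.
- by move=> l; exact: sume_ge0.
- exact: measurable_list_row.
- by apply: (@measurable_list_row _ d d (fun v => \sum_(i <- r) F i v)); exact: emeasurable_sum.
Qed.

Lemma sphere_rVZ (k : R) (F : V -> \bar R) : (0 <= k)%R ->
  measurable_fun setT F -> (forall v, 0 <= F v) ->
  sphere_rV (fun v => k%:E * F v) = k%:E * sphere_rV F.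
Proof.
by move=> k0 mF F0; rewrite /sphere_rV -sphere_intZ//; exact: measurable_list_row.
Qed.

Variable Q : {measure set V -> \bar R}.
Hypothesis QE : forall A : set V, measurable A -> Q A = (l1_sphere_uniform A)%:E.

(** The constant area density cancels in the quotient defining the uniform law. Areas must be shown
    finite, since the quotient is taken between their real parts. *)
Lemma sphere_law_indic (A : set V) : measurable A ->
  sphere_mass%:E * Q A = sphere_rV (fun v => (\1_A v)%:E).
Proof.
move=> mA; have mI (B : set V) : measurable B ->
    measurable_fun setT (fun v : V => (\1_B v)%:E).
  by move=> mB; apply/measurable_EFinP; exact: measurable_indic.
have I0 (B : set V) v : 0 <= (\1_B v)%:E :> \bar R by rewrite lee_fin.
have fA : sphere_rV (fun v => (\1_A v)%:E) \is a fin_num.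
  rewrite ge0_fin_numE; last exact: sphere_rV_ge0.
  apply: (@le_lt_trans _ _ sphere_mass%:E); last exact: ltry.
  rewrite -sphere_rV1; apply: le_sphere_rV => //; first exact: mI.
  by move=> v _; rewrite lee_fin indicE; case: (_ \in _).
rewrite QE// /l1_sphere_uniform !sphere_area_sphere_rV//.
rewrite (_ : sphere_rV (fun v => (\1_setT v)%:E) = sphere_mass%:E); last first.
  by rewrite -sphere_rV1; congr sphere_rV; apply/funext => v; rewrite indicT.
move: fA; case: (sphere_rV _) => // r _; rewrite -!EFinM/=.
congr (_%:E); field; rewrite gt_eqF ?sphere_mass_gt0//=.
Qed.

(** The standard extension from indicators through simple functions to monotone limits, run on both
    sides at once. *)
Lemma sphere_law_integral (Phi : V -> \bar R) : measurable_fun setT Phi ->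
  (forall v, 0 <= Phi v) ->
  sphere_mass%:E * \int[Q]_v Phi v = sphere_rV Phi.
Proof.
move=> mPhi Phi0; have m0 := sphere_mass_gt0.
have nn (g : {nnsfun V >-> R}) :
    sphere_mass%:E * \int[Q]_v (g v)%:E = sphere_rV (fun v => (g v)%:E).
  have gE v : (g v)%:E = \sum_(y <- finmap.enum_fset (fset_set (range g))) (y * \1_(g @^-1` [set y]) v)%:E.
    by rewrite sumEFin fimfunE fsbig_finite.
  have mg y : measurable_fun setT (fun v => (\1_(g @^-1` [set y]) v)%:E : \bar R).
    by apply/measurable_EFinP; exact: measurable_indic.
  have mgy y : measurable_fun setT (fun v => (y * \1_(g @^-1` [set y]) v)%:E : \bar R).
    by apply/measurable_EFinP; apply: measurable_funM => //; exact: measurable_indic.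
  have gy0 y v : 0 <= (y * \1_(g @^-1` [set y]) v)%:E.
    exact: nnfun_muleindic_ge0.
  under eq_integral do rewrite gE.
  rewrite ge0_integral_sum// ge0_sume_distrr; last first.
    by move=> y _; exact: integral_ge0.
  under [in RHS]eq_fun do rewrite gE.
  rewrite sphere_rV_sum//; apply: eq_bigr => y _.
  have [y0|y0] := leP 0%R y; last first.
    have g0 : g @^-1` [set y] = set0 by exact: preimage_nnfun0.
    rewrite integral0_eq ?mule0; last by move=> v _; rewrite g0 indic0 mulr0.
    rewrite -[LHS](@sphere_int0 R n 1); apply: eq_sphere_int_all => l.
    by rewrite g0 indic0 mulr0.
  under eq_integral do rewrite EFinM.
  rewrite ge0_integralZl//.
  rewrite integral_indic// setIT muleCA sphere_law_indic//.
  by rewrite -sphere_rVZ//; move=> v; rewrite lee_fin.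
pose f_ := nnsfun_approx measurableT mPhi.
have f_cvg v : (f_ k v)%:E @[k --> \oo] --> Phi v.
  by apply: cvg_nnsfun_approx => //.
have nd v : nondecreasing_seq (fun k => (f_ k v)%:E).
  by move=> a b ab; rewrite lee_fin; exact/lefP/nd_nnsfun_approx.
have c1 : sphere_mass%:E * \int[Q]_v (f_ k v)%:E @[k --> \oo] -->
    sphere_mass%:E * \int[Q]_v Phi v.
  apply: cvgeZl => //.
  have -> : \int[Q]_v Phi v = \int[Q]_v limn (fun k => (f_ k v)%:E).
    by apply: eq_integral => v _; apply/esym/cvg_lim.
  apply: cvg_monotone_convergence => //.
  - by move=> k; exact/measurable_EFinP/measurable_funP.
  - by move=> k v _; rewrite lee_fin.
have c2 : sphere_rV (fun v => (f_ k v)%:E) @[k --> \oo] --> sphere_rV Phi.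
  apply: cvg_sphere_int => //.
  - by move=> k l; rewrite lee_fin.
  - move=> k; apply: (@measurable_list_row _ d d (fun v => (f_ k v)%:E)).
    exact/measurable_EFinP/measurable_funP.
move: c1; rewrite (_ : (fun k => _) = (fun k => sphere_rV (fun v => (f_ k v)%:E))).
  by move=> c1; apply: (cvg_unique _ c1 c2).
by apply/funext => k; exact: nn.
Qed.

End sphere_law.

(** * Variance of odd functions on the sphere through sign flips *)

Section sphere_variance.
Local Open Scope ereal_scope.
Context {R : realType} (n : nat).
Local Notation d := n.+1.
Local Notation V := (borel_rV R n.+1).
Local Notation "'II'" := (@sphere_rV R n).

Definition flip_rV (j : 'I_d) (v : 'rV[R]_d) : 'rV[R]_d :=
  (\row_i (if i == j then - v 0 i else v 0 i))%R.

Lemma flip_rVK j : involutive (flip_rV j).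
Proof. by move=> v; apply/rowP => i; rewrite !mxE; case: eqP; rewrite ?opprK. Qed.

Lemma flip_rVC i j v : flip_rV i (flip_rV j v) = flip_rV j (flip_rV i v).
Proof. by apply/rowP => k; rewrite !mxE; case: eqP; case: eqP. Qed.

Lemma l1norm_flip j v : l1norm (flip_rV j v) = l1norm v.
Proof. by apply: eq_bigr => i _; rewrite mxE; case: eqP; rewrite ?normrN. Qed.

Lemma measurable_flip j : measurable_fun setT (flip_rV j : V -> V).
Proof.
apply: measurable_rV => i.
have -> : (fun x : V => flip_rV j x 0%R i) = (fun x : V => if i == j then - (x : 'rV[R]_d) 0%R i else (x : 'rV[R]_d) 0%R i)%R.
  by apply/funext => x; rewrite mxE.
case: (i == j); last exact: measurable_coord.
by apply: measurableT_comp => //; exact: measurable_coord.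
Qed.

Lemma sphere_rV_flip j (F : V -> \bar R) : measurable_fun setT F ->
  (forall v, 0 <= F v) -> II (fun v => F (flip_rV j v)) = II F.
Proof.
move=> mF F0; rewrite -[RHS](@sphere_int_flip _ n j)//; last exact: measurable_list_row.
apply: eq_sphere_int_all => l /=; congr F.
by apply/rowP => i; rewrite !mxE nth_flip_nth.
Qed.

Lemma sphere_rVD (F G : V -> \bar R) : measurable_fun setT F ->
  measurable_fun setT G -> (forall v, 0 <= F v) -> (forall v, 0 <= G v) ->
  II (fun v => F v + G v) = II F + II G.
Proof.
by move=> mF mG F0 G0; rewrite /sphere_rV -sphere_intD//; exact: measurable_list_row.
Qed.

Lemma sphere_rV_sqr (j : 'I_d) :
  II (fun v => ((v : 'rV[R]_d) 0%R j ^+ 2)%:E) = (2 ^+ n.+2 / n.+2`!%:R)%:E.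
Proof.
transitivity (sphere_int n 1 (fun l : seq R => (l`_j ^+ 2)%:E)).
  by apply: eq_sphere_int_all => l; rewrite mxE.
by rewrite sphere_int_sqr ?leq_ord// /monomial_at ler01 expr1n mulr1.
Qed.

(** On the sphere this is the conditional expectation of [f] once the signs of the coordinates in
    [s] are forgotten. *)
Fixpoint flip_average (s : seq 'I_d) (f : 'rV[R]_d -> R) (v : 'rV[R]_d) : R :=
  (if s is j :: s' then
     (flip_average s' f v + flip_average s' f (flip_rV j v)) / 2
   else f v)%R.

Lemma measurable_flip_average s (f : V -> R) : measurable_fun setT f ->
  measurable_fun setT (flip_average s f : V -> R).
Proof.
move=> mf; elim: s => [//|j s IH] /=.
apply: measurable_funM => //; apply: measurable_funD => //.
exact: (measurableT_comp IH (measurable_flip j)).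
Qed.

Lemma flip_average_inv s f j v : j \in s ->
  flip_average s f (flip_rV j v) = flip_average s f v.
Proof.
elim: s v => [//|i s IH] v /=; rewrite inE.
have [->|ij] := eqVneq j i; first by rewrite flip_rVK addrC.
by move=> /= js; rewrite flip_rVC !IH.
Qed.

Lemma flip_average_odd s f : (forall v, f (- v) = - f v)%R ->
  forall v, (flip_average s f (- v) = - flip_average s f v)%R.
Proof.
move=> fN; elim: s => [//|j s IH] v /=.
have -> : flip_rV j (- v)%R = (- flip_rV j v)%R.
  by apply/rowP => i; rewrite !mxE; case: eqP.
by rewrite !IH; lra.
Qed.

(** The full average inherits oddness from [f] and is invariant under every flip, hence under their
    composition, which is [v -> -v]. A quantity equal to its opposite is zero. *)
Lemma flip_average_odd0 f : (forall v, f (- v) = - f v)%R ->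
  forall v, (flip_average (enum 'I_d) f v = 0)%R.
Proof.
move=> fN v; have inv : flip_average (enum 'I_d) f (- v)%R = flip_average (enum 'I_d) f v.
  have -> : (- v)%R = foldr flip_rV v (enum 'I_d).
    have h (s : seq 'I_d) i : uniq s -> (foldr flip_rV v s 0 i =
        if i \in s then - v 0 i else v 0 i)%R.
      elim: s => [//|j s IH] /= /andP[js us]; rewrite mxE inE IH//.
      by case: eqVneq => [->|//]/=; rewrite (negbTE js).
    by apply/rowP => i; rewrite h ?enum_uniq// mem_enum mxE.
  elim: {2}(enum _) => [//|j s IH] /=.
  by rewrite flip_average_inv ?mem_enum.
by have := flip_average_odd (enum 'I_d) fN v; rewrite inv; lra.
Qed.

(* Efron-Stein over the signs of the coordinates: averaging over the flip of
   the j-th coordinate decreases the second moment by the second moment of half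
   the difference. *)
Lemma sphere_rV_variance (f : V -> R) (L : R) : measurable_fun setT f ->
  (0 <= L)%R -> (forall v, f (- v) = - f v)%R ->
  (forall j (v : 'rV[R]_d), l1norm v = 1 ->
     `|f v - f (flip_rV j v)| <= 2 * L * `|v 0 j|)%R ->
  II (fun v => (f v ^+ 2)%:E) <= (d%:R * (L ^+ 2 * (2 ^+ n.+2 / n.+2`!%:R)))%:E.
Proof.
move=> mf L0 fN fL.
have mA s : measurable_fun setT (flip_average s f : V -> R).
  exact: measurable_flip_average.
(* Averaging preserves the flip bound: flips commute, and they change neither the l1-norm nor
   [|v_j|]. *)
have AL s j (v : 'rV[R]_d) : (l1norm v = 1 ->
    `|flip_average s f v - flip_average s f (flip_rV j v)| <= 2 * L * `|v 0 j|)%R.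
  elim: s v => [|i s IH] v v1 /=; first exact: fL.
  have h1 := IH v v1.
  have h2 : (`|flip_average s f (flip_rV i v) -
      flip_average s f (flip_rV j (flip_rV i v))| <= 2 * L * `|v 0 j|)%R.
    apply: (le_trans (IH _ _)); first by rewrite l1norm_flip.
    by rewrite mxE; case: eqP; rewrite ?normrN.
  rewrite (flip_rVC i j) ler_norml; move: h1 h2; rewrite !ler_norml.
  by move=> /andP[h1 h2] /andP[h3 h4]; apply/andP; split; lra.
have msq (g : V -> R) : measurable_fun setT g ->
    measurable_fun setT (fun v => (g v ^+ 2)%:E : \bar R).
  by move=> mg; apply/measurable_EFinP; exact: (measurable_funX 2 mg).
have sq0 (g : V -> R) v : 0 <= (g v ^+ 2)%:E by rewrite lee_fin sqr_ge0.
pose B := (L ^+ 2 * (2 ^+ n.+2 / n.+2`!%:R))%R.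
have step s j : II (fun v => (flip_average s f v ^+ 2)%:E) <=
    II (fun v => (flip_average (j :: s) f v ^+ 2)%:E) + B%:E.
  pose A := flip_average s f; pose A' := fun v => flip_average s f (flip_rV j v).
  have mA' : measurable_fun setT (A' : V -> R).
    exact: (measurableT_comp (mA s) (measurable_flip j)).
  have mZ (g : V -> R) : measurable_fun setT g ->
      measurable_fun setT (fun v => (2^-1)%:E * (g v ^+ 2)%:E : \bar R).
    by move=> mg; apply: measurable_funeM; exact: msq.
  have Z0 (g : V -> R) v : 0 <= (2^-1)%:E * (g v ^+ 2)%:E.
    by rewrite mule_ge0// lee_fin invr_ge0.
  have -> : II (fun v => (A v ^+ 2)%:E) =
      II (fun v => (2^-1)%:E * (A v ^+ 2)%:E + (2^-1)%:E * (A' v ^+ 2)%:E).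
    rewrite sphere_rVD; [|exact: (mZ _ (mA s))|exact: mZ|exact: Z0|exact: Z0].
    rewrite !sphere_rVZ ?invr_ge0//; [|exact: msq|exact: (msq _ (mA s))].
    rewrite (@sphere_rV_flip j (fun v => (A v ^+ 2)%:E))//; last exact: (msq _ (mA s)).
    rewrite -ge0_muleDl ?lee_fin ?invr_ge0// -EFinD.
    by rewrite (_ : (2^-1 + 2^-1 = 1 :> R)%R) ?mul1e//; lra.
  have mc : measurable_fun setT (fun v : V => ((v : 'rV[R]_d) 0%R j ^+ 2)%:E : \bar R).
    by apply: msq; exact: measurable_coord.
  have -> : B%:E = II (fun v => (L ^+ 2)%:E * ((v : 'rV[R]_d) 0%R j ^+ 2)%:E).
    rewrite sphere_rVZ ?sqr_ge0//; last by move=> v; rewrite lee_fin sqr_ge0.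
    by rewrite /B EFinM -(sphere_rV_sqr j).
  have mc' : measurable_fun setT
      (fun v : V => (L ^+ 2)%:E * ((v : 'rV[R]_d) 0%R j ^+ 2)%:E : \bar R).
    exact: measurable_funeM.
  have c0 v : 0 <= (L ^+ 2)%:E * ((v : 'rV[R]_d) 0%R j ^+ 2)%:E.
    by rewrite mule_ge0// lee_fin sqr_ge0.
  rewrite -sphere_rVD//; first last.
    exact: (msq _ (mA (j :: s))).
  apply: le_sphere_rV.
  - by apply: emeasurable_funD; [exact: (mZ _ (mA s))|exact: mZ].
  - by apply: emeasurable_funD => //; exact: (msq _ (mA (j :: s))).
  - by move=> v; rewrite adde_ge0// Z0.
  - by move=> v; rewrite adde_ge0// ?c0// sq0.
  move=> v v1; rewrite -!EFinM -!EFinD lee_fin /= -/(A v) -/(A' v).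
  have : ((A v - A' v) ^+ 2 <= (2 * L * `|v 0 j|) ^+ 2)%R.
    rewrite -real_normK ?num_real// lerXn2r ?nnegrE//; last exact: AL.
    by rewrite !mulr_ge0.
  rewrite exprMn real_normK ?num_real//; move: (A v) (A' v) (v 0%R j) => a a' w.
  by nra.
have main s : II (fun v => (f v ^+ 2)%:E) <=
    II (fun v => (flip_average s f v ^+ 2)%:E) + ((size s)%:R * B)%:E.
  elim: s => [|j s IH]; first by rewrite mul0r adde0.
  apply: (le_trans IH); apply: (le_trans (leeD2r _ (step s j))).
  rewrite -addeA -EFinD leeD2l// lee_fin -[(size (j :: s))]/((size s).+1) mulrSr; lra.
apply: (le_trans (main (enum 'I_d))); rewrite size_enum_ord.
rewrite (_ : II _ = 0) ?add0e// -[RHS](@sphere_int0 R n 1).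
by apply: eq_sphere_int_all => l; rewrite flip_average_odd0// expr0n.
Qed.

End sphere_variance.

(** * From lists to vectors: the divergence inequality for convex functions on the unit ball *)

Section sphere_gradient.
Local Open Scope ereal_scope.
Context {R : realType} (n : nat).
Local Notation d := n.+1.
Local Notation V := (borel_rV R n.+1).
Local Notation "'II'" := (@sphere_rV R n).
Implicit Types (f : 'rV[R]_d -> R) (j : 'I_d).

Definition ball_rV (F : V -> \bar R) : \bar R :=
  ball_int d 1 (fun l => F (row_of d l)).

Lemma cvx_measurable f : cvx f -> measurable_fun setT (f : V -> R).
Proof. by move=> cf; apply: continuous_measurable_rV; exact: cvx_continuous. Qed.

Lemma cvx_add f a : cvx f -> cvx (fun x => f (a + x))%R.
Proof.
move=> /(cvx_shift a 1); congr cvx; apply/funext => x; by rewrite scale1r.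
Qed.

Lemma cvx_flip f j : cvx f -> cvx (fun x => f (flip_rV j x)).
Proof.
move=> cf x y t t01; have := cf (flip_rV j x) (flip_rV j y) t t01.
congr (f _ <= _)%R; apply/rowP => i; rewrite !mxE; case: eqP => _; ring.
Qed.

Lemma row_of_add_nth j (h : R) (l : seq R) : (j < size l)%N ->
  row_of d (add_nth j h l) = (row_of d l + h *: delta_mx 0 j)%R.
Proof.
move=> jl; apply/rowP => i; rewrite !mxE nth_add_nth// eqxx/=.
by rewrite -val_eqE; case: eqP; rewrite ?mulr1 ?mulr0.
Qed.

Lemma row_of_add_nth_default j (h : R) (l : seq R) : (size l <= j)%N ->
  row_of d (add_nth j h l) = row_of d l.
Proof.
move=> jl; congr row_of.
by elim: l (j : nat) jl => [|x l IH] [|k]//= kl; rewrite IH.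
Qed.

Lemma row_of_flip_nth j (l : seq R) : row_of d (flip_nth j l) = flip_rV j (row_of d l).
Proof. by apply/rowP => i; rewrite !mxE nth_flip_nth. Qed.

(** The points at distance [c] and [t] are convex combinations of the two extreme points with
    complementary weights, so adding the two inequalities gives total weight one to each extreme. A
    list too short to have an entry [j] is left unchanged by the shift. *)
Lemma cvx_convex_at f j : cvx f -> convex_at j (fun l => f (row_of d l)).
Proof.
move=> cf l c t c0 t0.
have [jl|jl] := ltnP j (size l); last first.
  by rewrite !row_of_add_nth_default// lexx.
rewrite !row_of_add_nth//; set x := row_of d l; set e := delta_mx _ _.
have [ct|ct] := eqVneq (c + t)%R 0%R.
  have cz : c = 0%R by lra.
  have tz : t = 0%R by lra.
  by rewrite ct cz tz scale0r addr0.
have ct0 : (0 < c + t)%R by rewrite lt_neqAle eq_sym ct addr_ge0.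
have h (a b : R) : (0 <= a)%R -> (0 <= b)%R -> (a + b = c + t)%R ->
    (f (x + a *: e) <= a / (c + t) * f (x + (c + t) *: e) + b / (c + t) * f x)%R.
  move=> a0 b0 ab; have a01 : (0 <= a / (c + t) <= 1)%R.
    by rewrite divr_ge0 ?(ltW ct0)//= ler_pdivrMr// mul1r -ab lerDl.
  have := cf (x + (c + t) *: e)%R x _ a01.
  have -> : (1 - a / (c + t) = b / (c + t))%R.
    by apply: (mulIf ct); rewrite mulrBl !mulfVK// -ab; ring.
  congr (f _ <= _)%R; rewrite scalerDr scalerA mulfVK// addrAC -scalerDl.
  by rewrite -mulrDl ab mulfV// scale1r.
have h1 := h c t c0 t0 erefl; have h2 := h t c t0 c0 (addrC _ _).
have : ((c / (c + t) + t / (c + t)) = 1)%R by rewrite -mulrDl mulfV.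
move: h1 h2; set p := (c / _)%R; set q := (t / _)%R; set u := f _; set v := f (_ + t *: _)%R.
set w := f (_ + (c + t) *: _)%R => h1 h2 pq.
move: h1 h2; have -> : q = (1 - p)%R by rewrite -pq; ring.
by nra.
Qed.

Lemma l1norm_row_of (l : seq R) : (l1norm (row_of d l) <= \sum_(a <- l) `|a|)%R.
Proof.
rewrite (big_nth 0%R).
have -> : (l1norm (row_of d l) = \sum_(0 <= i < d) `|l`_i|)%R.
  by rewrite big_mkord; apply: eq_bigr => i _; rewrite mxE.
have [dl|ld] := leqP d (size l).
  by rewrite [leRHS](big_cat_nat _ dl)//= lerDl sumr_ge0.
rewrite (@big_cat_nat _ _ _ (size l))//=; last exact: ltnW.
rewrite gerDl big_nat_cond big1// => i /andP[/andP[li _] _].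
by rewrite nth_default ?normr0.
Qed.

Lemma cvx_bounded_on_balls f : cvx f -> bounded_on_balls (fun l => f (row_of d l)).
Proof.
move=> cf r; have [M M0 fM] := cvx_bounded r cf.
exists M => l lr; apply: (le_trans (ler_norm _)); apply: fM.
exact: le_trans (l1norm_row_of l) lr.
Qed.

Lemma measurable_pos_part f j : cvx f ->
  measurable_fun setT (fun v : V => if (0 < (v : 'rV[R]_d) 0 j)%R then (f v)%:E else 0).
Proof.
move=> cf; apply: measurable_fun_ifT => //.
  by apply: measurable_fun_ltr => //; exact: measurable_coord.
by apply/measurable_EFinP; exact: cvx_measurable.
Qed.

Lemma measurable_neg_part f j : cvx f ->
  measurable_fun setT (fun v : V => if ((v : 'rV[R]_d) 0 j < 0)%R then (f v)%:E else 0).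
Proof.
move=> cf; apply: measurable_fun_ifT => //.
  by apply: measurable_fun_ltr => //; exact: measurable_coord.
by apply/measurable_EFinP; exact: cvx_measurable.
Qed.

(** The two half-spheres are integrated separately because the integrals are extended nonnegative
    numbers; their difference is formed only once they are known to be finite. *)
Definition pos_int f j :=
  II (fun v => if (0 < (v : 'rV[R]_d) 0 j)%R then (f v)%:E else 0).
Definition neg_int f j :=
  II (fun v => if ((v : 'rV[R]_d) 0 j < 0)%R then (f v)%:E else 0).

Lemma ball_increment_ge0 f j (h : R) : cvx f -> (forall x, 0 <= f x)%R ->
  (0 <= h)%R ->
  ball_rV (fun v => (f v)%:E) + h%:E * pos_int f j <=
  ball_rV (fun v => (f (v + h *: delta_mx 0 j)%R)%:E) + h%:E * neg_int f j.
Proof.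
move=> cf f0 h0.
have cfh : cvx (fun v => f (v + h *: delta_mx 0 j)%R).
  have := cvx_add (h *: delta_mx 0 j)%R cf.
  by congr cvx; apply/funext => x; rewrite addrC.
pose F l := f (row_of d l).
have me g : cvx g -> measurable_fun setT (fun v : V => (g v)%:E : \bar R).
  by move=> cg; apply/measurable_EFinP; exact: cvx_measurable.
have posE : pos_int f j =
    sphere_int n 1 (fun l : seq R => if (0 < l`_j)%R then (F l)%:E else 0).
  by apply: eq_sphere_int_all => l; rewrite mxE.
have negE : neg_int f j =
    sphere_int n 1 (fun l : seq R => if (l`_j < 0)%R then (F l)%:E else 0).
  by apply: eq_sphere_int_all => l; rewrite mxE.
have mpos : measurable_list d (fun l : seq R => if (0 < l`_j)%R then (F l)%:E else 0).
  have := measurable_list_row d (measurable_pos_part j cf).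
  by congr measurable_list; apply/funext => l; rewrite mxE.
have mneg : measurable_list d (fun l : seq R => if (l`_j < 0)%R then (F l)%:E else 0).
  have := measurable_list_row d (measurable_neg_part j cf).
  by congr measurable_list; apply/funext => l; rewrite mxE.
have mF : measurable_list d (fun l => (F l)%:E).
  exact: (measurable_list_row d (me _ cf)).
have jd (l : seq R) : size l = d -> (j < size l)%N by move=> ->.
have FE (l : seq R) : size l = d ->
    (f (row_of d l + h *: delta_mx 0 j)%R)%:E = (F (add_nth j h l))%:E.
  by move=> /jd jl; rewrite /F row_of_add_nth.
have mFh' := measurable_list_row d (me _ cfh).
have mFh := eq_measurable_list FE mFh'.
have -> : ball_rV (fun v => (f (v + h *: delta_mx 0 j)%R)%:E) =
    ball_int d 1 (fun l => (F (add_nth j h l))%:E).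
  by apply: eq_ball_int => // l; rewrite lee_fin f0.
rewrite posE negE; apply: sphere_ball_increment => //.
- by rewrite -ltnS.
- exact: cvx_bounded_on_balls.
- exact: cvx_convex_at.
Qed.

(** Reflecting coordinate [j] turns a negative shift into a positive one and exchanges the two
    half-spheres. *)
Lemma ball_increment_le0 f j (h : R) : cvx f -> (forall x, 0 <= f x)%R ->
  (0 <= h)%R ->
  ball_rV (fun v => (f v)%:E) + h%:E * neg_int f j <=
  ball_rV (fun v => (f (v + (- h) *: delta_mx 0 j)%R)%:E) + h%:E * pos_int f j.
Proof.
move=> cf f0 h0.
have := ball_increment_ge0 (h := h) j (cvx_flip j cf) (fun x => f0 _) h0.
have ballE (g : 'rV[R]_d -> R) : cvx g -> (forall x, 0 <= g x)%R ->
    ball_rV (fun v => (g (flip_rV j v))%:E) = ball_rV (fun v => (g v)%:E).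
  move=> cg g0; rewrite /ball_rV.
  rewrite -(@ball_int_flip _ d j 1 (fun l => (g (row_of d l))%:E)).
  - by congr ball_int; apply/funext => l; rewrite /= row_of_flip_nth.
  - by move=> l; rewrite lee_fin.
  - apply: (@measurable_list_row _ d d (fun v => (g v)%:E)).
    by apply/measurable_EFinP; exact: cvx_measurable.
have cfh : cvx (fun v => f (v + (- h) *: delta_mx 0 j)%R).
  have := cvx_add ((- h) *: delta_mx 0 j)%R cf.
  by congr cvx; apply/funext => x; rewrite addrC.
have if0 (b : V -> bool) v : 0 <= (if b v then (f v)%:E else 0).
  by case: ifPn; rewrite ?lee_fin.
have -> : pos_int (fun x => f (flip_rV j x)) j = neg_int f j.
  rewrite /neg_int -(@sphere_rV_flip _ _ j); [|exact: measurable_neg_part|exact: if0].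
  by apply: eq_sphere_int_all => l; rewrite !mxE eqxx oppr_lt0.
have -> : neg_int (fun x => f (flip_rV j x)) j = pos_int f j.
  rewrite /pos_int -(@sphere_rV_flip _ _ j); [|exact: measurable_pos_part|exact: if0].
  by apply: eq_sphere_int_all => l; rewrite !mxE eqxx oppr_gt0.
rewrite ballE// -(ballE _ cfh)//.
congr (_ <= _ + _); congr ball_rV; apply/funext => v; congr (f _)%:E.
by apply/rowP => i; rewrite !mxE eqxx/=; case: eqP => _; rewrite ?mulr1 ?mulr0; ring.
Qed.

End sphere_gradient.

Section sphere_gradient_inequality.
Local Open Scope ereal_scope.
Context {R : realType} (n : nat).
Local Notation d := n.+1.
Local Notation V := (borel_rV R n.+1).
Local Notation "'II'" := (@sphere_rV R n).
Local Notation mass := (@sphere_mass R n).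
Implicit Types (f : 'rV[R]_d -> R) (j : 'I_d).

Definition ball_mass : R := (2 ^+ d / d`!%:R)%R.

Lemma ball_rV1 : ball_rV (fun _ : V => 1) = ball_mass%:E.
Proof. by rewrite /ball_rV ball_int1 /monomial_at ler01 expr1n mulr1. Qed.

(** The volume of the ball of radius [r] is [ball_mass * r^d], and its derivative at 1 is the sphere
    mass. This is the source of the factor [d] in the gradient estimator. *)
Lemma ball_massE : (d%:R * ball_mass = mass)%R.
Proof.
rewrite /ball_mass /sphere_mass factS natrM invfM; field.
by rewrite pnatr_eq0 -lt0n fact_gt0 /= addrC natr1 pnatr_eq0.
Qed.

Lemma le_ball_rV (F G : V -> \bar R) : measurable_fun setT F ->
  measurable_fun setT G -> (forall v, 0 <= F v) -> (forall v, 0 <= G v) ->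
  (forall v, (l1norm (v : 'rV[R]_d) <= 1)%R -> F v <= G v) ->
  ball_rV F <= ball_rV G.
Proof.
move=> mF mG F0 G0 FG; apply: le_ball_int => //; try exact: measurable_list_row.
by move=> l ls l1; apply: FG; apply: le_trans (l1norm_row_of _ l) l1.
Qed.

Lemma ball_rVDc (F : V -> \bar R) (c : R) : measurable_fun setT F ->
  (forall v, 0 <= F v) -> (0 <= c)%R ->
  ball_rV (fun v => F v + c%:E) = ball_rV F + (c * ball_mass)%:E.
Proof.
move=> mF F0 c0; rewrite EFinM -ball_rV1 /ball_rV -ball_intZ//.
  rewrite -ball_intD//.
  - by congr ball_int; apply/funext => l /=; rewrite mule1.
  - by move=> l; rewrite mule1 lee_fin.
  - exact: measurable_list_row.
  - by apply: (@measurable_list_row _ d d (fun v => c%:E * 1)); exact: measurable_cst.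
by apply: (@measurable_list_row _ d d (fun v => 1)); exact: measurable_cst.
Qed.

Lemma sphere_rVDc (F : V -> \bar R) (c : R) : measurable_fun setT F ->
  (forall v, 0 <= F v) -> (0 <= c)%R ->
  II (fun v => F v + c%:E) = II F + (c * mass)%:E.
Proof.
move=> mF F0 c0; rewrite sphere_rVD//.
congr (_ + _); rewrite EFinM -sphere_rV1 -sphere_rVZ//.
by apply: eq_sphere_int_all => l; rewrite mule1.
Qed.

Lemma cvx_measurableE f : cvx f -> measurable_fun setT (fun v : V => (f v)%:E).
Proof. by move=> cf; apply/measurable_EFinP; exact: cvx_measurable. Qed.

Lemma ball_rV_fin f : cvx f -> (forall x, 0 <= f x)%R ->
  ball_rV (fun v => (f v)%:E) \is a fin_num.
Proof.
move=> cf f0; have [M M0 fM] := cvx_bounded 1 cf.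
have mf := cvx_measurableE cf.
rewrite ge0_fin_numE; last by apply: ball_int_ge0 => l; rewrite lee_fin.
apply: (@le_lt_trans _ _ (ball_rV (fun _ => M%:E * 1))).
  apply: le_ball_rV => //.
  - by move=> v; rewrite mule1 lee_fin.
  - by move=> v v1; rewrite mule1 lee_fin; apply: le_trans (ler_norm _) (fM _ v1).
rewrite /ball_rV ball_intZ//; last first.
  by apply: (@measurable_list_row _ d d (fun v => 1)); exact: measurable_cst.
by rewrite -/(ball_rV (fun _ => 1)) ball_rV1 -EFinM ltry.
Qed.

Lemma le_pos_int f g j (c : R) : cvx f -> cvx g ->
  (forall x, 0 <= f x)%R -> (forall x, 0 <= g x)%R -> (0 <= c)%R ->
  (forall v : 'rV[R]_d, l1norm v = 1 -> f v <= g v + c)%R ->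
  pos_int f j <= pos_int g j + (c * mass)%:E.
Proof.
move=> cf cg f0 g0 c0 fg; have mf := measurable_pos_part j cf.
have mg := measurable_pos_part j cg.
rewrite -sphere_rVDc//; last by move=> v; case: ifPn; rewrite ?lee_fin.
apply: le_sphere_rV => //.
- exact: emeasurable_funD.
- by move=> v; case: ifPn; rewrite ?lee_fin.
- by move=> v; case: ifPn; rewrite ?adde0 ?add0e -?EFinD ?lee_fin ?addr_ge0.
- move=> v v1; case: ifPn => _; rewrite ?add0e -?EFinD lee_fin//.
  exact: fg.
Qed.

Lemma le_neg_int f g j (c : R) : cvx f -> cvx g ->
  (forall x, 0 <= f x)%R -> (forall x, 0 <= g x)%R -> (0 <= c)%R ->
  (forall v : 'rV[R]_d, l1norm v = 1 -> f v <= g v + c)%R ->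
  neg_int f j <= neg_int g j + (c * mass)%:E.
Proof.
move=> cf cg f0 g0 c0 fg; have mf := measurable_neg_part j cf.
have mg := measurable_neg_part j cg.
rewrite -sphere_rVDc//; last by move=> v; case: ifPn; rewrite ?lee_fin.
apply: le_sphere_rV => //.
- exact: emeasurable_funD.
- by move=> v; case: ifPn; rewrite ?lee_fin.
- by move=> v; case: ifPn; rewrite ?adde0 ?add0e -?EFinD ?lee_fin ?addr_ge0.
- move=> v v1; case: ifPn => _; rewrite ?add0e -?EFinD lee_fin//.
  exact: fg.
Qed.

Lemma pos_int_fin f j : cvx f -> (forall x, 0 <= f x)%R ->
  pos_int f j \is a fin_num.
Proof.
move=> cf f0; have [M M0 fM] := cvx_bounded 1 cf.
rewrite ge0_fin_numE; last first.
  by apply: sphere_rV_ge0 => v; case: ifPn; rewrite ?lee_fin.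
have c0 : cvx (fun _ : 'rV[R]_d => 0%R) by move=> x y t _; rewrite !mulr0 addr0.
apply: (@le_lt_trans _ _ (pos_int (fun _ => 0%R) j + (M * mass)%:E)).
  apply: le_pos_int => // v v1.
  by rewrite add0r (le_trans (ler_norm _))// fM// v1.
rewrite /pos_int (_ : II _ = 0) ?add0e ?ltry// -[RHS](@sphere_int0 R n 1).
by apply: eq_sphere_int_all => l; rewrite if_same.
Qed.

Lemma neg_int_fin f j : cvx f -> (forall x, 0 <= f x)%R ->
  neg_int f j \is a fin_num.
Proof.
move=> cf f0; have [M M0 fM] := cvx_bounded 1 cf.
rewrite ge0_fin_numE; last first.
  by apply: sphere_rV_ge0 => v; case: ifPn; rewrite ?lee_fin.
have c0 : cvx (fun _ : 'rV[R]_d => 0%R) by move=> x y t _; rewrite !mulr0 addr0.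
apply: (@le_lt_trans _ _ (neg_int (fun _ => 0%R) j + (M * mass)%:E)).
  apply: le_neg_int => // v v1.
  by rewrite add0r (le_trans (ler_norm _))// fM// v1.
rewrite /neg_int (_ : II _ = 0) ?add0e ?ltry// -[RHS](@sphere_int0 R n 1).
by apply: eq_sphere_int_all => l; rewrite if_same.
Qed.

Local Open Scope ring_scope.

(** Up to the factor [sphere_mass], the mean of [f z] times the sign of [z_j] under the uniform
    law. *)
Definition sign_int f j : R := fine (pos_int f j) - fine (neg_int f j).

Lemma ball_increment f j (h : R) : cvx f -> (forall x, 0 <= f x) ->
  fine (ball_rV (fun v => (f v)%:E)) + h * sign_int f j <=
  fine (ball_rV (fun v => (f (v + h *: delta_mx 0 j))%:E)).
Proof.
move=> cf f0.
have cfh : cvx (fun v => f (v + h *: delta_mx 0 j)).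
  have := cvx_add (h *: delta_mx 0 j) cf.
  by congr cvx; apply/funext => x; rewrite addrC.
have b1 := ball_rV_fin cf f0; have b2 := ball_rV_fin cfh (fun x => f0 _).
have p1 := pos_int_fin j cf f0; have n1 := neg_int_fin j cf f0.
rewrite /sign_int.
have [h0|h0] := leP 0 h.
  have := ball_increment_ge0 j cf f0 h0.
  rewrite -(fineK b1) -(fineK b2) -(fineK p1) -(fineK n1) -!EFinM -!EFinD lee_fin /=.
  lra.
have h0' : 0 <= - h by rewrite oppr_ge0 ltW.
have := ball_increment_le0 j cf f0 h0'; rewrite opprK.
rewrite -(fineK b1) -(fineK b2) -(fineK p1) -(fineK n1) -!EFinM -!EFinD lee_fin /=.
lra.
Qed.

Lemma sign_int_lip f g j (c : R) : cvx f -> cvx g ->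
  (forall x, 0 <= f x) -> (forall x, 0 <= g x) -> 0 <= c ->
  (forall v, l1norm v = 1 -> `|f v - g v| <= c) ->
  `|sign_int f j - sign_int g j| <= 2 * (c * mass).
Proof.
move=> cf cg f0 g0 c0 fg; rewrite /sign_int.
have fg1 v : l1norm v = 1 -> f v <= g v + c.
  by move=> /fg; rewrite ler_norml => /andP[_]; rewrite lerBlDl.
have gf1 v : l1norm v = 1 -> g v <= f v + c.
  by move=> /fg; rewrite distrC ler_norml => /andP[_]; rewrite lerBlDl.
have := le_pos_int j cf cg f0 g0 c0 fg1.
have := le_pos_int j cg cf g0 f0 c0 gf1.
have := le_neg_int j cf cg f0 g0 c0 fg1.
have := le_neg_int j cg cf g0 f0 c0 gf1.
rewrite -(fineK (pos_int_fin j cf f0)) -(fineK (pos_int_fin j cg g0)).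
rewrite -(fineK (neg_int_fin j cf f0)) -(fineK (neg_int_fin j cg g0)).
rewrite -!EFinD !lee_fin /= ler_norml => h1 h2 h3 h4.
by apply/andP; split; lra.
Qed.

(** The ball is moved from 0 to [h v] one coordinate at a time. Each move gains at least [h v_k]
    times a sign integral of the partly shifted function, which differs from that of [f] by O(h);
    the total gain is at most [h K ball_mass] by convexity. Dividing by [h] and letting [h] tend to
    0 leaves the claim. *)
Lemma sphere_gradient_le f (v : 'rV[R]_d) (K : R) : cvx f ->
  (forall x, 0 <= f x) ->
  (forall z, l1norm z <= 1 -> f (z + v) - f z <= K) ->
  d%:R * \sum_j v 0 j * sign_int f j <= K * mass.
Proof.
move=> cf f0 fK.
suff : \sum_j v 0 j * sign_int f j <= K * ball_mass.
  by move=> h; rewrite -ball_massE mulrCA ler_wpM2l.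
have [M M0 fM] := cvx_bounded (1 + l1norm v) cf.
have cfw w : cvx (fun x => f (x + w)).
  by have := cvx_add w cf; congr cvx; apply/funext => x; rewrite addrC.
apply: (@ler_linear_eps _ _ _ (2 * M * mass * l1norm v)) => h /andP[h0 h1].
(* The position after the first [k] coordinate moves; the differences of [b] telescope along this
   path. *)
pose w (k : nat) : 'rV[R]_d := \row_i (if (i < k)%N then h * v 0 i else 0).
pose b k := fine (ball_rV (fun x => (f (x + w k))%:E)).
have w0 : w 0%N = 0 by apply/rowP => i; rewrite !mxE.
have wd : w d = h *: v by apply/rowP => i; rewrite !mxE ltn_ord.
have wS (k : 'I_d) : w k.+1 = w k + (h * v 0 k) *: delta_mx 0 k.
  apply/rowP => i; rewrite !mxE/= ltnS leq_eqVlt -val_eqE.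
  by case: eqVneq => [/val_inj->|_]; rewrite ?ltnn/= ?mulr1 ?add0r ?mulr0 ?addr0.
pose v' k : 'rV[R]_d := \row_i (if (i < k)%N then v 0 i else 0).
have wE k : w k = h *: v' k.
  by apply/rowP => i; rewrite !mxE; case: ifPn; rewrite ?mulr0.
have v'v k : l1norm (v' k) <= l1norm v.
  by apply: ler_sum => i _; rewrite mxE; case: ifPn; rewrite ?normr0.
(* With [0 <= f] and [f <= M] on the larger ball, convexity toward [z + v'] gives the upper
   estimate, and writing [z] as a combination of [z + h v'] and [z - v'] with weights [1/(1+h)] and
   [h/(1+h)] gives the lower one. *)
have lip k z : l1norm z = 1 -> `|f (z + w k) - f z| <= h * M.
  move=> z1; rewrite wE ler_norml.
  have b1 : f (z + v' k) <= M.
    rewrite (le_trans (ler_norm _))// fM// (le_trans (l1normD _ _))// z1 lerD2l//.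
  have b2 : f (z - v' k) <= M.
    rewrite (le_trans (ler_norm _))// fM// (le_trans (l1normB _ _))// z1 lerD2l//.
  have h01 : 0 <= h <= 1 by rewrite (ltW h0).
  have c1 := cf (z + v' k) z h h01.
  have e1 : h *: (z + v' k) + (1 - h) *: z = z + h *: v' k.
    by apply/rowP => i; rewrite !mxE; ring.
  rewrite e1 in c1.
  have hh : 0 < 1 + h by rewrite addr_gt0.
  have h02 : 0 <= (1 + h)^-1 <= 1.
    by rewrite invr_ge0 (ltW hh) invf_le1// lerDl ltW.
  have c2 := cf (z + h *: v' k) (z - v' k) _ h02.
  have e2 : (1 + h)^-1 *: (z + h *: v' k) + (1 - (1 + h)^-1) *: (z - v' k) = z.
    by apply/rowP => i; rewrite !mxE; field; rewrite gt_eqF.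
  rewrite e2 in c2.
  have c3 : (1 + h) * f z <= f (z + h *: v' k) + h * f (z - v' k).
    have : (1 + h) * f z <= (1 + h) * ((1 + h)^-1 * f (z + h *: v' k) +
        (1 - (1 + h)^-1) * f (z - v' k)) by rewrite ler_pM2l.
    congr (_ <= _); field; rewrite gt_eqF//.
  have fz0 := f0 z.
  have b3 : h * f (z + v' k) <= h * M by rewrite ler_pM2l.
  have b4 : h * f (z - v' k) <= h * M by rewrite ler_pM2l.
  have b5 : 0 <= h * f z by rewrite mulr_ge0// ltW.
  by apply/andP; split; lra.
have step (k : 'I_d) : h * (v 0 k * sign_int f k) <=
    b k.+1 - b k + h * (`|v 0 k| * (2 * (h * M * mass))).
  have := ball_increment k (h * v 0 k) (cfw (w k)) (fun x => f0 _).
  have -> : fine (ball_rV (fun x =>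
      (f (x + (h * v 0 k) *: delta_mx 0 k + w k))%:E)) = b k.+1.
    rewrite /b wS; congr (fine (ball_rV _)); apply/funext => x.
    by congr (f _)%:E; rewrite -addrA (addrC (w k)).
  rewrite -/(b k).
  have hM0 : 0 <= h * M by rewrite mulr_ge0// ltW.
  have := sign_int_lip k (cfw (w k)) cf (fun x => f0 _) f0 hM0 (lip k).
  set S' := sign_int _ _; set S := sign_int f k => SS' bk.
  have : v 0 k * (S - S') <= `|v 0 k| * (2 * (h * M * mass)).
    rewrite (le_trans (ler_norm _))// normrM distrC ler_wpM2l//.
  by move=> /(ler_wpM2l (ltW h0)); lra.
have tot : h * \sum_j v 0 j * sign_int f j <=
    b d - b 0%N + h * (l1norm v * (2 * (h * M * mass))).
  rewrite mulr_sumr /l1norm mulr_suml mulr_sumr.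
  rewrite -(telescope_sumr b (leq0n d)) big_mkord -big_split/=.
  by apply: ler_sum => k _; exact: step.
have bb : b d - b 0%N <= h * (K * ball_mass).
  rewrite /b w0 wd.
  under [X in _ - fine (ball_rV X)]eq_fun do rewrite addr0.
  have f1 := ball_rV_fin cf f0; have f2 := ball_rV_fin (cfw (h *: v)) (fun x => f0 _).
  (* [K] may be negative while integrands must be nonnegative, so [h * |K|] is added on both
     sides. *)
  have K0 : 0 <= h * `|K| by rewrite mulr_ge0// ltW.
  have K1 : 0 <= h * (K + `|K|).
    by rewrite mulr_ge0 ?(ltW h0)//; have := ler_norm (- K); rewrite normrN; lra.
  have : (ball_rV (fun x => (f (x + h *: v))%:E + (h * `|K|)%:E) <=
      ball_rV (fun x => (f x)%:E + (h * (K + `|K|))%:E))%E.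
    apply: le_ball_rV.
    - by apply: emeasurable_funD => //; exact: (cvx_measurableE (cfw (h *: v))).
    - by apply: emeasurable_funD => //; exact: cvx_measurableE.
    - by move=> x; rewrite -EFinD lee_fin addr_ge0.
    - by move=> x; rewrite -EFinD lee_fin addr_ge0.
    move=> x x1; rewrite -!EFinD lee_fin.
    have h01 : 0 <= h <= 1 by rewrite (ltW h0).
    have := cf (x + v) x h h01.
    have -> : h *: (x + v) + (1 - h) *: x = x + h *: v.
      by apply/rowP => i; rewrite !mxE; ring.
    have : h * (f (x + v) - f x) <= h * K by rewrite ler_pM2l// fK.
    lra.
  have mh := cvx_measurableE (cfw (h *: v)); have m0 := cvx_measurableE cf.
  have fe0 x : (0 <= (f x)%:E)%E by rewrite lee_fin.
  rewrite (ball_rVDc mh (fun x => fe0 _) K0) (ball_rVDc m0 fe0 K1).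
  rewrite -(fineK f1) -(fineK f2) -!EFinD lee_fin/=; lra.
rewrite -(ler_pM2l h0); apply: (le_trans tot); rewrite mulrDr.
by apply: lerD => //; rewrite ler_pM2l//; lra.
Qed.

End sphere_gradient_inequality.

Section sphere_law_gradient.
Local Open Scope ereal_scope.
Context {R : realType} (n : nat).
Local Notation d := n.+1.
Local Notation V := (borel_rV R n.+1).
Local Notation "'II'" := (@sphere_rV R n).
Local Notation mass := (@sphere_mass R n).
Variable Q : probability V R.
Hypothesis QE : forall A : set V, measurable A -> Q A = (l1_sphere_uniform A)%:E.
Implicit Types (f : 'rV[R]_d -> R) (j : 'I_d).

Lemma measurable_l1norm : measurable_fun setT (@l1norm R d : V -> R).
Proof.
apply: measurable_sum => j.
by apply: measurableT_comp => //; exact: measurable_coord.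
Qed.

Lemma sphere_law_null (A : set V) : measurable A ->
  II (fun v => (\1_A v)%:E) = 0 -> Q A = 0.
Proof.
move=> mA; rewrite -(sphere_law_indic QE mA) => /eqP.
by rewrite mule_eq0 eqe gt_eqF ?sphere_mass_gt0//= => /eqP.
Qed.

Lemma measurable_sphere : measurable ([set v | l1norm v = 1%R] : set V).
Proof.
have := measurable_l1norm measurableT (measurable_set1 (1%R : R)).
by rewrite setTI.
Qed.

Lemma sphere_law_sphere : Q [set v | l1norm (v : 'rV[R]_d) = 1%R] = 1.
Proof.
have mS := measurable_sphere.
have : Q (~` [set v | l1norm (v : 'rV[R]_d) = 1%R]) = 0.
  apply: sphere_law_null; first exact: measurableC.
  apply/eqP; rewrite eq_le; apply/andP; split; last exact: sphere_rV_ge0.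
  rewrite -[leRHS](@sphere_int0 R n 1).
  apply: (@le_sphere_rV _ _ _ (fun _ => 0)) => //.
    by apply/measurable_EFinP; apply: measurable_indic; exact: measurableC.
  by move=> v v1; rewrite lee_fin indicE memNset//= => /(_ v1).
rewrite probability_setC// => /eqP; rewrite sube_eq ?fin_num_measure// ?add0e.
  by move=> /eqP.
Qed.

Lemma sphere_law_ae : {ae Q, forall v, l1norm (v : 'rV[R]_d) = 1%R}.
Proof.
exists (~` [set v | l1norm (v : 'rV[R]_d) = 1%R]); split => //.
- by apply: measurableC; exact: measurable_sphere.
- by rewrite probability_setC ?sphere_law_sphere ?subee//; exact: measurable_sphere.
Qed.

(** Almost everywhere each sign is the difference of the indicators of the two strict half-spheres,
    which links [signv] to [pos_int] and [neg_int]. *)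
Lemma sphere_law_coord_neq0 j : (0 < n)%N -> {ae Q, forall v : V, (v : 'rV[R]_d) 0%R j != 0%R}.
Proof.
move=> n0; pose Z : set V := [set v | (v : 'rV[R]_d) 0%R j = 0%R].
have mZ : measurable Z.
  have := measurable_coord j measurableT (measurable_set1 (0%R : R)).
  by rewrite setTI.
exists Z; split => //; last by move=> v /= /negP; rewrite negbK => /eqP.
apply: sphere_law_null => //.
case: n n0 j @Z mZ => // m _ j Z mZ.
rewrite -[RHS](@sphere_int_coord0 R m j 1 (leq_ord j)).
apply: eq_sphere_int_all => l; rewrite indicE.
case: eqP => lj; first by rewrite mem_set// /Z/= mxE.
by rewrite memNset//= /Z/= mxE.
Qed.

Lemma sphere_law_sign_int f j : cvx f -> (forall x, 0 <= f x)%R ->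
  Q.-integrable setT (fun v => (if 0 < (v : 'rV[R]_d) 0 j then f v else 0)%R%:E) /\
  Q.-integrable setT (fun v => (if (v : 'rV[R]_d) 0 j < 0 then f v else 0)%R%:E) /\
  \int[Q]_v ((if 0 < (v : 'rV[R]_d) 0 j then f v else 0)
    - (if (v : 'rV[R]_d) 0 j < 0 then f v else 0))%R%:E = (sign_int f j / mass)%:E.
Proof.
move=> cf f0; have m0 := @sphere_mass_gt0 R n.
have pif : (fun v : V => (if 0 < (v : 'rV[R]_d) 0 j then f v else 0)%R%:E) =
    (fun v : V => if (0 < (v : 'rV[R]_d) 0 j)%R then (f v)%:E else 0).
  by apply/funext => v; case: ifPn.
have nif : (fun v : V => (if (v : 'rV[R]_d) 0 j < 0 then f v else 0)%R%:E) =
    (fun v : V => if ((v : 'rV[R]_d) 0 j < 0)%R then (f v)%:E else 0).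
  by apply/funext => v; case: ifPn.
have mp : measurable_fun setT (fun v : V => (if 0 < (v : 'rV[R]_d) 0 j then f v else 0)%R%:E).
  by rewrite pif; exact: measurable_pos_part.
have mn : measurable_fun setT (fun v : V => (if (v : 'rV[R]_d) 0 j < 0 then f v else 0)%R%:E).
  by rewrite nif; exact: measurable_neg_part.
have p0 (v : V) : 0 <= (if 0 < (v : 'rV[R]_d) 0 j then f v else 0)%R%:E.
  by rewrite lee_fin; case: ifPn.
have n0 (v : V) : 0 <= (if (v : 'rV[R]_d) 0 j < 0 then f v else 0)%R%:E.
  by rewrite lee_fin; case: ifPn.
have pI := sphere_law_integral QE mp p0; have nI := sphere_law_integral QE mn n0.
rewrite [II _](_ : _ = pos_int f j) in pI; last by rewrite pif.
rewrite [II _](_ : _ = neg_int f j) in nI; last by rewrite nif.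
have fin (x y : \bar R) : mass%:E * x = y -> y \is a fin_num -> x = (fine y / mass)%:E.
  case: x y => [x| |] [y| |]//=; rewrite ?gt0_muley ?gt0_muleNy ?lte_fin//.
  by rewrite -EFinM => -[<-] _; congr (_%:E); rewrite mulrC mulKf// gt_eqF.
have pI' := fin _ _ pI (pos_int_fin j cf f0).
have nI' := fin _ _ nI (neg_int_fin j cf f0).
have ip : Q.-integrable setT (fun v => (if 0 < (v : 'rV[R]_d) 0 j then f v else 0)%R%:E).
  apply/integrableP; split => //.
  by under eq_integral do rewrite gee0_abs//; rewrite pI' ltry.
have inn : Q.-integrable setT (fun v => (if (v : 'rV[R]_d) 0 j < 0 then f v else 0)%R%:E).
  apply/integrableP; split => //.
  by under eq_integral do rewrite gee0_abs//; rewrite nI' ltry.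
split=> //; split=> //.
under eq_integral do rewrite EFinB.
by rewrite integralB// pI' nI' -EFinB /sign_int mulrBl.
Qed.

(** A constant function has zero increments, so the gradient inequality in the directions [e_j] and
    [-e_j] bounds its sign integral from both sides by 0. *)
Lemma sign_int1 j : sign_int (fun _ : 'rV[R]_d => 1%R) j = 0%R.
Proof.
have c1 : cvx (fun _ : 'rV[R]_d => 1%R).
  by move=> x y t _; rewrite !mulr1 addrC subrK.
have h (a : R) : (a * sign_int (fun _ : 'rV[R]_d => 1%R) j <= 0)%R.
  have := @sphere_gradient_le R n (fun _ => 1%R) (a *: delta_mx 0 j)%R 0%R c1 (fun _ => ler01).
  rewrite subrr mul0r => /(_ (fun _ _ => lexx _)).
  rewrite (bigD1 j)//= big1 => [|i ij].
    by rewrite addr0 !mxE !eqxx mulr1 pmulr_rle0.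
  by rewrite !mxE (negbTE ij) andbF mulr0 mul0r.
by have := h 1%R; have := h (-1)%R; lra.
Qed.

(** The sphere form of the gradient inequality requires a nonnegative function. An additive constant
    changes nothing because the signs have mean zero, so [f] can be lifted by a bound [M]. *)
Lemma sphere_law_gradient f (v : 'rV[R]_d) (K : R) : (0 < n)%N -> cvx f ->
  (forall z, l1norm z <= 1 -> f (z + v) - f z <= K)%R ->
  let F z := (if l1norm z == 1 then f z * dotp (signv z) v else 0)%R in
  Q.-integrable setT (fun z : V => (F z)%:E) /\
  \int[Q]_z (F z)%:E <= (K / d%:R)%:E.
Proof.
move=> n0 cf fK F.
have [M M0 fM] := cvx_bounded (1 + l1norm v) cf.
(* Truncation keeps [g] convex and nonnegative everywhere, while [g = f + M] on the ball of radius
   [1 + l1norm v], which contains every [z] and [z + v] that matter. *)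
pose g x := Num.max (f x + M)%R 0%R.
have g0 x : (0 <= g x)%R by rewrite /g le_max lexx orbT.
have gE x : (l1norm x <= 1 + l1norm v -> g x = f x + M)%R.
  move=> /fM; rewrite ler_norml => /andP[h _]; rewrite /g max_l//; lra.
have cg : cvx g.
  move=> x y t t01; rewrite {1}/g ge_max; case/andP: (t01) => t0 t1.
  have t1' : (0 <= 1 - t)%R by lra.
  have gx : (f x + M <= g x)%R by rewrite /g le_max lexx.
  have gy : (f y + M <= g y)%R by rewrite /g le_max lexx.
  rewrite addr_ge0 ?mulr_ge0// andbT.
  have := cf x y t t01; have := ler_wpM2l t0 gx; have := ler_wpM2l t1' gy; lra.
have gK z : (l1norm z <= 1 -> g (z + v) - g z <= K)%R.
  move=> z1; rewrite !gE ?(le_trans z1) ?lerDl ?l1norm_ge0//; last first.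
    by rewrite (le_trans (l1normD _ _))// lerD2r.
  by have := fK z z1; lra.
have grad := sphere_gradient_le cg g0 gK.
have c1 : cvx (fun _ : 'rV[R]_d => 1%R).
  by move=> x y t _; rewrite !mulr1 addrC subrK.
pose P h j (z : V) := (if 0 < (z : 'rV[R]_d) 0 j then h z else 0 : R)%R.
pose N h j (z : V) := (if (z : 'rV[R]_d) 0 j < 0 then h z else 0 : R)%R.
pose one := fun _ : 'rV[R]_d => 1%R : R.
pose X j z := ((P g j z - N g j z) - M * (P one j z - N one j z))%R.
have iX j : Q.-integrable setT (fun z => (X j z)%:E) /\
    \int[Q]_z (X j z)%:E = (sign_int g j / mass)%:E.
  have [ip [inn I]] := sphere_law_sign_int j cg g0.
  have [ip1 [in1 I1]] := sphere_law_sign_int j c1 (fun _ => ler01).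
  have i1 := integrableB measurableT ip inn.
  have i2 := integrableZl measurableT M (integrableB measurableT ip1 in1).
  rewrite sign_int1 mul0r in I1.
  have XE : (fun z => (X j z)%:E) = (fun z => (P g j z - N g j z)%R%:E -
      M%:E * (P one j z - N one j z)%R%:E).
    by apply/funext => z; rewrite /X EFinB EFinM.
  rewrite XE; split; first exact: (integrableB measurableT i1 i2).
  rewrite (integralB measurableT i1 i2).
  rewrite integralZl//; last exact: (integrableB measurableT ip1 in1).
  by rewrite I I1 mule0 sube0.
pose Th (z : V) := \sum_j (v 0%R j)%:E * (X j z)%:E.
have iTh : Q.-integrable setT Th.
  by apply: integrable_sum => // j _; apply: integrableZl => //; exact: (iX j).1.
have ITh : \int[Q]_z Th z = ((\sum_j v 0%R j * sign_int g j) / mass)%:E.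
  rewrite /Th integral_sum//; last first.
    by move=> j; apply: integrableZl => //; exact: (iX j).1.
  rewrite mulr_suml -sumEFin; apply: eq_bigr => j _.
  by rewrite integralZl ?(iX j).2//; [rewrite -EFinM mulrA|exact: (iX j).1].
have mF : measurable_fun setT (fun z : V => (F z)%:E).
  apply/measurable_EFinP; apply: measurable_fun_ifT => //.
    by apply: measurable_fun_eqr => //; exact: measurable_l1norm.
  apply: measurable_funM; first exact: cvx_measurable.
  apply: measurable_sum => j; apply: measurable_funM => //.
  have -> : (fun z : V => signv (z : 'rV[R]_d) 0%R j) =
      (fun z : V => if (z : 'rV[R]_d) 0 j < 0 then -1 else 1)%R.
    by apply/funext => z; rewrite mxE.
  apply: measurable_fun_ifT => //.
  by apply: measurable_fun_ltr => //; exact: measurable_coord.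
have FTh : ae_eq Q setT (fun z : V => (F z)%:E) Th.
  have nz : {ae Q, forall z : V, forall j, (z : 'rV[R]_d) 0%R j != 0%R}.
    by apply: filter_forall => j; exact: sphere_law_coord_neq0.
  have := sphere_law_ae; move: nz; apply: filterS2 => z zn z1 _.
  rewrite /F z1 eqxx /Th /dotp mulr_sumr -sumEFin; apply: eq_bigr => j _.
  rewrite -EFinM; congr (_%:E); rewrite mxE /X /P /N /sign1 /one.
  have -> : (f z = g z - M)%R by rewrite gE ?z1 ?lerDl ?l1norm_ge0// addrK.
  by case: ltgtP (zn j) => //= _ _; ring.
have iF : Q.-integrable setT (fun z : V => (F z)%:E).
  apply/integrableP; split => //; have [_] := integrableP _ _ _ iTh.
  rewrite (@ae_eq_integral _ _ _ Q setT (fun z => `|Th z|) (fun z => `|(F z)%:E|))//.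
  - exact: measurableT_comp.
  - by apply: measurableT_comp => //; exact: measurable_int iTh.
  - by move: FTh; apply: filterS => z h Dz; rewrite h.
split=> //; rewrite (@ae_eq_integral _ _ _ Q setT Th (fun z => (F z)%:E))//; last first.
  exact: measurable_int iTh.
rewrite ITh lee_fin ler_pdivrMr ?sphere_mass_gt0//.
by rewrite mulrAC ler_pdivlMr ?ltr0n// mulrC.
Qed.

End sphere_law_gradient.

Section sphere_law_variance.
Local Open Scope ereal_scope.
Context {R : realType} (n : nat).
Local Notation d := n.+1.
Local Notation V := (borel_rV R n.+1).
Variable Q : probability V R.
Hypothesis QE : forall A : set V, measurable A -> Q A = (l1_sphere_uniform A)%:E.

(** Normalising the Efron-Stein bound: [d] coordinates, each contributing [L^2] times the second
    moment [2 / (d (d + 1))]. *)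
Lemma sphere_law_variance (f : V -> R) (L : R) : measurable_fun setT f ->
  (0 <= L)%R -> (forall v, f (- v) = - f v)%R ->
  (forall j (v : 'rV[R]_d), l1norm v = 1 ->
     `|f v - f (flip_rV j v)| <= 2 * L * `|v 0 j|)%R ->
  \int[Q]_v (f v ^+ 2)%:E <= (2 * L ^+ 2 / d.+1%:R)%:E.
Proof.
move=> mf L0 fN fL; have := sphere_rV_variance mf L0 fN fL.
have m2 : measurable_fun setT (fun v => (f v ^+ 2)%:E : \bar R).
  by apply/measurable_EFinP; exact: (measurable_funX 2 mf).
rewrite -(sphere_law_integral QE m2); last by move=> v; rewrite lee_fin sqr_ge0.
have m0 := @sphere_mass_gt0 R n.
rewrite -lee_pdivlMl// => /le_trans; apply; rewrite -EFinM lee_fin.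
rewrite /sphere_mass !factS !natrM !exprS.
have f0 : (n`!%:R != 0 :> R)%R by rewrite pnatr_eq0 -lt0n fact_gt0.
have p0 : (2 ^+ n != 0 :> R)%R by rewrite expf_neq0// pnatr_eq0.
have d0 : (n.+1%:R != 0 :> R)%R by rewrite pnatr_eq0.
have d1 : (n.+2%:R != 0 :> R)%R by rewrite pnatr_eq0.
rewrite le_eqVlt; apply/orP; left; apply/eqP.
move: f0 p0 d0 d1; move: (n`!%:R : R)%R (2 ^+ n : R)%R (n.+1%:R : R)%R (n.+2%:R : R)%R => a b c e *.
by field; apply/and4P.
Qed.

End sphere_law_variance.

(** * Pathwise regret *)

Section logarithm_bounds.
Context {R : realType}.
Implicit Types (a b m : R).

Lemma ln_le_subr1 a : 0 < a -> ln a <= a - 1.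
Proof.
move=> a0; have := @le_ln1Dx R (a - 1).
by rewrite (_ : 1 + (a - 1) = a); [apply; lra|ring].
Qed.

Lemma lnB_le a b : 0 < a -> 0 < b -> ln a - ln b <= (a - b) / b.
Proof.
move=> a0 b0; rewrite -ln_div ?posrE// (le_trans (ln_le_subr1 _)) ?divr_gt0//.
by rewrite mulrBl mulfV ?gt_eqF.
Qed.

Lemma lnB_mul_le a b m : 0 < m -> m <= a -> m <= b ->
  (ln a - ln b) * (a - b) <= (a - b) ^+ 2 / m.
Proof.
move=> m0.
wlog : a b / b <= a => [h|ba] ma mb.
  have [ba|ab] := leP b a; first exact: h.
  have := h b a (ltW ab) mb ma; rewrite -(opprB a b) sqrrN -(opprB (ln a)) mulrNN//.
have a0 := lt_le_trans m0 ma; have b0 := lt_le_trans m0 mb.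
rewrite expr2 -mulrA mulrC; apply: ler_wpM2l; first by rewrite subr_ge0.
apply: (le_trans (lnB_le a0 b0)); apply: ler_wpM2l; first by rewrite subr_ge0.
by rewrite lef_pV2.
Qed.

(** Strong monotonicity of the entropy gradient on the unit interval; it is the source of the
    stability of the mirror step. *)
Lemma lnB_mul_ge a b : 0 < a <= 1 -> 0 < b <= 1 ->
  (a - b) ^+ 2 <= (ln a - ln b) * (a - b).
Proof.
wlog : a b / b <= a => [h|ba] /andP[a0 a1] /andP[b0 b1].
  have [ba|ab] := leP b a; first by apply: h => //; apply/andP.
  have := h b a (ltW ab); rewrite a0 a1 b0 b1 => /(_ isT isT).
  by rewrite -(opprB a b) sqrrN -(opprB (ln a)) mulrNN.
rewrite expr2; apply: ler_wpM2r; first by rewrite subr_ge0.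
have := lnB_le b0 a0.
have : a - b <= (a - b) / a.
  by rewrite ler_pdivlMr// ler_piMr// subr_ge0.
rewrite -(opprB a b) mulNr; lra.
Qed.

Lemma entropy_sub_le a b : 0 < a -> 0 < b ->
  a * ln a - b * ln b <= (ln a + 1) * (a - b).
Proof.
move=> a0 b0; have := lnB_le a0 b0.
rewrite ler_pdivlMr// => h; lra.
Qed.

(** Per coordinate, relative entropy dominates the squared Hellinger distance [(sqrt a - sqrt b)^2],
    and Young's inequality splits [g (b - a) = g (sqrt b - sqrt a)(sqrt b + sqrt a)] against it.
    Over the simplex the terms [(a + b) / 2] sum to 1. *)
Lemma entropy_pinsker a b g eta M : 0 < a -> 0 < b -> 0 < eta -> `|g| <= M ->
  g * (b - a) <= eta^-1 * (a * (ln a - ln b) - a + b) + eta * M ^+ 2 * ((a + b) / 2).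
Proof.
move=> a0 b0 e0 gM.
have root (c : R) : 0 < c -> exists2 z, 0 < z & c = z ^+ 2.
  by move=> c0; exists (Num.sqrt c); rewrite ?sqrtr_gt0// sqr_sqrtr ?ltW.
have [x x0 ax] := root _ a0; have [y y0 bY] := root _ b0.
have l1 : (x - y) ^+ 2 <= a * (ln a - ln b) - a + b.
  have := lnB_le y0 x0; rewrite ler_pdivlMr// => h.
  rewrite ax bY !lnXn// !mulr2n; set p := ln x; set q := ln y.
  rewrite -/p -/q in h; have := ler_wpM2l (ltW x0) h; lra.
have M0 : 0 <= M by rewrite (le_trans _ gM).
have l2 : g * (b - a) <= eta^-1 * (x - y) ^+ 2 + eta * M ^+ 2 * ((a + b) / 2).
  pose p := eta^-1.
  have pe : p * eta = 1 by rewrite mulVf ?gt_eqF.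
  have p0 : 0 < p by rewrite invr_gt0.
  have h1 : g * (b - a) <= M * (`|y - x| * (x + y)).
    rewrite (le_trans (ler_norm _))// normrM.
    have -> : b - a = (y - x) * (x + y) by rewrite ax bY; ring.
    rewrite normrM (gtr0_norm (addr_gt0 x0 y0)).
    by apply: ler_wpM2r => //; rewrite mulr_ge0// ltW// addr_gt0.
  apply: (le_trans h1).
  have -> : (x - y) ^+ 2 = `|y - x| ^+ 2 by rewrite real_normK ?num_real// -(opprB y x) sqrrN.
  rewrite -/p; set w := `|y - x|.
  have h2 : 0 <= p * (w - eta * M * (x + y) / 2) ^+ 2.
    by rewrite mulr_ge0 ?sqr_ge0 ?ltW.
  have h3 : p * (w - eta * M * (x + y) / 2) ^+ 2 =
    p * w ^+ 2 - (p * eta) * (M * (w * (x + y))) +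
     (p * eta) * eta * M ^+ 2 * (x + y) ^+ 2 / 4 by field.
  rewrite h3 pe !mul1r in h2.
  have h4 : eta * M ^+ 2 * (x + y) ^+ 2 / 4 <= eta * M ^+ 2 * ((a + b) / 2).
    rewrite -mulrA; apply: ler_wpM2l; first by rewrite mulr_ge0 ?sqr_ge0 ?ltW.
    have := sqr_ge0 (x - y); rewrite ax bY; lra.
  lra.
apply: (le_trans l2); rewrite lerD2r; apply: ler_wpM2l => //.
by rewrite invr_ge0 ltW.
Qed.

(** Valid for every real [a], so exponential weights can be analysed without assuming [gamma * phi]
    small. Up to 1/2, [exp a <= 1 + a + 2 a^2] follows from [(1 - a) exp a <= 1]; beyond,
    [a <= 2 a^2]. *)
Lemma expR_le_quad a : expR a <= a + expR (2 * a ^+ 2).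
Proof.
have [a12|a12] := leP a (1 / 2).
  have h1 : expR a <= 1 + a + 2 * a ^+ 2.
    have := expR_ge1Dx (- a); rewrite expRN => h.
    have a1 : 0 < 1 - a by lra.
    have := expR_gt0 a; set e := expR a in h * => e0.
    have h' : (1 - a) * e <= 1 by rewrite -ler_pdivlMr// div1r.
    have : (1 - a) * e <= (1 - a) * (1 + a + 2 * a ^+ 2).
      apply: (le_trans h').
      have : 0 <= a ^+ 2 * (1 - 2 * a) by rewrite mulr_ge0 ?sqr_ge0//; lra.
      lra.
    by rewrite ler_pM2l.
  have := expR_ge1Dx (2 * a ^+ 2); lra.
have : expR a <= expR (2 * a ^+ 2) by rewrite ler_expR expr2 mulrA ler_peMl//; lra.
lra.
Qed.

End logarithm_bounds.

Section shrunk_simplex_geometry.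
Context {R : realType} {d : nat} (alpha : R).
Hypothesis d0 : (0 < d)%N.
Hypothesis alpha01 : 0 < alpha <= 1.
Local Notation X := (@shrunk_simplex R d alpha).

Let dR0 : 0 < d%:R :> R. Proof. by rewrite ltr0n. Qed.

Let sum_inv : \sum_(j < d) (d%:R^-1 : R) = 1.
Proof. by rewrite sumr_const card_ord -[LHS]mulr_natl mulfV// gt_eqF. Qed.

Lemma barycenter_simplex : simplex (barycenter : 'rV[R]_d).
Proof.
split=> [j|]; first by rewrite mxE invr_ge0 ler0n.
by under eq_bigr do rewrite mxE.
Qed.

(** Shrinking toward the barycenter amounts to a floor [alpha / d] on every coordinate; in this form
    positivity, convexity and the bound on logarithms are immediate. *)
Lemma shrunk_simplexP (z : 'rV[R]_d) :
  X z <-> (forall j, alpha / d%:R <= z 0 j) /\ \sum_j z 0 j = 1.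
Proof.
case/andP: alpha01 => a0 a1; split.
  move=> [x [x0 x1] <-]; split=> [j|].
    by rewrite !mxE lerDr mulr_ge0// subr_ge0.
  under eq_bigr do rewrite !mxE.
  by rewrite big_split/= -!mulr_sumr x1 sum_inv !mulr1 subrK.
(* For [alpha = 1] the preimage cannot be found by dividing by [1 - alpha]; the floors already sum
   to 1 and force [z] to be the barycenter. *)
move=> [z0 z1]; have [a1'|a1'] := eqVneq alpha 1.
  exists (barycenter : 'rV[R]_d); first exact: barycenter_simplex.
  rewrite a1' subrr scale0r add0r scale1r.
  have h : \sum_j (z 0 j - d%:R^-1) = 0.
    by rewrite sumrB z1 sum_inv subrr.
  apply/rowP => j; rewrite mxE; apply/eqP; rewrite eq_sym -subr_eq0; apply/eqP.
  have := h; rewrite (bigD1 j)//= => /eqP; rewrite paddr_eq0.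
  - by move=> /andP[/eqP].
  - by rewrite subr_ge0; have := z0 j; rewrite a1' div1r.
  - by apply: sumr_ge0 => i _; rewrite subr_ge0; have := z0 i; rewrite a1' div1r.
have b0 : 0 < 1 - alpha by rewrite subr_gt0 lt_neqAle a1'.
exists ((1 - alpha)^-1 *: (z - alpha *: barycenter)); last first.
  by rewrite scalerA mulfV ?gt_eqF// scale1r subrK.
split=> [j|].
  by rewrite !mxE mulr_ge0 ?invr_ge0 ?(ltW b0)// subr_ge0.
under eq_bigr do rewrite !mxE.
by rewrite -mulr_sumr sumrB z1 -mulr_sumr sum_inv mulr1 mulVf ?gt_eqF.
Qed.

Lemma shrunk_simplex_gt0 z j : X z -> 0 < z 0 j.
Proof.
case/andP: alpha01 => a0 _ /shrunk_simplexP[z0 _].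
by apply: lt_le_trans (z0 j); rewrite divr_gt0.
Qed.

Lemma shrunk_simplex_le1 z j : X z -> z 0 j <= 1.
Proof.
move=> Xz; have [_ <-] := (shrunk_simplexP z).1 Xz.
by rewrite (bigD1 j)//= lerDl sumr_ge0// => i _; rewrite ltW// shrunk_simplex_gt0.
Qed.

Lemma shrunk_simplex_convex z u (t : R) : X z -> X u -> 0 <= t <= 1 ->
  X (z + t *: (u - z)).
Proof.
move=> /shrunk_simplexP[z0 z1] /shrunk_simplexP[u0 u1] /andP[t0 t1].
apply/shrunk_simplexP; split=> [j|].
  rewrite !mxE; have := z0 j; have := u0 j; set m := alpha / _ => h1 h2.
  have t1' : 0 <= 1 - t by rewrite subr_ge0.
  have := ler_wpM2l t0 h1; have := ler_wpM2l t1' h2; lra.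
under eq_bigr do rewrite !mxE.
by rewrite big_split/= -mulr_sumr sumrB z1 u1 subrr mulr0 addr0.
Qed.

Lemma barycenter_shrunk : X barycenter.
Proof.
case/andP: alpha01 => a0 a1; apply/shrunk_simplexP.
split; last by have [_] := barycenter_simplex.
by move=> j; rewrite mxE ler_piMl// invr_ge0 ltW.
Qed.

Lemma shrunk_simplex_sum (I : eqType) (r : seq I) (w : I -> R) (z : I -> 'rV[R]_d) :
  (forall i, i \in r -> 0 <= w i) -> \sum_(i <- r) w i = 1 ->
  (forall i, i \in r -> X (z i)) -> X (\sum_(i <- r) w i *: z i).
Proof.
move=> w0 w1 Xz; apply/shrunk_simplexP; split=> [j|].
  have -> : alpha / d%:R = \sum_(i <- r) w i * (alpha / d%:R).
    by rewrite -mulr_suml w1 mul1r.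
  rewrite summxE big_seq [leRHS]big_seq.
  apply: ler_sum => i ir; rewrite mxE; apply: ler_wpM2l; first exact: w0.
  by have [h _] := (shrunk_simplexP _).1 (Xz i ir); exact: h.
transitivity (\sum_(i <- r) w i * \sum_j z i 0 j).
  under eq_bigr do rewrite summxE.
  rewrite exchange_big; apply: eq_bigr => i _; rewrite mulr_sumr.
  by apply: eq_bigr => j _; rewrite mxE.
rewrite -[RHS]w1 big_seq [RHS]big_seq; apply: eq_bigr => i ir.
by have [_ ->] := (shrunk_simplexP _).1 (Xz i ir); rewrite mulr1.
Qed.

Lemma simplex_l1norm (z : 'rV[R]_d) : simplex z -> l1norm z = 1.
Proof. by move=> [z0 <-]; apply: eq_bigr => j _; rewrite ger0_norm. Qed.

Lemma shrunk_simplexW z : X z -> simplex z.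
Proof.
move=> Xz; split=> [j|]; first by rewrite ltW// shrunk_simplex_gt0.
by have [] := (shrunk_simplexP z).1 Xz.
Qed.

End shrunk_simplex_geometry.

(** * The entropic mirror step *)

Section entropy.
Context {R : realType} {d : nat}.
Implicit Types (x y z u g : 'rV[R]_d).

Lemma grad_neg_entropy y j : 0 < y 0 j ->
  grad neg_entropy y 0 j = ln (y 0 j) + 1.
Proof.
move=> y0; rewrite mxE.
have dl : is_derive (y 0 j) 1 (fun t : R => t * ln t) (ln (y 0 j) + 1).
  have h1 := is_derive1_ln y0.
  have h2 := is_deriveM (is_derive_id (y 0 j) 1) h1.
  apply: (is_derive_eq h2).
  by rewrite /GRing.scale/= mulfV ?gt_eqF// mulr1 addrC.
rewrite -[RHS](@derive_val _ _ _ _ _ _ _ dl) /derive.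
(* Only the j-th summand moves along [delta_mx 0 j], so the difference quotients are exactly those
   of [t * ln t]. *)
have -> // : (fun h : R => h^-1 *: ((neg_entropy \o shift y) (h *: delta_mx 0 j)
      - neg_entropy y)) =
    (fun h : R => h^-1 *: (((fun t : R => t * ln t) \o shift (y 0 j)) (h *: 1)
      - y 0 j * ln (y 0 j))).
apply/funext => h /=; congr (_ *: _); rewrite /neg_entropy.
rewrite (bigD1 j)//= [X in _ - X](bigD1 j)//= !mxE !eqxx !mulr1 /GRing.scale/= mulr1.
rewrite (eq_bigr (fun i => y 0 i * ln (y 0 i))); first by ring.
by move=> i ij; rewrite !mxE (negbTE ij) andbF /GRing.scale/= mulr0 add0r.
Qed.

Lemma bregman_neg_entropy z y : (forall j, 0 < y 0 j) ->
  bregman neg_entropy z y = neg_entropy z - neg_entropy y -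
    \sum_j (ln (y 0 j) + 1) * (z 0 j - y 0 j).
Proof.
move=> y0; rewrite /bregman; congr (_ - _); apply: eq_bigr => j _.
by rewrite grad_neg_entropy// !mxE.
Qed.

Definition kl z y : R := \sum_j z 0 j * (ln (z 0 j) - ln (y 0 j)).

Section mirror_step.
Variables (alpha eta : R).
Hypothesis d0 : (0 < d)%N.
Hypothesis alpha01 : 0 < alpha <= 1.
Hypothesis eta0 : 0 < eta.
Local Notation X := (@shrunk_simplex R d alpha).

Definition mirror_objective g y z := dotp g z + eta^-1 * bregman neg_entropy z y.

(** First-order optimality obtained by comparing [z] with [z + t (u - z)]. Convexity bounds the
    entropy change by the gradient at the new point; the floor [alpha / d] makes the logarithm
    Lipschitz, so returning to the gradient at [z] costs O(t) relative to the main term, which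
    vanishes as [t] tends to 0. *)
Lemma mirror_step_vi g y z u : X y -> is_argmin X (mirror_objective g y) z -> X u ->
  0 <= \sum_j (g 0 j + eta^-1 * (ln (z 0 j) - ln (y 0 j))) * (u 0 j - z 0 j).
Proof.
move=> Xy [Xz zmin] Xu; case/andP: (alpha01) => a0 a1.
have pos v j : X v -> 0 < v 0 j by exact: shrunk_simplex_gt0.
pose m := alpha / d%:R; have m0 : 0 < m by rewrite divr_gt0// ltr0n.
have Xm v j : X v -> m <= v 0 j by move=> /shrunk_simplexP[].
set S := \sum_j _.
pose C := eta^-1 * \sum_j (u 0 j - z 0 j) ^+ 2 / m.
suff : - S <= 0 by rewrite oppr_le0.
apply: (@ler_linear_eps _ _ _ C) => t /andP[t0 t1].
pose w := z + t *: (u - z).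
have Xw : X w by apply: shrunk_simplex_convex => //; rewrite (ltW t0).
have := zmin w Xw; rewrite /mirror_objective !bregman_neg_entropy; last 2 first.
- by move=> j; exact: pos.
- by move=> j; exact: pos.
have sumD (F H : 'I_d -> R) : \sum_j F j - \sum_j H j = \sum_j (F j - H j).
  by rewrite sumrB.
rewrite -subr_ge0 opprD addrACA -mulrBr => h.
have e1 : dotp g w - dotp g z = \sum_j t * (g 0 j * (u 0 j - z 0 j)).
  by rewrite /dotp sumD; apply: eq_bigr => j _; rewrite !mxE; ring.
have e2 : neg_entropy w - neg_entropy y - \sum_j (ln (y 0 j) + 1) * (w 0 j - y 0 j) -
    (neg_entropy z - neg_entropy y - \sum_j (ln (y 0 j) + 1) * (z 0 j - y 0 j)) <=
    \sum_j t * ((ln (w 0 j) - ln (y 0 j)) * (u 0 j - z 0 j)).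
  rewrite /neg_entropy !sumD; apply: ler_sum => j _.
  have := entropy_sub_le (pos w j Xw) (pos z j Xz).
  have -> : w 0 j = z 0 j + t * (u 0 j - z 0 j) by rewrite !mxE.
  lra.
have e3 : \sum_j t * ((ln (w 0 j) - ln (y 0 j)) * (u 0 j - z 0 j)) <=
    \sum_j t * ((ln (z 0 j) - ln (y 0 j)) * (u 0 j - z 0 j)) +
    t * (t * \sum_j (u 0 j - z 0 j) ^+ 2 / m).
  rewrite !mulr_sumr -big_split/=; apply: ler_sum => j _; rewrite -mulrDr.
  rewrite ler_pM2l//.
  have := lnB_mul_le m0 (Xm w j Xw) (Xm z j Xz).
  have -> : w 0 j - z 0 j = t * (u 0 j - z 0 j) by rewrite !mxE; ring.
  rewrite mulrCA exprMn expr2 -!mulrA ler_pM2l// => k; lra.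
have e4 : 0 <= t * (S + t * C).
  apply: (le_trans h); rewrite e1.
  have p0 : 0 <= eta^-1 by rewrite invr_ge0 ltW.
  apply: (@le_trans _ _ (\sum_j t * (g 0 j * (u 0 j - z 0 j)) + eta^-1 *
    (\sum_j t * ((ln (z 0 j) - ln (y 0 j)) * (u 0 j - z 0 j)) +
    t * (t * \sum_j (u 0 j - z 0 j) ^+ 2 / m)))).
    by rewrite lerD2l; apply: ler_wpM2l => //; exact: le_trans e2 e3.
  rewrite mulrDr addrA mulrDr le_eqVlt; apply/orP; left; apply/eqP.
  congr (_ + _); last by rewrite /C; ring.
  rewrite /S !mulr_sumr -big_split/=; apply: eq_bigr => j _; ring.
rewrite pmulr_rge0// in e4; lra.
Qed.

(** Optimality at [z] tested against [u] leaves the difference of the divergences of [u] from [y]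
    and from [z], minus the divergence of [z] from [y]. The latter pays for the movement
    [<g, y - z>] through [entropy_pinsker]. *)
Lemma mirror_step_regret g y z u (M : R) : X y ->
  is_argmin X (mirror_objective g y) z -> X u -> (forall j, `|g 0 j| <= M) ->
  dotp g (y - u) <= eta^-1 * (\sum_j u 0 j * (ln (z 0 j) - ln (y 0 j))) + eta * M ^+ 2.
Proof.
move=> Xy zmin Xu gM; have vi := mirror_step_vi Xy zmin Xu.
have Xz := zmin.1; have pos v j : X v -> 0 < v 0 j by exact: shrunk_simplex_gt0.
have [_ sz] := (shrunk_simplexP d0 alpha01 z).1 Xz.
have [_ sy] := (shrunk_simplexP d0 alpha01 y).1 Xy.
have pin : \sum_j g 0 j * (y 0 j - z 0 j) <=
    \sum_j (eta^-1 * (z 0 j * (ln (z 0 j) - ln (y 0 j)) - z 0 j + y 0 j) +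
       eta * M ^+ 2 * ((z 0 j + y 0 j) / 2)).
  by apply: ler_sum => j _; apply: entropy_pinsker => //; exact: pos.
rewrite big_split/= -!mulr_sumr -mulr_suml !big_split/= sz sy sumrN sz in pin.
have e : \sum_j (g 0 j + eta^-1 * (ln (z 0 j) - ln (y 0 j))) * (u 0 j - z 0 j) =
   - dotp g (y - u) + \sum_j g 0 j * (y 0 j - z 0 j) +
   eta^-1 * (\sum_j u 0 j * (ln (z 0 j) - ln (y 0 j))) -
   eta^-1 * (\sum_j z 0 j * (ln (z 0 j) - ln (y 0 j))).
  rewrite /dotp -sumrN !mulr_sumr -sumrN -!big_split/=; apply: eq_bigr => j _.
  rewrite !mxE; ring.
rewrite e in vi; move: pin vi; rewrite subrK; lra.
Qed.

End mirror_step.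
End entropy.

(** * Pathwise regret of the base learners and of exponential weights *)

Section regret.
Context {R : realType} {d : nat}.
Variables (alpha : R).
Hypothesis d0 : (0 < d)%N.
Hypothesis alpha01 : 0 < alpha <= 1.
Local Notation X := (@shrunk_simplex R d alpha).
Local Notation Lam := (ln (d%:R / alpha)).

Lemma shrunk_simplex_ln (z : 'rV[R]_d) j : X z -> - Lam <= ln (z 0 j) <= 0.
Proof.
move=> Xz; case/andP: (alpha01) => a0 a1.
have z0 := shrunk_simplex_gt0 d0 alpha01 j Xz.
have d0' : 0 < d%:R :> R by rewrite ltr0n.
rewrite ln_le0 ?(shrunk_simplex_le1 d0 alpha01 j Xz)// andbT.
rewrite -lnV ?posrE ?divr_gt0// invf_div ler_ln ?posrE ?divr_gt0//.
by have [h _] := (shrunk_simplexP d0 alpha01 z).1 Xz; exact: h.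
Qed.

(** Abel summation of the divergence differences. The start at the barycenter contributes [ln d],
    the final logarithms are nonpositive, and changing the comparator costs [ln (d / alpha)] per
    unit of l1-length because all logarithms on the shrunk simplex lie between [- ln (d / alpha)]
    and 0. *)
Lemma base_regret (eta : R) (T : nat) (g z u : nat -> 'rV[R]_d) (M : nat -> R) :
  0 < eta -> (1 <= T)%N -> z 1%N = barycenter ->
  (forall t, (1 <= t <= T)%N -> is_argmin X (mirror_objective eta (g t) (z t)) (z t.+1)) ->
  (forall t, (1 <= t <= T)%N -> X (u t)) ->
  (forall t j, (1 <= t <= T)%N -> `|g t 0 j| <= M t) ->
  \sum_(1 <= t < T.+1) dotp (g t) (z t - u t) <=
  eta^-1 * (ln d%:R + Lam * \sum_(1 <= t < T) l1norm (u t.+1 - u t)) +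
  eta * \sum_(1 <= t < T.+1) M t ^+ 2.
Proof.
move=> eta0 T1 z1 zmin Xu gM.
have Xz t : (1 <= t <= T.+1)%N -> X (z t).
  case: t => [//|[|t]] ht; first by rewrite z1; exact: barycenter_shrunk.
  by have [] := zmin t.+1 ht.
pose D t := \sum_j u t 0 j * (ln (z t.+1 0 j) - ln (z t 0 j)).
have abel : \sum_(1 <= t < T.+1) D t <=
    \sum_j u T 0 j * ln (z T.+1 0 j) +
    (ln d%:R + Lam * \sum_(1 <= t < T) l1norm (u t.+1 - u t)).
  have : forall S, (1 <= S <= T)%N -> \sum_(1 <= t < S.+1) D t <=
    \sum_j u S 0 j * ln (z S.+1 0 j) +
    (ln d%:R + Lam * \sum_(1 <= t < S) l1norm (u t.+1 - u t)).
    elim=> [//|[|S] IH] ST.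
      rewrite big_nat1 big_geq// mulr0 addr0 /D.
      have [_ u1] := (shrunk_simplexP d0 alpha01 _).1 (Xu 1%N ST).
      have -> : ln d%:R = \sum_j ln d%:R * u 1%N 0 j by rewrite -mulr_sumr u1 mulr1.
      rewrite -lerBlDl -sumrB.
      rewrite le_eqVlt; apply/orP; left; apply/eqP; apply: eq_bigr => j _.
      by rewrite z1 mxE lnV ?posrE ?ltr0n//; ring.
    have ST' : (1 <= S.+1 <= T)%N by rewrite /= (leq_trans _ (proj2 (andP ST))).
    rewrite big_nat_recr//= [\sum_(1 <= t < S.+2) l1norm _]big_nat_recr//=.
    have := IH ST'; set A := \sum_(1 <= t < S.+2) D t.
    set Ps := \sum_(1 <= t < S.+1) _ => h.
    have k : D S.+2 <= \sum_j u S.+2 0 j * ln (z S.+3 0 j) -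
        \sum_j u S.+1 0 j * ln (z S.+2 0 j) + Lam * l1norm (u S.+2 - u S.+1).
      rewrite /D /l1norm mulr_sumr -sumrB -big_split/=; apply: ler_sum => j _.
      have XS : X (z S.+2) by apply: Xz; rewrite /= ltnW.
      have := shrunk_simplex_ln j XS => /andP[l1 l2].
      have : (u S.+1 0 j - u S.+2 0 j) * ln (z S.+2 0 j) <=
          Lam * `|u S.+2 0 j - u S.+1 0 j|.
        rewrite (le_trans (ler_norm _))// normrM distrC mulrC; apply: ler_wpM2r => //.
        by rewrite ler_norml l1/= (le_trans l2)// -oppr_le0 (le_trans l1).
      by rewrite !mxE; lra.
    rewrite mulrDr; lra.
  by apply; rewrite T1 leqnn.
have last0 : \sum_j u T 0 j * ln (z T.+1 0 j) <= 0.
  have XT : X (z T.+1) by apply: Xz; rewrite /= leqnn.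
  have XuT : X (u T) by apply: Xu; rewrite T1 leqnn.
  rewrite -oppr_ge0 -sumrN; apply: sumr_ge0 => j _; rewrite -mulrN mulr_ge0//.
    by rewrite ltW// (shrunk_simplex_gt0 d0 alpha01).
  by have /andP[_] := shrunk_simplex_ln j XT; rewrite oppr_ge0.
have steps : \sum_(1 <= t < T.+1) dotp (g t) (z t - u t) <=
    \sum_(1 <= t < T.+1) (eta^-1 * D t + eta * M t ^+ 2).
  rewrite big_nat [leRHS]big_nat; apply: ler_sum => t; rewrite ltnS => ht.
  have Xzt : X (z t) by apply: Xz; case/andP: ht => -> /= /leqW.
  exact: (mirror_step_regret d0 alpha01 eta0 Xzt (zmin t ht) (Xu t ht) (fun j => gM t j ht)).
apply: (le_trans steps); rewrite big_split/= -!mulr_sumr lerD2r.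
apply: ler_wpM2l; first by rewrite invr_ge0 ltW.
lra.
Qed.

Variables (T N : nat) (mu gamma : R) (eta : nat -> R).
Variables (f : nat -> 'rV[R]_d -> R) (s xp xm y g : nat -> 'rV[R]_d).
Variables (yb : nat -> nat -> 'rV[R]_d) (om : nat -> nat -> R).
Hypothesis N0 : (0 < N)%N.
Hypothesis run : PBMD_run T mu gamma N eta neg_entropy X barycenter f s xp xm y g yb om.

Lemma run_iterate_in t k : (1 <= t <= T.+1)%N -> (1 <= k <= N)%N -> X (yb k t).
Proof.
case: t => [//|[|t]] ht hk.
  by rewrite (run_init_iterate run)//; exact: barycenter_shrunk.
by have [] := run_iterate run (t := t.+1) ht hk.
Qed.

Lemma run_init_weight_sum : \sum_(1 <= k < N.+1) om k 1%N = 1.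
Proof.
have N0' : N%:R != 0 :> R by rewrite pnatr_eq0 -lt0n.
have N1' : N.+1%:R != 0 :> R by rewrite pnatr_eq0.
transitivity (\sum_(1 <= k < N.+1) N.+1%:R / N%:R * (- k.+1%:R^-1 - - k%:R^-1 : R)).
  rewrite big_nat [RHS]big_nat; apply: eq_bigr => k /andP[k0 kN].
  rewrite (run_init_weight run) ?k0//; congr (_ * _).
  have k0' : k%:R != 0 :> R by rewrite pnatr_eq0 -lt0n.
  rewrite natrM -(natr1 k); have k1' : k%:R + 1 != 0 :> R by rewrite natr1 pnatr_eq0.
  by field; apply/andP.
rewrite -mulr_sumr (telescope_sumr (fun k => - k%:R^-1 : R))// invr1.
have -> : N.+1%:R = N%:R + 1 :> R by rewrite natr1.
have N1'' : N%:R + 1 != 0 :> R by rewrite natr1.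
by field; apply/andP.
Qed.

Lemma run_weight_props t : (1 <= t <= T.+1)%N ->
  (forall k, (1 <= k <= N)%N -> 0 < om k t) /\ \sum_(1 <= k < N.+1) om k t = 1.
Proof.
elim: t => [//|[|t] IH] ht.
  split; last exact: run_init_weight_sum.
  move=> k hk; rewrite (run_init_weight run)//; case/andP: hk => k0 _.
  by rewrite mulr_gt0 ?divr_gt0 ?invr_gt0 ?ltr0n ?muln_gt0 ?k0.
have ht' : (1 <= t.+1 <= T)%N by [].
have [om0 om1] := IH (leqW ht).
have Zterm k : (1 <= k <= N)%N ->
    0 < om k t.+1 * expR (- gamma * dotp (g t.+1) (yb k t.+1 - y t.+1)).
  by move=> hk; rewrite mulr_gt0 ?expR_gt0 ?om0.
set Z := \sum_(1 <= k < N.+1) om k t.+1 * expR (- gamma * dotp (g t.+1) (yb k t.+1 - y t.+1)).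
have Z0 : 0 < Z.
  rewrite /Z big_nat_recl// ltr_pwDl ?Zterm//.
  by rewrite big_nat; apply: sumr_ge0 => k /andP[k0 kN]; rewrite ltW// Zterm.
split=> [k hk|]; first by rewrite (run_weight run)// divr_gt0// Zterm.
transitivity (Z / Z); last by rewrite mulfV// lt0r_neq0.
rewrite {1}/Z mulr_suml big_nat [RHS]big_nat.
by apply: eq_bigr => k hk; rewrite (run_weight run).
Qed.

Lemma run_average_in t : (1 <= t <= T)%N -> X (y t).
Proof.
move=> ht; have ht' : (1 <= t <= T.+1)%N by case/andP: ht => -> /= /leqW.
have [om0 om1] := run_weight_props ht'.
rewrite (run_average run)//; apply: shrunk_simplex_sum => // k;
  rewrite mem_index_iota ltnS => hk; first by rewrite ltW// om0.
exact: run_iterate_in.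
Qed.

(** Follows the log-weight of learner [k]: it decreases by [gamma phi] and by the log-normaliser,
    and it can never exceed 0. The quadratic exponential bound keeps each log-normaliser below
    [8 gamma^2 M^2]. *)
Lemma meta_regret (M : nat -> R) k : 0 < gamma -> (1 <= k <= N)%N ->
  (forall t j, (1 <= t <= T)%N -> `|g t 0 j| <= M t) ->
  \sum_(1 <= t < T.+1) dotp (g t) (y t - yb k t) <=
  - ln (om k 1%N) / gamma + 8 * gamma * \sum_(1 <= t < T.+1) M t ^+ 2.
Proof.
move=> gamma0 hk gM.
pose phi t k := dotp (g t) (yb k t - y t).
have up : forall S, (S <= T)%N ->
    ln (om k 1%N) - gamma * \sum_(1 <= t < S.+1) phi t k -
      8 * gamma ^+ 2 * \sum_(1 <= t < S.+1) M t ^+ 2 <= ln (om k S.+1).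
  elim=> [|S IH] ST; first by rewrite !big_geq// !mulr0 !subr0.
  have ht : (1 <= S.+1 <= T)%N by [].
  have ht' : (1 <= S.+1 <= T.+1)%N by rewrite /= ltnW.
  have [om0 om1] := run_weight_props ht'.
  rewrite !(big_nat_recr S.+1)//= (run_weight run ht hk).
  set Z := \sum_(1 <= j < N.+1) _.
  have phiM j : (1 <= j <= N)%N -> `|phi S.+1 j| <= M S.+1 * 2.
    move=> hj; apply: (le_trans (dotp_le _ (fun i => gM _ i ht))).
    have M0 : 0 <= M S.+1.
      have i0 : 'I_d by exact: Ordinal d0.
      by apply: le_trans (gM S.+1 i0 ht).
    apply: ler_wpM2l => //; apply: (le_trans (l1normB _ _)).
    rewrite !simplex_l1norm//; apply: (shrunk_simplexW d0 alpha01).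
      exact: run_average_in.
    exact: run_iterate_in.
  (* The played point is the weighted mean of the base iterates, so the linear losses centred at it
     average to zero. *)
  have phi0 : \sum_(1 <= j < N.+1) om j S.+1 * phi S.+1 j = 0.
    transitivity (dotp (g S.+1) (\sum_(1 <= j < N.+1) om j S.+1 *: yb j S.+1) -
       (\sum_(1 <= j < N.+1) om j S.+1) * dotp (g S.+1) (y S.+1)).
      rewrite mulr_suml /dotp.
      under [X in X - _]eq_bigr do rewrite summxE mulr_sumr.
      rewrite exchange_big/= -sumrB; apply: eq_bigr => j _.
      rewrite /phi dotpBr mulrBr; congr (_ - _); rewrite /dotp mulr_sumr.
      by apply: eq_bigr => i _; rewrite mxE; ring.
    by rewrite om1 mul1r -(run_average run)// subrr.
  (* The linear terms cancel by [phi0]. The constant 8 is [2 * 2^2], since points of the simplex are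
     at l1-distance at most 2 and thus [|phi| <= 2 M]. *)
  have ZM : Z <= expR (8 * gamma ^+ 2 * M S.+1 ^+ 2).
    apply: (@le_trans _ _ (\sum_(1 <= j < N.+1)
        om j S.+1 * (- gamma * phi S.+1 j + expR (8 * gamma ^+ 2 * M S.+1 ^+ 2)))).
      rewrite /Z big_nat [leRHS]big_nat; apply: ler_sum => j; rewrite ltnS => hj.
      apply: ler_wpM2l; first by rewrite ltW// om0.
      apply: (le_trans (expR_le_quad _)); rewrite lerD2l ler_expR.
      rewrite -/(phi S.+1 j).
      have h4 : phi S.+1 j ^+ 2 <= 4 * M S.+1 ^+ 2.
        rewrite -(real_normK (num_real (phi _ _))).
        have := phiM j hj; have := normr_ge0 (phi S.+1 j); nra.
      by have := ler_wpM2l (sqr_ge0 gamma) h4; lra.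
    under eq_bigr do rewrite mulrDr.
    rewrite big_split/= -mulr_suml om1 mul1r.
    rewrite (eq_bigr (fun j => - gamma * (om j S.+1 * phi S.+1 j))); last first.
      by move=> j _; ring.
    by rewrite -mulr_sumr phi0 mulr0 add0r.
  have Z0 : 0 < Z.
    rewrite /Z big_nat_recl// ltr_pwDl//.
      by rewrite mulr_gt0 ?expR_gt0 ?om0.
    rewrite big_nat; apply: sumr_ge0 => j /andP[j0 jN].
    by rewrite mulr_ge0 ?expR_ge0// ltW// om0.
  have lnZ : ln Z <= 8 * gamma ^+ 2 * M S.+1 ^+ 2.
    by rewrite -[leRHS]expRK ler_ln ?posrE ?expR_gt0.
  rewrite ln_div ?posrE ?mulr_gt0 ?expR_gt0 ?om0// lnM ?posrE ?expR_gt0 ?om0// expRK.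
  have := IH (ltnW ST); rewrite -/(phi S.+1 k); lra.
have hT : (1 <= T.+1 <= T.+1)%N by rewrite /= leqnn.
have [omT sumT] := run_weight_props hT.
have omT1 : ln (om k T.+1) <= 0.
  apply: ln_le0; rewrite -sumT (big_rem k)/=; last by rewrite mem_index_iota ltnS.
  rewrite lerDl big_seq; apply: sumr_ge0 => j /mem_rem.
  by rewrite mem_index_iota ltnS => hj; rewrite ltW// omT.
have := le_trans (up T (leqnn T)) omT1.
have -> : \sum_(1 <= t < T.+1) dotp (g t) (y t - yb k t) =
    - \sum_(1 <= t < T.+1) phi t k.
  rewrite -sumrN; apply: eq_bigr => t _; rewrite /phi !dotpBr opprB//.
set P := \sum_(1 <= t < T.+1) phi t k; set Q := \sum_(1 <= t < T.+1) M t ^+ 2 => h.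
have g0 : gamma != 0 by rewrite gt_eqF.
have : gamma * - P <= gamma * (- ln (om k 1%N) / gamma + 8 * gamma * Q).
  rewrite mulrDr [gamma * (_ / _)]mulrC mulfVK//; lra.
by rewrite ler_pM2l.
Qed.

Lemma run_regret (M : nat -> R) (u : nat -> 'rV[R]_d) k : (1 <= T)%N ->
  0 < gamma -> 0 < eta k -> (1 <= k <= N)%N ->
  (forall t j, (1 <= t <= T)%N -> `|g t 0 j| <= M t) ->
  (forall t, (1 <= t <= T)%N -> X (u t)) ->
  \sum_(1 <= t < T.+1) dotp (g t) (y t - u t) <=
  - ln (om k 1%N) / gamma +
  (eta k)^-1 * (ln d%:R + Lam * \sum_(1 <= t < T) l1norm (u t.+1 - u t)) +
  (8 * gamma + eta k) * \sum_(1 <= t < T.+1) M t ^+ 2.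
Proof.
move=> T1 gamma0 eta0 hk gM Xu.
have h1 := meta_regret gamma0 hk gM.
have h2 := base_regret eta0 T1 (run_init_iterate run hk)
  (fun t ht => run_iterate run ht hk) Xu gM.
have -> : \sum_(1 <= t < T.+1) dotp (g t) (y t - u t) =
    \sum_(1 <= t < T.+1) dotp (g t) (y t - yb k t) +
    \sum_(1 <= t < T.+1) dotp (g t) (yb k t - u t).
  by rewrite -big_split/=; apply: eq_bigr => t _; rewrite !dotpBr addrA subrK.
rewrite mulrDl; lra.
Qed.

End regret.

(** * Measurability and conditional expectations *)

Section caratheodory.
Context {R : realType} {d : nat} {dX : measure_display} (X : measurableType dX).
Local Notation V := (borel_rV R d).
Variable f : X -> 'rV[R]_d -> R.
Hypothesis mf : forall x, measurable_fun setT (f ^~ x).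
Hypothesis cf : forall w, continuous (f w).

Definition grid_round (k : nat) (x : 'rV[R]_d) : 'rV[R]_d :=
  \row_j ((Num.floor (k.+1%:R * x 0 j))%:~R / k.+1%:R).

Lemma grid_round_cvg (x : 'rV[R]_d) : grid_round k x @[k --> \oo] --> x.
Proof.
apply/cvg_ballP => e e0.
have := near_infty_natSinv_lt (PosNum e0); apply: filterS => k /= ke.
split=> // i j; rewrite ord1 /ball/= mxE.
apply: le_lt_trans ke; have k0 : 0 < k.+1%:R :> R by rewrite ltr0n.
have := floor_itv (k.+1%:R * x 0 j).
set m := (Num.floor _)%:~R => /andP[h1].
rewrite intrD -/m => h2.
have -> : x 0 j - m / k.+1%:R = (k.+1%:R * x 0 j - m) / k.+1%:R.
  by field; rewrite gt_eqF.
rewrite normrM ger0_norm ?subr_ge0// gtr0_norm ?invr_gt0//.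
rewrite -[leRHS]mul1r; apply: ler_wpM2r; first by rewrite invr_ge0 ltW.
by rewrite lerBlDl ltW.
Qed.

(** The rounded argument takes countably many values, so preimages are countable unions of
    measurable rectangles. *)
Lemma measurable_grid_round k :
  measurable_fun setT (fun p : X * V => f p.1 (grid_round k p.2)).
Proof.
move=> _ B mB; rewrite setTI.
pose q (m : 'rV[int]_d) : 'rV[R]_d := \row_j ((m 0 j)%:~R / k.+1%:R).
have -> : (fun p : X * V => f p.1 (grid_round k p.2)) @^-1` B =
    \bigcup_(m in [set: 'rV[int]_d]) ((f ^~ (q m) @^-1` B) `*`
      \bigcap_(j in [set: 'I_d])
       [set x : V | (m 0 j)%:~R <= k.+1%:R * (x : 'rV[R]_d) 0 j < (m 0 j + 1)%:~R]).
  apply/seteqP; split=> [[w x]/= Bwx|[w x]/= [m _ [/= Bw h]]].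
    exists (\row_j Num.floor (k.+1%:R * x 0 j)) => //; split => /=.
      congr (B (f w _)) : Bwx; apply/rowP => j; by rewrite !mxE.
    by move=> j _ /=; rewrite mxE floor_itv.
  congr (B (f w _)) : Bw; apply/rowP => j; rewrite !mxE.
  by have /floor_def-> := h j I.
apply: countable_bigcupT_measurable; first exact: countableP.
move=> m; apply: measurableX.
  by rewrite -[X in measurable X]setTI; exact: mf.
apply: fin_bigcap_measurable; first exact: finite_finset.
move=> j _.
have mlt : measurable_fun setT (fun x : V =>
    (m 0 j)%:~R <= k.+1%:R * (x : 'rV[R]_d) 0 j < (m 0 j + 1)%:~R).
  apply: measurable_and.
    apply: measurable_fun_ler => //; apply: measurable_funM => //.
    exact: measurable_coord.
  apply: measurable_fun_ltr => //; apply: measurable_funM => //.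
  exact: measurable_coord.
by have := mlt measurableT [set true]; rewrite setTI; exact.
Qed.

(** A pointwise limit of the grid approximations, by continuity in the vector argument. It allows a
    random loss to be evaluated at a random point. *)
Lemma caratheodory : measurable_fun setT (fun p : X * V => f p.1 p.2).
Proof.
apply: (@measurable_fun_cvg _ _ _ _ (fun k (p : X * V) => f p.1 (grid_round k p.2))).
  exact: measurable_grid_round.
have cvg (w : X) (x : 'rV[R]_d) : f w (grid_round k x) @[k --> \oo] --> f w x.
  by apply: cvg_comp; [exact: grid_round_cvg|exact: cf].
by move=> [w x] _; exact: cvg.
Qed.

Lemma caratheodory_comp (h : X -> V) : measurable_fun setT h ->
  measurable_fun setT (fun w => f w (h w)).
Proof.
move=> mh; apply: (measurableT_comp caratheodory (_ : measurable_fun setT (fun w => (w, h w)))).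
exact: measurable_fun_pair.
Qed.

End caratheodory.

(** * Independence of a draw from the past *)

Section past_independence.
Context {disp : measure_display} {Omega : measurableType disp} {R : realType}.
Context {d : nat}.
Variables (P : probability Omega R) (T : nat).
Variable s : nat -> Omega -> 'rV[R]_d.
Hypothesis us : uniform_draws P T s.
Local Notation V := (borel_rV R d).

Definition past_gen (t : nat) : set (set Omega) :=
  [set E | exists i A, [/\ (1 <= i < t)%N, borel A & E = s i @^-1` A]].
(** The same sample space under the coarser sigma-algebra: depending only on earlier draws becomes
    ordinary measurability out of this type. *)
Definition past_type (t : nat) := g_sigma_algebraType (past_gen t).

Lemma measurable_draw t : (1 <= t <= T)%N -> measurable_fun setT (s t : Omega -> V).
Proof. by move=> ht _ B mB; rewrite setTI; exact: (draws_measurable us). Qed.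

Lemma past_measurable t : (t <= T.+1)%N -> past s t `<=` measurable.
Proof.
move=> tT; apply: smallest_sub; first exact: sigma_algebra_measurable.
move=> _ [i [A [/andP[i1 it] bA ->]]]; apply: (draws_measurable us) => //.
by rewrite i1 -ltnS (leq_trans it).
Qed.

Lemma past_mono t t' : (t <= t')%N -> past s t `<=` past s t'.
Proof.
move=> tt'; apply: sub_sigma_algebra2 => _ [i [A [/andP[i1 it] bA ->]]].
by exists i, A; rewrite i1 (leq_trans it tt').
Qed.

(** Joint events of the earlier draws form a generating family closed under intersection, as
    uniqueness of measures requires. *)
Definition past_cylinder (t : nat) : set (set Omega) :=
  [set E | exists2 A : nat -> set 'rV[R]_d, forall i, borel (A i) &
     E = \bigcap_(i in [set i | (1 <= i < t)%N]) s i @^-1` A i].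

Lemma borelT : borel (setT : set 'rV[R]_d).
Proof. exact: (@measurableT _ V). Qed.

Lemma past_cylinder_measurable t : (t <= T.+1)%N -> past_cylinder t `<=` measurable.
Proof.
move=> tT _ [A bA ->]; apply: bigcap_measurableType => i /andP[i1 it].
by apply: (draws_measurable us) => //; rewrite i1 -ltnS (leq_trans it).
Qed.

Lemma past_cylinder_setI t : setI_closed (past_cylinder t).
Proof.
move=> _ _ [A bA ->] [B bB ->]; exists (fun i => A i `&` B i).
  by move=> i; exact: (@measurableI _ V _ _ (bA i) (bB i)).
by rewrite -bigcapI; apply: eq_bigcapr => i _; rewrite preimage_setI.
Qed.

Lemma past_sub_cylinder t : past s t `<=` <<s past_cylinder t >>.
Proof.
apply: sub_sigma_algebra2 => _ [i [A [it bA ->]]].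
exists (fun k => if k == i then A else setT).
  by move=> k; case: ifPn => // _; exact: borelT.
apply/seteqP; split=> w Aw; last by have := Aw i it; rewrite /= eqxx.
by move=> k _ /=; case: eqP => [->|].
Qed.

Lemma past_cylinderT t : past_cylinder t setT.
Proof.
exists (fun=> setT); first by move=> i; exact: borelT.
by apply/seteqP; split=> // w _ i _.
Qed.

(** The product rule is applied twice, with [B] and with the whole space in position [t] and the
    whole space at all later times; the two products share every other factor. *)
Lemma draw_indep_cylinder t (E : set Omega) (B : set 'rV[R]_d) :
  (1 <= t <= T)%N -> past_cylinder t E -> borel B ->
  P (E `&` s t @^-1` B) = (P E * P (s t @^-1` B))%E.
Proof.
move=> ht cE bB; have tT : (t <= T.+1)%N by case/andP: ht => _ /leqW.
have mE := past_cylinder_measurable tT cE.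
case: cE mE => A bA -> mE.
have mB : measurable (s t @^-1` B) by exact: (draws_measurable us).
pose A' (C : set 'rV[R]_d) i := if (i < t)%N then A i else if i == t then C else setT.
have bA' C : borel C -> forall i, borel (A' C i).
  by move=> bC i; rewrite /A'; case: ifPn => // _; case: ifPn => // _; exact: borelT.
have capE C : \bigcap_(i in [set i | (1 <= i <= T)%N]) s i @^-1` A' C i =
    (\bigcap_(i in [set i | (1 <= i < t)%N]) s i @^-1` A i) `&` s t @^-1` C.
  apply/seteqP; split=> w.
    move=> h; split=> [i /= /andP[i1 it]|].
      have := h i; rewrite /= i1 /A' it; apply.
      by case/andP: ht => _; apply: leq_trans; exact: ltnW.
    by have := h t ht; rewrite /A' /= ltnn eqxx.
  move=> [h1 h2] i /= /andP[i1 iT]; rewrite /A'.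
  by case: ltnP => it; [apply: h1; rewrite /= i1|case: eqP => [->|]].
have prodE C : borel C -> fine (P ((\bigcap_(i in [set i | (1 <= i < t)%N]) s i @^-1` A i)
      `&` s t @^-1` C)) =
    fine (P (s t @^-1` C)) *
    \prod_(i <- rem t (index_iota 1 T.+1)) fine (P (s i @^-1` A' setT i)).
  move=> bC; rewrite -capE (draws_independent us (bA' C bC)).
  rewrite (big_rem t)/=; last by rewrite mem_index_iota ltnS.
  congr (_ * _); first by rewrite /A' ltnn eqxx.
  rewrite big_seq [RHS]big_seq; apply: eq_bigr => i.
  rewrite mem_rem_uniq ?iota_uniq// inE => /andP[it _].
  by rewrite /A' (negbTE it).
have := prodE setT borelT; rewrite preimage_setT setIT probability_setT mul1r => pE.
have pf (C : set Omega) : measurable C -> P C \is a fin_num by move=> mC; exact: fin_num_measure.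
rewrite -(fineK (pf _ (measurableI _ _ mE mB))) prodE// -pE.
by rewrite mulrC EFinM (fineK (pf _ mE)) (fineK (pf _ mB)).
Qed.

(** For fixed [B] both sides are finite measures in [E] that agree on cylinders, hence on the
    sigma-algebra generated by them. *)
Lemma draw_indep t (E : set Omega) (B : set 'rV[R]_d) :
  (1 <= t <= T)%N -> past s t E -> borel B ->
  P (E `&` s t @^-1` B) = (P E * P (s t @^-1` B))%E.
Proof.
move=> ht pE bB; have tT : (t <= T.+1)%N by case/andP: ht => _ /leqW.
have mB : measurable (s t @^-1` B) by exact: (draws_measurable us).
pose c := fine (P (s t @^-1` B)).
have c0 : 0 <= c by rewrite fine_ge0.
have cE : P (s t @^-1` B) = c%:E by rewrite fineK// fin_num_measure.
have cov : \bigcup_(k in [set: nat]) (setT : set Omega) = setT.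
  by apply: bigcup_const; exists 0%N.
have := @g_sigma_algebra_measure_unique _ R Omega (past_cylinder t)
  (past_cylinder_measurable tT) (fun=> setT) (fun=> past_cylinderT t)
  cov (mrestr P mB) (mscale (NngNum c0) P).
move=> /(_ (@past_cylinder_setI t)) h.
have hE : mrestr P mB E = mscale (NngNum c0) P E.
  apply: h (past_sub_cylinder pE) => [A cA|_].
    transitivity (P (A `&` s t @^-1` B)); first by [].
    by rewrite draw_indep_cylinder// cE muleC.
  apply: (@le_lt_trans _ _ (P (s t @^-1` B))); last by rewrite cE ltry.
  by rewrite /mrestr; apply: le_measure; rewrite ?inE//; exact: measurableI.
transitivity (mrestr P mB E); first by [].
by rewrite hE cE muleC.
Qed.

End past_independence.

Section conditional_integral.
Context {disp : measure_display} {Omega : measurableType disp} {R : realType}.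
Context {d : nat}.
Variables (P : probability Omega R) (T : nat).
Variable s : nat -> Omega -> 'rV[R]_d.
Hypothesis us : uniform_draws P T s.
Variable t : nat.
Hypothesis ht : (1 <= t <= T)%N.
Local Notation V := (borel_rV R d).
Local Notation O' := (past_type s t).

Let st_mixin := isMeasurableFun.Build _ _ _ _ _ (measurable_draw us ht).
Definition draw_mfun : {mfun Omega >-> V} := HB.pack (s t : Omega -> V) st_mixin.

Definition draw_law : probability V R := distribution P draw_mfun.

Lemma draw_lawE (A : set V) : measurable A -> draw_law A = (l1_sphere_uniform A)%:E.
Proof. by move=> mA; exact: (draws_uniform us ht mA). Qed.

Lemma measurable_to_past : measurable_fun setT (id : Omega -> O').
Proof.
move=> _ B mB; rewrite setTI; apply: (past_measurable us _ mB).
by case/andP: ht => _ /leqW.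
Qed.

Let id_mixin := isMeasurableFun.Build _ _ _ _ _ measurable_to_past.
Let id_mfun : {mfun Omega >-> O'} := HB.pack (id : Omega -> O') id_mixin.
Let past_law : probability O' R := distribution P id_mfun.

Lemma measurable_past_draw :
  measurable_fun setT ((fun w => (w, s t w)) : Omega -> (O' * V)%type).
Proof.
by apply: measurable_fun_pair; [exact: measurable_to_past|exact: (measurable_draw us ht)].
Qed.

Let pair_mixin := isMeasurableFun.Build _ _ _ _ _ measurable_past_draw.
Let pair_mfun : {mfun Omega >-> (O' * V)%type} :=
  HB.pack ((fun w => (w, s t w)) : Omega -> (O' * V)%type) pair_mixin.
Let pair_law : probability (O' * V)%type R := distribution P pair_mfun.

(** Independence on rectangles identifies the joint law of the past and the current draw as a
    product measure. *)
Let pair_lawE (X : set (O' * V)) : measurable X ->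
  (past_law \x draw_law)%E X = pair_law X.
Proof.
apply: product_measure_unique => A B mA mB.
exact: (draw_indep us ht mA mB).
Qed.

Lemma bounded_integrable d' (T' : measurableType d') (mu : probability T' R)
    (h : T' -> R) (C : R) : measurable_fun setT h -> (forall x, `|h x| <= C) ->
  mu.-integrable setT (EFin \o h).
Proof.
move=> mh hC; apply: measurable_bounded_integrable => //.
  by apply: (le_lt_trans (probability_le1 mu measurableT)); exact: ltry.
exists C; split; first exact: num_real.
by move=> M CM x _; apply: (le_trans (hC x)); exact: ltW.
Qed.

(** The freezing property: conditioning on the past means integrating over the current draw with the
    past held fixed, here as Fubini for the product law. *)
Lemma integral_past_draw (H : O' * V -> R) (C : R) : measurable_fun setT H ->
  (forall p, `|H p| <= C) ->
  P.-integrable setT (fun w => \int[draw_law]_z (H (w, z))%:E)%E /\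
  (\int[P]_w (H (w, s t w))%:E = \int[P]_w \int[draw_law]_z (H (w, z))%:E)%E.
Proof.
move=> mH HC.
have mHE : measurable_fun setT (EFin \o H) by exact/measurable_EFinP.
have iprod : (past_law \x draw_law)%E.-integrable setT (EFin \o H).
  have ipair := bounded_integrable pair_law mH HC.
  case/integrableP: ipair => _ ipair; apply/integrableP; split => //.
  by rewrite (eq_measure_integral pair_law)// => A mA _; exact: pair_lawE.
have mF := measurable_fubini_F iprod.
have iF : P.-integrable setT (fun w => \int[draw_law]_z (H (w, z))%:E)%E.
  apply/integrableP; split; first exact: (measurableT_comp mF measurable_to_past).
  case/integrableP: (integrable_fubini_F iprod) => _.
  rewrite (@ge0_integral_distribution _ _ _ _ _ P id_mfun)//.
  exact: measurableT_comp.
split=> //.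
transitivity (\int[pair_law]_p (H p)%:E)%E.
  have mHp : measurable_fun setT (H \o pair_mfun).
    exact: (measurableT_comp mH measurable_past_draw).
  have HpC x : `|(H \o pair_mfun) x| <= C by exact: HC.
  have ip := bounded_integrable P mHp HpC.
  by rewrite (@integral_distribution _ _ _ _ _ P pair_mfun (EFin \o H)).
transitivity (\int[(past_law \x draw_law)%E]_p (H p)%:E)%E.
  by apply/esym/eq_measure_integral => A mA _; exact: pair_lawE.
rewrite -(integral12_prod_meas1 iprod).
by rewrite (@integral_distribution _ _ _ _ _ P id_mfun).
Qed.

End conditional_integral.

Section lipschitz_measurability.
Context {R : realType} {d : nat}.
Local Notation V := (borel_rV R d).

Lemma l1_lipschitz_continuous (f : 'rV[R]_d -> R) :
  (forall x y, `|f x - f y| <= l1norm (x - y)) -> continuous f.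
Proof.
move=> fL x A /nbhs_ballP[e /= e0 eA].
have d0 : 0 < d%:R + 1 :> R by rewrite ltr_wpDl.
have del0 : 0 < e / (d%:R + 1) by rewrite divr_gt0.
apply/nbhs_ballP; exists (e / (d%:R + 1)) => //= y [_ xy].
apply: eA; rewrite /ball/=; apply: (le_lt_trans (fL x y)).
have h : l1norm (x - y) <= d%:R * (e / (d%:R + 1)).
  by apply: l1norm_le_coord => j; rewrite !mxE ltW//; exact: (xy 0 j).
apply: (le_lt_trans h); rewrite mulrA ltr_pdivrMr// mulrC ltr_pM2l//.
by rewrite ltrDl.
Qed.

(* McShane: a function that is Lipschitz in [theta] extends to a Lipschitz, hence
   continuous, function of [theta]. *)
Lemma lipschitz_comp_measurable dX (X : measurableType dX) (h : X -> R)
    (theta : X -> 'rV[R]_d) :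
  measurable_fun setT (theta : X -> V) ->
  (forall w w', `|h w - h w'| <= l1norm (theta w - theta w')) ->
  measurable_fun setT h.
Proof.
move=> mth hL.
pose E x := [set h w + l1norm (x - theta w) | w in [set: X]].
pose H x := inf (E x).
have E0 x : E x !=set0 by exists (h point + l1norm (x - theta point)), point.
have tri (x y z : 'rV[R]_d) : l1norm (x - z) <= l1norm (x - y) + l1norm (y - z).
  by rewrite (_ : x - z = (x - y) + (y - z)) ?l1normD// addrA subrK.
have sym (x y : 'rV[R]_d) : l1norm (x - y) = l1norm (y - x).
  by rewrite -opprB l1normN.
have lb x w : lbound (E x) (h w - l1norm (x - theta w)).
  move=> _ [w' _ <-]; have := hL w w'; have := tri (theta w) x (theta w').
  by rewrite (sym (theta w) x) ler_norml => h1 /andP[h2 h3]; lra.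
have hlb x : has_lbound (E x) by exists (h point - l1norm (x - theta point)); exact: lb.
have HE w : h w = H (theta w).
  apply/eqP; rewrite eq_le; apply/andP; split.
    apply: lb_le_inf => //; have := lb (theta w) w.
    by rewrite subrr l1norm0 subr0.
  apply: ge_inf => //; exists w => //.
  by rewrite subrr l1norm0 addr0.
have HL1 x y : H x - l1norm (x - y) <= H y.
  apply: lb_le_inf => // _ [w _ <-].
  have : H x <= h w + l1norm (x - theta w) by apply: ge_inf => //; exists w.
  have := tri x y (theta w); lra.
have HL x y : `|H x - H y| <= l1norm (x - y).
  rewrite ler_norml; have := HL1 x y; have := HL1 y x; rewrite (sym y x) => h1 h2.
  by apply/andP; split; lra.
have -> : h = H \o theta by apply/funext => w; exact: HE.
apply: (measurableT_comp _ mth); apply: continuous_measurable_rV.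
exact: l1_lipschitz_continuous.
Qed.

End lipschitz_measurability.

Section mirror_step_lipschitz.
Context {R : realType} {d : nat} (alpha eta : R).
Hypothesis d0 : (0 < d)%N.
Hypothesis alpha01 : 0 < alpha <= 1.
Hypothesis eta0 : 0 < eta.
Local Notation X := (@shrunk_simplex R d alpha).

(** Each minimiser is tested against the other in its variational inequality; adding the two and
    using strong monotonicity of the logarithm bounds the squared Euclidean distance by the pairing
    with the difference of the parameters [ln y - eta g]. In particular these parameters determine
    the minimiser, which is how its measurability is obtained. *)
Lemma mirror_step_lipschitz g y z g' y' z' i : X y -> X y' ->
  is_argmin X (mirror_objective eta g y) z ->
  is_argmin X (mirror_objective eta g' y') z' ->
  `|z 0 i - z' 0 i| <= l1norm ((\row_j (ln (y 0 j) - eta * g 0 j)) -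
      (\row_j (ln (y' 0 j) - eta * g' 0 j))).
Proof.
move=> Xy Xy' az az'.
have v1 := mirror_step_vi d0 alpha01 eta0 Xy az az'.1.
have v2 := mirror_step_vi d0 alpha01 eta0 Xy' az' az.1.
set th := \row_j _; set th' := \row_j (ln (y' 0 j) - _).
pose a j := z 0 j - z' 0 j; pose q := \sum_j a j ^+ 2.
have q0 : 0 <= q by apply: sumr_ge0 => j _; exact: sqr_ge0.
have vi : q <= \sum_j (th - th') 0 j * a j.
  apply: (@le_trans _ _ (\sum_j (ln (z 0 j) - ln (z' 0 j)) * a j)).
    apply: ler_sum => j _; apply: lnB_mul_ge.
      by rewrite (shrunk_simplex_gt0 d0 alpha01 j az.1) (shrunk_simplex_le1 d0 alpha01 j az.1).
    by rewrite (shrunk_simplex_gt0 d0 alpha01 j az'.1) (shrunk_simplex_le1 d0 alpha01 j az'.1).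
  have h := mulr_ge0 (ltW eta0) (addr_ge0 v1 v2).
  rewrite -big_split/= mulr_sumr in h; rewrite -subr_ge0 -sumrB.
  move: h; congr (0 <= _); apply: eq_bigr => j _; rewrite !mxE /a.
  by field; rewrite gt_eqF.
pose r := Num.sqrt q; have r0 : 0 <= r by exact: sqrtr_ge0.
have rq : r ^+ 2 = q by rewrite sqr_sqrtr.
have ar j : `|a j| <= r.
  rewrite -[`|a j|]ger0_norm// -sqrtr_sqr ler_sqrt// real_normK ?num_real//.
  by rewrite /q (bigD1 j)//= lerDl sumr_ge0// => k _; exact: sqr_ge0.
have qD : q <= l1norm (th - th') * r.
  apply: (le_trans vi); rewrite mulr_suml; apply: ler_sum => j _.
  rewrite (le_trans (ler_norm _))// normrM; apply: ler_wpM2l => //.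
apply: (le_trans (ar i)).
have [->|rn0] := eqVneq r 0; first exact: l1norm_ge0.
have rp : 0 < r by rewrite lt_neqAle eq_sym rn0.
by move: qD; rewrite -rq expr2 ler_pM2r.
Qed.

End mirror_step_lipschitz.

Section run_measurability.
Context {disp : measure_display} {Omega : measurableType disp} {R : realType}.
Context {d : nat}.
Variables (P : probability Omega R) (T N : nat) (alpha mu gamma : R) (eta : nat -> R).
Hypothesis d0 : (0 < d)%N.
Hypothesis N0 : (0 < N)%N.
Hypothesis alpha01 : 0 < alpha <= 1.
Hypothesis eta0 : forall k, 0 < eta k.
Local Notation X := (@shrunk_simplex R d alpha).
Local Notation V := (borel_rV R d).
Variables (s : nat -> Omega -> 'rV[R]_d) (f : nat -> Omega -> 'rV[R]_d -> R).
Variables (xp xm y g : nat -> Omega -> 'rV[R]_d).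
Variables (yb : nat -> nat -> Omega -> 'rV[R]_d) (om : nat -> nat -> Omega -> R).
Hypothesis na : nonanticipating T s f.
Hypothesis cf : forall t w, (1 <= t <= T)%N -> cvx (f t w).
Hypothesis run : forall w, PBMD_run T mu gamma N eta neg_entropy X barycenter
    (fun t => f t w) (fun t => s t w) (fun t => xp t w) (fun t => xm t w)
    (fun t => y t w) (fun t => g t w) (fun k t => yb k t w) (fun k t => om k t w).

Local Notation O t := (past_type s t).

Lemma past_type_mono dY (Y : measurableType dY) (h : Omega -> Y) t t' : (t <= t')%N ->
  measurable_fun setT (h : O t -> Y) -> measurable_fun setT (h : O t' -> Y).
Proof.
move=> tt' mh _ B mB; rewrite setTI; apply: (past_mono tt').
by have := mh measurableT B mB; rewrite setTI.
Qed.

Lemma measurable_draw_past i t : (1 <= i < t)%N -> measurable_fun setT (s i : O t -> V).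
Proof.
by move=> it _ B mB; rewrite setTI; apply: sub_sigma_algebra; exists i, B.
Qed.

Lemma measurable_loss t (h : O t -> V) : (1 <= t <= T)%N -> measurable_fun setT h ->
  measurable_fun setT (fun w : O t => f t w (h w)).
Proof.
move=> ht mh; apply: (@caratheodory_comp _ _ _ (O t) (f t)) => //.
- by move=> x _ B mB; rewrite setTI; exact: (na ht x mB).
- by move=> w; apply: cvx_continuous; exact: cf.
Qed.

Lemma measurable_loss_next t (h : O t.+1 -> V) : (1 <= t <= T)%N ->
  measurable_fun setT h ->
  measurable_fun setT (fun w : O t.+1 => f t w (h w)).
Proof.
move=> ht mh; apply: (@caratheodory_comp _ _ _ (O t.+1) (f t)) => //.
- move=> x; apply: (past_type_mono (leqnSn t)) => _ B mB; rewrite setTI.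
  exact: (na ht x mB).
- by move=> w; apply: cvx_continuous; exact: cf.
Qed.

Lemma measurable_rVD dX (Z : measurableType dX) (a b : Z -> V) :
  measurable_fun setT a -> measurable_fun setT b ->
  measurable_fun setT ((fun w => (a w : 'rV[R]_d) + b w) : Z -> V).
Proof.
move=> ma mb; apply: measurable_rV => j.
under eq_fun do rewrite mxE.
by apply: measurable_funD; exact: measurable_coord_comp.
Qed.

Lemma measurable_rVZ dX (Z : measurableType dX) (c : R) (a : Z -> V) :
  measurable_fun setT a ->
  measurable_fun setT ((fun w => c *: (a w : 'rV[R]_d)) : Z -> V).
Proof.
move=> ma; apply: measurable_rV => j.
under eq_fun do rewrite mxE.
by apply: measurable_funM => //; exact: measurable_coord_comp.
Qed.

Lemma measurable_sign1 dX (Z : measurableType dX) (a : Z -> R) :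
  measurable_fun setT a -> measurable_fun setT (fun w => sign1 (a w)).
Proof.
by move=> ma; apply: measurable_fun_ifT => //; exact: measurable_fun_ltr.
Qed.

(** The state at time [t] depends only on the draws before [t]. The induction passes to the next
    sigma-algebra, which contains the current draw as well. *)
Lemma run_measurable t : (1 <= t <= T.+1)%N -> forall k, (1 <= k <= N)%N ->
  measurable_fun setT (yb k t : O t -> V) /\ measurable_fun setT (om k t : O t -> R).
Proof.
elim: t => [//|[|t] IH] ht k hk.
  split.
    have -> : yb k 1%N = cst barycenter.
      by apply/funext => w; exact: (run_init_iterate (run w)).
    exact: measurable_cst.
  have -> : om k 1%N = cst (N.+1%:R / N%:R * (k * k.+1)%:R^-1).
    by apply/funext => w; exact: (run_init_weight (run w)).
  exact: measurable_cst.
have ht' : (1 <= t.+1 <= T)%N by [].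
have myb j : (1 <= j <= N)%N -> measurable_fun setT (yb j t.+1 : O t.+2 -> V).
  by move=> hj; apply: (past_type_mono (leqnSn _)); exact: (IH (leqW ht') j hj).1.
have mom j : (1 <= j <= N)%N -> measurable_fun setT (om j t.+1 : O t.+2 -> R).
  by move=> hj; apply: (past_type_mono (leqnSn _)); exact: (IH (leqW ht') j hj).2.
have msum (F : nat -> O t.+2 -> R) :
    (forall j, (1 <= j <= N)%N -> measurable_fun setT (F j)) ->
    measurable_fun setT (fun w => \sum_(1 <= j < N.+1) F j w).
  move=> mF; have -> : (fun w => \sum_(1 <= j < N.+1) F j w) =
      (fun w => \sum_(1 <= j < N.+1) (if (1 <= j <= N)%N then F j w else 0)).
    by apply/funext => w; apply: eq_big_nat => j; rewrite ltnS => ->.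
  apply: measurable_sum => j.
  by case: (1 <= j <= N)%N (mF j) => mFj; [exact: (mFj isT)|exact: measurable_cst].
have my : measurable_fun setT (y t.+1 : O t.+2 -> V).
  apply: measurable_rV => j.
  have -> : (fun w : O t.+2 => y t.+1 w 0 j) =
      (fun w => \sum_(1 <= k < N.+1) om k t.+1 w * yb k t.+1 w 0 j).
    apply/funext => w; rewrite (run_average (run w) ht') summxE.
    by apply: eq_bigr => i _; rewrite mxE.
  apply: msum => i hi; apply: measurable_funM; first exact: mom.
  by apply: measurable_coord_comp; exact: myb.
have ms : measurable_fun setT (s t.+1 : O t.+2 -> V).
  by apply: measurable_draw_past; rewrite /= ltnSn.
have mg j : measurable_fun setT (fun w : O t.+2 => g t.+1 w 0 j).
  have -> : (fun w : O t.+2 => g t.+1 w 0 j) =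
      (fun w => d%:R / (2 * mu) * (f t.+1 w (y t.+1 w + mu *: s t.+1 w) -
         f t.+1 w (y t.+1 w + (- mu) *: s t.+1 w)) * sign1 (s t.+1 w 0 j)).
    apply/funext => w; rewrite (run_gradient (run w) ht') !mxE.
    by rewrite (run_plus (run w) ht') (run_minus (run w) ht') scaleNr.
  apply: measurable_funM.
    apply: measurable_funM => //; apply: measurable_funB;
      by apply: measurable_loss_next => //; apply: measurable_rVD => //; exact: measurable_rVZ.
  by apply: measurable_sign1; exact: measurable_coord_comp.
have mdot i : (1 <= i <= N)%N ->
    measurable_fun setT (fun w : O t.+2 => dotp (g t.+1 w) (yb i t.+1 w - y t.+1 w)).
  move=> hi; apply: measurable_sum => j.
  apply: measurable_funM => //.
  have -> : (fun w : O t.+2 => (yb i t.+1 w - y t.+1 w) 0 j) =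
    (fun w => yb i t.+1 w 0 j - y t.+1 w 0 j) by apply/funext => w; rewrite !mxE.
  by apply: measurable_funB; apply: measurable_coord_comp => //; exact: myb.
have mterm i : (1 <= i <= N)%N -> measurable_fun setT (fun w : O t.+2 =>
    om i t.+1 w * expR (- gamma * dotp (g t.+1 w) (yb i t.+1 w - y t.+1 w))).
  move=> hi; apply: measurable_funM; first exact: mom.
  apply: (measurableT_comp (@measurable_expR R)).
  by apply: measurable_funM => //; exact: mdot.
have Xyb i w : (1 <= i <= N)%N -> X (yb i t.+1 w).
  move=> hi; have h := run_iterate_in d0 alpha01 (run w).
  exact: (h t.+1 i (leqW ht') hi).
split.
  apply: measurable_rV => i.
  pose th (w : O t.+2) : 'rV[R]_d := \row_j (ln (yb k t.+1 w 0 j) - eta k * g t.+1 w 0 j).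
  (* No formula for the minimiser is available; measurability comes from its Lipschitz dependence on
     the measurable vector [th]. *)
  apply: (@lipschitz_comp_measurable _ _ _ _ _ th).
    apply: measurable_rV => j.
    have -> : (fun w : O t.+2 => th w 0 j) =
        (fun w => ln (yb k t.+1 w 0 j) - eta k * g t.+1 w 0 j).
      by apply/funext => w; rewrite mxE.
    apply: measurable_funB; last by apply: measurable_funM.
    apply: (measurableT_comp (@measurable_ln R)).
    by apply: measurable_coord_comp; exact: myb.
  move=> w w'; have h := run_iterate (run w) ht' hk; have h' := run_iterate (run w') ht' hk.
  exact: (mirror_step_lipschitz d0 alpha01 (eta0 k) i (Xyb k w hk) (Xyb k w' hk) h h').
pose Z (w : O t.+2) := \sum_(1 <= j < N.+1)
  om j t.+1 w * expR (- gamma * dotp (g t.+1 w) (yb j t.+1 w - y t.+1 w)).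
have Z0 w : 0 < Z w.
  have ht2 : (1 <= t.+1 <= T.+1)%N := leqW ht'.
  have om0 := (run_weight_props N0 (run w) ht2).1.
  rewrite /Z big_nat_recl// ltr_pwDl//.
    by rewrite mulr_gt0 ?expR_gt0 ?om0.
  rewrite big_nat; apply: sumr_ge0 => j /andP[j0 jN].
  by rewrite mulr_ge0 ?expR_ge0// ltW// om0.
(* The normaliser is positive, so division can be written with [expR] and [ln], both measurable. *)
have -> : (om k t.+2 : O t.+2 -> R) = (fun w =>
    om k t.+1 w * expR (- gamma * dotp (g t.+1 w) (yb k t.+1 w - y t.+1 w)) *
    expR (- ln (Z w))).
  apply/funext => w; rewrite (run_weight (run w) ht' hk); congr (_ * _).
  by rewrite expRN lnK// posrE.
apply: measurable_funM; first exact: mterm.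
apply: (measurableT_comp (@measurable_expR R)); apply: measurableT_comp => //.
apply: (measurableT_comp (@measurable_ln R)).
by apply: msum => j hj; exact: mterm.
Qed.

Lemma run_average_measurable t : (1 <= t <= T)%N ->
  measurable_fun setT (y t : O t -> V).
Proof.
move=> ht; have ht' : (1 <= t <= T.+1)%N by case/andP: ht => -> /= /leqW.
apply: measurable_rV => j.
have -> : (fun w : O t => y t w 0 j) = (fun w => \sum_(1 <= k < N.+1)
    (if (1 <= k <= N)%N then om k t w * yb k t w 0 j else 0)).
  apply/funext => w; rewrite (run_average (run w) ht) summxE.
  by apply: eq_big_nat => k; rewrite ltnS => ->; rewrite mxE.
apply: measurable_sum => k.
have := run_measurable ht' (k := k); case: (1 <= k <= N)%N => [/(_ isT)[myb mom]|_].
  by apply: measurable_funM => //; exact: measurable_coord_comp.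
exact: measurable_cst.
Qed.

End run_measurability.

(** * One round in expectation *)

Section one_round.
Context {disp : measure_display} {Omega : measurableType disp} {R : realType}.
Context {n : nat}.
Local Notation d := n.+1.
Variables (P : probability Omega R) (T : nat) (alpha mu G : R).
Hypothesis n0 : (0 < n)%N.
Hypothesis alpha01 : 0 < alpha <= 1.
Hypothesis mu0 : 0 < mu.
Hypothesis G0 : 0 < G.
Local Notation X := (@shrunk_simplex R d alpha).
Local Notation V := (borel_rV R d).
Variables (U : set 'rV[R]_d) (s : nat -> Omega -> 'rV[R]_d).
Variables (f : nat -> Omega -> 'rV[R]_d -> R).
Hypothesis XU : [set x + mu *: z | x in X & z in l1_ball] `<=` U.
Hypothesis us : uniform_draws P T s.
Hypothesis na : nonanticipating T s f.
Hypothesis cf : forall t w, (1 <= t <= T)%N -> cvx (f t w).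
Hypothesis lf : forall t w, (1 <= t <= T)%N -> l1_lipschitz G U (f t w).
Variable t : nat.
Hypothesis ht : (1 <= t <= T)%N.
Local Notation O' := (past_type s t).
Variable y : Omega -> 'rV[R]_d.
Hypothesis my : measurable_fun setT (y : O' -> V).
Hypothesis Xy : forall w, X (y w).
Local Notation Q := (draw_law us ht).

Let QE := @draw_lawE _ _ _ _ _ _ _ us t ht.

Lemma shrunk_ball_in x (z : 'rV[R]_d) : X x -> l1norm z <= 1 -> U (x + mu *: z).
Proof. by move=> Xx z1; apply: XU; exists x => //; exists z. Qed.

Lemma shrunk_ball_inN x (z : 'rV[R]_d) : X x -> l1norm z <= 1 -> U (x - mu *: z).
Proof.
by move=> Xx z1; rewrite -scalerN; apply: shrunk_ball_in; rewrite ?l1normN.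
Qed.

Lemma shrunk_in x : X x -> U x.
Proof.
by move=> Xx; have := @shrunk_ball_in x 0 Xx; rewrite scaler0 addr0 l1norm0; apply.
Qed.

Definition loss_diff w (z : 'rV[R]_d) : R := f t w (y w + mu *: z) - f t w (y w - mu *: z).

Lemma loss_diff_bound w z : l1norm z = 1 -> `|loss_diff w z| <= 2 * G * mu.
Proof.
move=> z1; have z1' : l1norm z <= 1 by rewrite z1.
apply: (le_trans (lf w ht (shrunk_ball_in (Xy w) z1') (shrunk_ball_inN (Xy w) z1'))).
have -> : y w + mu *: z - (y w - mu *: z) = (2 * mu) *: z.
  by apply/rowP => j; rewrite !mxE; ring.
rewrite l1normZ z1 mulr1 gtr0_norm ?mulr_gt0//; lra.
Qed.

Lemma measurable_loss_shift (a : R) :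
  measurable_fun setT (fun p : O' * V => f t p.1 (y p.1 + a *: (p.2 : 'rV[R]_d))).
Proof.
apply: (@caratheodory_comp _ _ _ (O' * V)%type (fun p => f t p.1)).
- move=> x; have mfx : measurable_fun setT (fun w : O' => f t w x).
    by move=> _ B mB; rewrite setTI; exact: (na ht x mB).
  exact: (measurableT_comp mfx measurable_fst).
- by move=> p; apply: cvx_continuous; exact: cf.
- apply: measurable_rVD; first exact: (measurableT_comp my measurable_fst).
  exact: (measurable_rVZ a measurable_snd).
Qed.

Lemma measurable_loss_diff :
  measurable_fun setT (fun p : O' * V => loss_diff p.1 p.2).
Proof.
apply: measurable_funB; first exact: measurable_loss_shift.
have -> : (fun p : O' * V => f t p.1 (y p.1 - mu *: (p.2 : 'rV[R]_d))) =
    (fun p => f t p.1 (y p.1 + (- mu) *: (p.2 : 'rV[R]_d))).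
  by apply/funext => p; rewrite scaleNr.
exact: measurable_loss_shift.
Qed.

Lemma measurable_signv_dotp (u : 'rV[R]_d) :
  measurable_fun setT (fun p : O' * V => dotp (signv p.2) (y p.1 - u)).
Proof.
apply: measurable_sum => j; apply: measurable_funM.
  have -> : (fun p : O' * V => signv (p.2 : 'rV[R]_d) 0 j) =
      (fun p => sign1 ((p.2 : 'rV[R]_d) 0 j)) by apply/funext => p; rewrite mxE.
  by apply: measurable_sign1; apply: measurable_coord_comp.
have -> : (fun p : O' * V => (y p.1 - u) 0 j) = (fun p => y p.1 0 j - u 0 j).
  by apply/funext => p; rewrite !mxE.
apply: measurable_funB => //.
by apply: measurable_coord_comp; exact: (measurableT_comp my measurable_fst).
Qed.

Lemma measurable_l1norm_draw :
  measurable_fun setT (fun p : O' * V => l1norm (p.2 : 'rV[R]_d)).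
Proof.
apply: measurable_sum => j; apply: measurableT_comp => //.
exact: measurable_coord_comp.
Qed.

Lemma draw_ae : {ae P, forall w, l1norm (s t w) = 1}.
Proof.
have [A [mA QA sA]] := sphere_law_ae QE.
exists (s t @^-1` A); split => //; last by move=> w /= h; apply: sA.
exact: (draws_measurable us ht mA).
Qed.

Lemma past_measurable_fun (h : Omega -> R) :
  measurable_fun setT (h : O' -> R) -> measurable_fun setT h.
Proof. by move=> mh; exact: (measurableT_comp mh (measurable_to_past us ht)). Qed.

Lemma measurable_at_draw (H : O' * V -> R) : measurable_fun setT H ->
  measurable_fun setT (fun w : Omega => H (w, s t w)).
Proof. by move=> mH; exact: (measurableT_comp mH (measurable_past_draw us ht)). Qed.

(** The bias bound with the past frozen. The two queries are two convex functions of the direction,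
    [f (y + mu z)] and [f (y - mu z)]; the sphere gradient inequality for each bounds half of the
    estimator. *)
Lemma gradient_inner w (u : 'rV[R]_d) : X u ->
  ((f t w (y w) - f t w u - 2 * G * mu)%:E <=
   \int[Q]_z (if l1norm z == 1 then
      d%:R / (2 * mu) * loss_diff w z * dotp (signv z) (y w - u) else 0)%:E)%E.
Proof.
move=> Xu; pose K := f t w u - f t w (y w) + 2 * G * mu.
have near1 x z : X x -> l1norm z <= 1 -> `|f t w (x + mu *: z) - f t w x| <= G * mu.
  move=> Xx z1; apply: (le_trans (lf w ht (shrunk_ball_in Xx z1) (shrunk_in Xx))).
  rewrite addrC addKr l1normZ gtr0_norm//; apply: ler_wpM2l; first exact: ltW.
  by rewrite ler_piMr// ltW.
have fK z : l1norm z <= 1 -> f t w (u + mu *: z) - f t w (y w + mu *: z) <= K.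
  move=> z1; have := near1 u z Xu z1; have := near1 (y w) z (Xy w) z1.
  by rewrite !ler_norml /K => /andP[h1 h2] /andP[h3 h4]; lra.
(* The shift that carries [y + mu z] to [u + mu z]. Although [z + v] may leave the unit ball,
   [u + mu z] stays in [U], where the Lipschitz bound holds; the other query needs the shift
   [- v]. *)
pose v := mu^-1 *: (u - y w).
have muv : mu *: v = u - y w by rewrite scalerA mulfV ?gt_eqF// scale1r.
have K1 z : l1norm z <= 1 ->
    f t w (y w + mu *: (z + v)) - f t w (y w + mu *: z) <= K.
  move=> z1; have := fK z z1; congr (f t w _ - _ <= _).
  by rewrite scalerDr muv; apply/rowP => j; rewrite !mxE; ring.
have K2 z : l1norm z <= 1 ->
    f t w (y w + (- mu) *: (z + - v)) - f t w (y w + (- mu) *: z) <= K.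
  move=> z1; have := fK (- z); rewrite l1normN => /(_ z1).
  rewrite !scalerN -!scaleNr; congr (f t w _ - _ <= _).
  rewrite scalerDr !(scaleNr, scalerN) opprK muv; apply/rowP => j; rewrite !mxE; ring.
have [i1 I1] := sphere_law_gradient QE n0 (cvx_shift (y w) mu (cf w ht)) K1.
have [i2 I2] := sphere_law_gradient QE n0 (cvx_shift (y w) (- mu) (cf w ht)) K2.
set F1 := (fun z : V => _) in i1 I1; set F2 := (fun z : V => _) in i2 I2.
have d0 : 0 < d%:R :> R by rewrite ltr0n.
have -> : (\int[Q]_z (if l1norm z == 1 then
    d%:R / (2 * mu) * loss_diff w z * dotp (signv z) (y w - u) else 0)%:E =
    \int[Q]_z ((- (d%:R / 2))%:E * (F1 z + F2 z)))%E.
  apply: eq_integral => z _; rewrite /F1 /F2; case: ifPn => _; last first.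
    by rewrite adde0 mule0.
  rewrite -EFinD -EFinM; congr (_%:E); rewrite /loss_diff -scaleNr.
  have dN (a b : 'rV[R]_d) : dotp a (- b) = - dotp a b.
    by rewrite -sumrN; apply: eq_bigr => j _; rewrite mxE mulrN.
  have -> : y w - u = mu *: (- v) by rewrite scalerN muv opprB.
  have dZ (a b : 'rV[R]_d) : dotp a (mu *: b) = mu * dotp a b.
    by rewrite mulr_sumr; apply: eq_bigr => j _; rewrite mxE mulrCA.
  by rewrite dZ dN; field; rewrite gt_eqF.
rewrite integralZl//; last exact: integrableD.
rewrite integralD//.
have F1f := integrable_fin_num measurableT i1.
have F2f := integrable_fin_num measurableT i2.
move: I1 I2; rewrite -(fineK F1f) -(fineK F2f) -EFinD -EFinM !lee_fin => I1 I2.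
have h1 : d%:R * fine (\int[Q]_z F1 z)%E <= K by rewrite mulrC -ler_pdivlMr.
have h2 : d%:R * fine (\int[Q]_z F2 z)%E <= K by rewrite mulrC -ler_pdivlMr.
rewrite /K in h1 h2; lra.
Qed.

Lemma gradient_round (u : 'rV[R]_d) (g : Omega -> 'rV[R]_d) : X u ->
  (forall w, g w = (d%:R / (2 * mu) * loss_diff w (s t w)) *: signv (s t w)) ->
  (\int[P]_w (f t w (y w) - f t w u - 2 * G * mu)%:E <=
   \int[P]_w (dotp (g w) (y w - u))%:E)%E /\
  P.-integrable setT (fun w => (f t w (y w) - f t w u)%:E) /\
  P.-integrable setT (fun w => (dotp (g w) (y w - u))%:E).
Proof.
move=> Xu gE; have d0 : 0 < d%:R :> R by rewrite ltr0n.
(* Cutting the estimator off outside the sphere makes it bounded everywhere, since the Lipschitz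
   bound is available only for directions that keep the queries in [U]; the draw lies on the sphere
   almost surely. *)
pose H (p : O' * V) : R := if l1norm (p.2 : 'rV[R]_d) == 1 then
  d%:R / (2 * mu) * loss_diff p.1 p.2 * dotp (signv p.2) (y p.1 - u) else 0.
have mH : measurable_fun setT H.
  apply: measurable_fun_ifT => //.
    by apply: measurable_fun_eqr => //; exact: measurable_l1norm_draw.
  apply: measurable_funM; last exact: measurable_signv_dotp.
  by apply: measurable_funM => //; exact: measurable_loss_diff.
have c0 : 0 <= d%:R / (2 * mu) by rewrite divr_ge0 ?mulr_ge0 ?ltW.
have HC p : `|H p| <= 2 * d%:R * G.
  rewrite /H; case: eqP => p1; last by rewrite normr0 !mulr_ge0// ltW.
  rewrite normrM [`|_ * loss_diff _ _|]normrM (ger0_norm c0).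
  have h1 := loss_diff_bound p.1 p1.
  have h2 : `|dotp (signv p.2) (y p.1 - u)| <= 2.
    apply: (@le_trans _ _ (1 * l1norm (y p.1 - u))).
      by apply: dotp_le => j; rewrite mxE /sign1; case: ifPn; rewrite ?normrN normr1.
    rewrite mul1r (le_trans (l1normB _ _))//.
    by rewrite !simplex_l1norm//; apply: (shrunk_simplexW _ alpha01).
  apply: (@le_trans _ _ (d%:R / (2 * mu) * (2 * G * mu) * 2)).
    apply: ler_pM => //; first exact: mulr_ge0.
    exact: ler_wpM2l.
  by rewrite le_eqVlt; apply/orP; left; apply/eqP; field; rewrite gt_eqF.
have [iI IE] := integral_past_draw us ht mH HC.
have mHs := measurable_at_draw mH.
have Hae : ae_eq P setT (fun w => (dotp (g w) (y w - u))%:E) (fun w => (H (w, s t w))%:E).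
  have := draw_ae; apply: filterS => w sw _.
  by rewrite /H/= sw eqxx gE dotpZl.
have mg : measurable_fun setT (fun w => dotp (g w) (y w - u)).
  have -> : (fun w => dotp (g w) (y w - u)) = (fun w =>
      (fun p : O' * V => d%:R / (2 * mu) * loss_diff p.1 p.2 *
        dotp (signv p.2) (y p.1 - u)) (w, s t w)).
    by apply/funext => w; rewrite gE dotpZl.
  have mp : measurable_fun setT (fun p : O' * V => d%:R / (2 * mu) * loss_diff p.1 p.2 *
      dotp (signv p.2) (y p.1 - u)).
    apply: measurable_funM; last exact: measurable_signv_dotp.
    by apply: measurable_funM => //; exact: measurable_loss_diff.
  exact: (measurable_at_draw mp).
have iH : P.-integrable setT (fun w => (H (w, s t w))%:E).
  exact: (bounded_integrable P mHs (fun w => HC _)).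
have ia : P.-integrable setT (fun w => (f t w (y w) - f t w u)%:E).
  apply: (@bounded_integrable _ _ _ P (fun w => f t w (y w) - f t w u) (2 * G)).
    apply: measurable_funB; apply: past_measurable_fun.
      exact: (measurable_loss na cf ht my).
    exact: (measurable_loss na cf ht (measurable_cst (u : V))).
  move=> w; apply: (le_trans (lf w ht (shrunk_in (Xy w)) (shrunk_in Xu))).
  rewrite mulrC; apply: ler_wpM2r; first exact: ltW.
  rewrite (le_trans (l1normB _ _))//.
  by rewrite !simplex_l1norm//; apply: (shrunk_simplexW _ alpha01).
have eI : (\int[P]_w (dotp (g w) (y w - u))%:E = \int[P]_w (H (w, s t w))%:E)%E.
  by apply: ae_eq_integral => //; exact/measurable_EFinP.
split; last split=> //.
  rewrite eI IE; apply: le_integral => //.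
    have -> : (fun w => (f t w (y w) - f t w u - 2 * G * mu)%:E) =
      (fun w => ((f t w (y w) - f t w u)%:E - (2 * G * mu)%:E))%E.
      by apply/funext => w; rewrite EFinB.
    apply: integrableB => //.
    by apply: (@bounded_integrable _ _ _ P (fun _ => 2 * G * mu) `|2 * G * mu|).
  by move=> w _; exact: gradient_inner.
apply/integrableP; split; first exact/measurable_EFinP.
have [_] := integrableP _ _ _ iH.
rewrite (@ae_eq_integral _ _ _ P setT (fun w => `|(dotp (g w) (y w - u))%:E|)
   (fun w => `|(H (w, s t w))%:E|))%E//.
- by apply: measurableT_comp => //; exact/measurable_EFinP.
- by apply: measurableT_comp => //; exact/measurable_EFinP.
- by move: Hae; apply: filterS => w h Dw; rewrite h.
Qed.

(** All coordinates of the gradient estimate share the absolute value of this scalar, so its square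
    is the squared maximum norm. The variance bound with [L = 2 G mu] gives [2 d G^2] times
    [d / (d + 1)]. *)
Lemma second_moment_round :
  (\int[P]_w ((d%:R / (2 * mu) * loss_diff w (s t w)) ^+ 2)%:E <=
     (2 * d%:R * G ^+ 2)%:E)%E /\
  P.-integrable setT (fun w => ((d%:R / (2 * mu) * loss_diff w (s t w)) ^+ 2)%:E).
Proof.
have d0 : 0 < d%:R :> R by rewrite ltr0n.
pose H (p : O' * V) : R := if l1norm (p.2 : 'rV[R]_d) == 1 then
  (d%:R / (2 * mu) * loss_diff p.1 p.2) ^+ 2 else 0.
have mD : measurable_fun setT (fun p : O' * V => d%:R / (2 * mu) * loss_diff p.1 p.2).
  by apply: measurable_funM => //; exact: measurable_loss_diff.
have mH : measurable_fun setT H.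
  apply: measurable_fun_ifT => //.
    by apply: measurable_fun_eqr => //; exact: measurable_l1norm_draw.
  exact: (measurable_funX 2 mD).
have c0 : 0 <= d%:R / (2 * mu) by rewrite divr_ge0 ?mulr_ge0 ?ltW.
have H0 p : 0 <= H p by rewrite /H; case: ifPn => // _; exact: sqr_ge0.
have HC p : `|H p| <= (d%:R * G) ^+ 2.
  rewrite ger0_norm// /H; case: eqP => p1; last exact: sqr_ge0.
  rewrite -real_normK ?num_real// lerXn2r ?nnegrE//.
    by rewrite mulr_ge0// ltW.
  rewrite normrM (ger0_norm c0).
  apply: (@le_trans _ _ (d%:R / (2 * mu) * (2 * G * mu))).
    by rewrite ler_wpM2l// loss_diff_bound.
  by rewrite le_eqVlt; apply/orP; left; apply/eqP; field; rewrite gt_eqF.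
have [iI IE] := integral_past_draw us ht mH HC.
have mHs := measurable_at_draw mH.
have mDs := measurable_at_draw (measurable_funX 2 mD).
have Hae : ae_eq P setT (fun w => ((d%:R / (2 * mu) * loss_diff w (s t w)) ^+ 2)%:E)
    (fun w => (H (w, s t w))%:E).
  by have := draw_ae; apply: filterS => w sw _; rewrite /H/= sw eqxx.
have iH : P.-integrable setT (fun w => (H (w, s t w))%:E).
  exact: (bounded_integrable P mHs (fun w => HC _)).
have eI : (\int[P]_w ((d%:R / (2 * mu) * loss_diff w (s t w)) ^+ 2)%:E =
    \int[P]_w (H (w, s t w))%:E)%E.
  by apply: ae_eq_integral => //; exact/measurable_EFinP.
have inner w : (\int[Q]_z (H (w, z))%:E <= (2 * d%:R * G ^+ 2)%:E)%E.
  have mLw : measurable_fun setT (fun z : V => loss_diff w z).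
    apply: (measurableT_comp measurable_loss_diff (_ : measurable_fun setT (fun z : V => (w : O', z)))).
    exact: measurable_fun_pair.
  have L0 : 0 <= 2 * G * mu by rewrite !mulr_ge0 ?ltW.
  have LN v : loss_diff w (- v) = - loss_diff w v.
    by rewrite /loss_diff scalerN opprK opprB.
  (* Flipping one coordinate moves each of the two queries by [2 mu |v_j|] in l1-norm. *)
  have Lf j v : l1norm v = 1 ->
      `|loss_diff w v - loss_diff w (flip_rV j v)| <= 2 * (2 * G * mu) * `|v 0 j|.
    move=> v1; have v1' : l1norm v <= 1 by rewrite v1.
    have fv1 : l1norm (flip_rV j v) <= 1 by rewrite l1norm_flip v1.
    have nf : l1norm (v - flip_rV j v) = 2 * `|v 0 j|.
      rewrite /l1norm (bigD1 j)//= big1 => [|i ij]; rewrite !mxE.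
        rewrite eqxx addr0 opprK (_ : v 0 j + v 0 j = 2 * v 0 j); last by ring.
        by rewrite normrM ger0_norm.
      by rewrite (negbTE ij) subrr normr0.
    have e1 := lf w ht (shrunk_ball_in (Xy w) v1') (shrunk_ball_in (Xy w) fv1).
    have e2 := lf w ht (shrunk_ball_inN (Xy w) v1') (shrunk_ball_inN (Xy w) fv1).
    have n1 : l1norm (y w + mu *: v - (y w + mu *: flip_rV j v)) = mu * (2 * `|v 0 j|).
      rewrite -nf -[mu in RHS]gtr0_norm// -l1normZ; congr l1norm.
      by apply/rowP => i; rewrite !mxE; ring.
    have n2 : l1norm (y w - mu *: v - (y w - mu *: flip_rV j v)) = mu * (2 * `|v 0 j|).
      rewrite -nf -[mu in RHS]gtr0_norm// -l1normZ -l1normN; congr l1norm.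
      by apply/rowP => i; rewrite !mxE; ring.
    rewrite n1 in e1; rewrite n2 in e2; move: e1 e2; rewrite /loss_diff !ler_norml.
    by move=> /andP[a1 a2] /andP[a3 a4]; apply/andP; split; lra.
  have var := sphere_law_variance QE mLw L0 LN Lf.
  have mL2 : measurable_fun setT (fun z : V => (loss_diff w z ^+ 2)%:E).
    by apply/measurable_EFinP; exact: (measurable_funX 2 mLw).
  have L20 z : (0 <= (loss_diff w z ^+ 2)%:E)%E by rewrite lee_fin sqr_ge0.
  apply: (@le_trans _ _ (((d%:R / (2 * mu)) ^+ 2)%:E *
      \int[Q]_z (loss_diff w z ^+ 2)%:E)%E).
    rewrite -ge0_integralZl_EFin ?sqr_ge0//.
    apply: ge0_le_integral => //.
    - by move=> z _; rewrite lee_fin.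
    - apply/measurable_EFinP.
      apply: (measurableT_comp mH (_ : measurable_fun setT (fun z : V => (w : O', z)))).
      exact: measurable_fun_pair.
    - exact: measurable_funeM.
    - move=> z _; rewrite -EFinM lee_fin /H/= -exprMn.
      by case: ifPn => // _; exact: sqr_ge0.
  apply: (@le_trans _ _ (((d%:R / (2 * mu)) ^+ 2)%:E * (2 * (2 * G * mu) ^+ 2 / d.+1%:R)%:E)%E).
    by apply: lee_wpmul2l => //; rewrite lee_fin sqr_ge0.
  rewrite -EFinM lee_fin.
  have -> : (d%:R / (2 * mu)) ^+ 2 * (2 * (2 * G * mu) ^+ 2 / d.+1%:R) =
      2 * d%:R * G ^+ 2 * (d%:R / d.+1%:R).
    have d1 : 0 < d.+1%:R :> R by rewrite ltr0n.
    by field; rewrite !gt_eqF.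
  rewrite ler_piMr//; first by rewrite !mulr_ge0 ?sqr_ge0 ?ltW.
  by rewrite ler_pdivrMr ?ltr0n// mul1r ler_nat.
split.
  rewrite eI IE.
  have -> : (2 * d%:R * G ^+ 2)%:E = (\int[P]_w (cst (2 * d%:R * G ^+ 2)%:E w))%E.
    by rewrite integral_cst// -[LHS]mule1; congr (_ * _)%E; exact/esym/probability_setT.
  apply: (@ge0_le_integral _ _ _ P setT measurableT (fun w => \int[Q]_z (H (w, z))%:E)%E (cst (2 * d%:R * G ^+ 2)%:E)) => //.
  - by move=> w _; apply: integral_ge0 => z _; rewrite lee_fin.
  - exact: measurable_int iI.
apply/integrableP; split; first exact/measurable_EFinP.
have [_] := integrableP _ _ _ iH.
rewrite (@ae_eq_integral _ _ _ P setT
   (fun w => `|((d%:R / (2 * mu) * loss_diff w (s t w)) ^+ 2)%:E|)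
   (fun w => `|(H (w, s t w))%:E|))%E//.
- by apply: measurableT_comp => //; exact/measurable_EFinP.
- by apply: measurableT_comp => //; exact/measurable_EFinP.
- by move: Hae; apply: filterS => w h Dw; rewrite h.
Qed.

End one_round.

(** * Parameters *)

Section logarithms.
Context {R : realType}.
Implicit Types x : R.

(** From [exp (- 1/6) >= 5/6]: the sixth power of [6/5] is just below 3. This is why [d] and [T] at
    least 3 have logarithm at least 1. *)
Lemma expR1_le3 : expR 1 <= 3 :> R.
Proof.
have h : expR (- (6%:R^-1)) >= 5 / 6 :> R.
  by apply: le_trans (expR_ge1Dx _); lra.
have h5 : (5 / 6) ^+ 6 * expR 1 <= 1 :> R.
  rewrite [leRHS](_ : 1 = expR (- 6%:R^-1) ^+ 6 * expR 1 :> R); last first.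
    by rewrite -expRM_natl -expRD mulrN mulfV ?pnatr_eq0// addNr expR0.
  apply: ler_wpM2r; first exact: expR_ge0.
  by rewrite lerXn2r ?nnegrE ?expR_ge0//; lra.
have := expR_ge0 (1 : R); move: h5; rewrite !exprS expr0; lra.
Qed.

Lemma ln_nat_ge1 n : (3 <= n)%N -> 1 <= ln n%:R :> R.
Proof.
move=> n3; rewrite -[leLHS]expRK ler_ln ?posrE ?expR_gt0 ?ltr0n ?(ltn_trans _ n3)//.
by apply: (le_trans expR1_le3); rewrite ler_nat.
Qed.

Lemma ln2_ge_half : 2^-1 <= ln 2 :> R.
Proof.
have := @le_ln1Dx R (- 2^-1); rewrite (_ : 1 + - 2^-1 = 2^-1); last by lra.
rewrite lnV ?posrE// => h.
have := h ltac:(lra); lra.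
Qed.

Lemma ln_le_2sqrt x : 0 < x -> ln x <= 2 * Num.sqrt x.
Proof.
move=> x0; have s0 : 0 < Num.sqrt x by rewrite sqrtr_gt0.
have -> : ln x = 2 * ln (Num.sqrt x) by rewrite mulr_natl -lnXn// sqr_sqrtr// ltW.
by rewrite ler_wpM2l//; exact/ltW/ln_sublinear.
Qed.

(** Locates the base learner whose step size is within a factor 2 of the ideal one. *)
Lemma dyadic_bracket (q : R) m : 1 <= q <= 2 ^+ m ->
  exists2 k, (k <= m)%N & 2 ^+ k <= q <= 2 ^+ k.+1.
Proof.
case/andP=> q1; elim: m => [|m IH] qm.
  exists 0%N => //; rewrite expr0 q1/=; apply: (le_trans qm).
  by rewrite expr0 expr1; lra.
have [/IH[k km hk]|mq] := leP q (2 ^+ m).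
  by exists k => //; rewrite (leq_trans km).
by exists m => //; rewrite (ltW mq).
Qed.

End logarithms.

Section parameters.
Context {R : realType}.
Variables (d T : nat) (G : R).
Hypothesis d3 : (3 <= d)%N.
Hypothesis T3 : (3 <= T)%N.
Hypothesis G0 : 0 < G.
Local Notation D := (d%:R : R).
Local Notation Tr := (T%:R : R).
Let A : R := 2 * ln D + 1.
Let c : R := 3 + 2 * (D / d.+1%:R).
Let mu : R := Num.min (Num.sqrt (A * D) / (Num.sqrt Tr * c)) (1 / 2).
Let gamma : R := 1 / (Num.sqrt 48 * (1 + Num.sqrt 2) * G * Num.sqrt (D * Tr)).
Let Ga : R := 1 + ln (D / mu).
Let N : nat := (`|Num.ceil (1 / 2 * (ln (1 + 2 * Ga * Tr / A) / ln 2) : R)| + 1)%N.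
Let eta (k : nat) : R :=
  2 ^+ k.-1 * Num.sqrt (A / (6 * (1 + Num.sqrt 2) ^+ 2 * G ^+ 2 * D * Tr)).
Local Notation l := (ln D).
Local Notation h := (ln Tr).

Let l1 : 1 <= l. Proof. exact: ln_nat_ge1. Qed.
Let h1 : 1 <= h. Proof. exact: ln_nat_ge1. Qed.
Let D3 : 3 <= D. Proof. by rewrite ler_nat. Qed.
Let Tr3 : 3 <= Tr. Proof. by rewrite ler_nat. Qed.
Let A3 : 3 <= A. Proof. by rewrite /A; have := l1; lra. Qed.
Let A0 : 0 < A. Proof. by have := A3; lra. Qed.
Let A3l : A <= 3 * l. Proof. by rewrite /A; have := l1; lra. Qed.
Local Ltac plra := move: l1 h1 D3 Tr3 A3 A3l => *; lra.


Let c35 : 3 <= c <= 5.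
Proof.
have d1 : 0 < d.+1%:R :> R by rewrite ltr0n.
have : 0 <= D / d.+1%:R <= 1.
  by rewrite divr_ge0//= ler_pdivrMr// mul1r ler_nat.
by rewrite /c; set z := D / _ => /andP[z0 z1]; apply/andP; split; lra.
Qed.

Let T9 : 9 <= Tr ^+ 2.
Proof.
by rewrite expr2; apply: (@le_trans _ _ (3 * 3)); [lra|rewrite ler_pM//; plra].
Qed.

Let sT0 : 0 < Num.sqrt Tr. Proof. by rewrite sqrtr_gt0; plra. Qed.

Lemma smoothing_bounds : 0 < mu <= 1 / 2.
Proof.
have /andP[c3 c5] := c35; rewrite ge_min lexx orbT andbT lt_min.
have n0 : 0 < Num.sqrt (A * D) by rewrite sqrtr_gt0 mulr_gt0//; plra.
have e0 : 0 < Num.sqrt Tr * c by rewrite mulr_gt0//; lra.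
by rewrite (divr_gt0 n0 e0)/=; lra.
Qed.

Let Ga_bounds : 1 <= Ga <= 5 * (l * h).
Proof.
have /andP[m0 m1] := smoothing_bounds; have /andP[c3 c5] := c35.
have D0 : 0 < D by plra.
have Dm0 : 0 < D / mu by rewrite divr_gt0.
have sTT : Num.sqrt Tr <= Tr.
  have e1 : 1 <= Num.sqrt Tr by rewrite -[leLHS](sqrtr1 R) ler_sqrt; plra.
  have e2 : Num.sqrt Tr ^+ 2 = Tr by rewrite sqr_sqrtr//; plra.
  by rewrite -[leRHS]e2 expr2 ler_peMl// ltW.
(* One branch of the minimum gives [c sqrt T / sqrt (A d)] with [c <= 5] and [A d >= 1], the other
   gives 2. *)
have m5 : mu^-1 <= 5 * Tr.
  rewrite -[leRHS]invrK lef_pV2 ?posrE ?invr_gt0//; last by plra.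
  rewrite le_min; apply/andP; split; last first.
    by rewrite invf_ple ?posrE; plra.
  rewrite invf_ple ?posrE; last 2 first.
  - plra.
  - rewrite divr_gt0//; last by rewrite mulr_gt0//; plra.
    by rewrite sqrtr_gt0 mulr_gt0//; plra.
  rewrite invf_div ler_pdivrMr; last by rewrite sqrtr_gt0 mulr_gt0//; plra.
  have s1 : 1 <= Num.sqrt (A * D).
    have AD : 1 <= A * D by rewrite -[leLHS]mulr1 ler_pM//; plra.
    by rewrite -[leLHS](sqrtr1 R) ler_sqrt//; lra.
  apply: (@le_trans _ _ (5 * Tr)); last by rewrite ler_peMr//; plra.
  by rewrite [leRHS]mulrC ler_pM//; plra.
apply/andP; split.
  rewrite /Ga lerDl ln_ge0// ler_pdivlMr// mul1r; plra.
(* Since [T^2 >= 9], the factor [5 T] is below [T^3]. *)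
have : ln (D / mu) <= l + 3 * h.
  rewrite (mulr_natl h 3) -lnXn; last by plra.
  rewrite -lnM ?posrE; last 2 first.
  - plra.
  - by rewrite exprn_gt0//; plra.
  rewrite ler_ln ?posrE//; last by rewrite mulr_gt0// exprn_gt0//; plra.
  rewrite ler_pM2l//; apply: (le_trans m5); rewrite exprSr.
  by rewrite ler_pM2r; have := T9; plra.
rewrite /Ga.
have e1 : l <= l * h by rewrite ler_peMr//; plra.
have e2 : h <= l * h by rewrite ler_peMl//; plra.
plra.
Qed.

Let x : R := 1 + 2 * Ga * Tr / A.

Let x1 : 1 <= x.
Proof.
have /andP[g1 g2] := Ga_bounds.
by rewrite lerDl divr_ge0// ?mulr_ge0//; plra.
Qed.

Let ln_x : ln x <= 4 * h.
Proof.
have /andP[g1 g2] := Ga_bounds; have T0 : 0 < Tr by plra.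
have hT : h <= Tr by exact/ltW/ln_sublinear.
have x0 : 0 < x by have := x1; lra.
rewrite (mulr_natl h 4) -lnXn// ler_ln ?posrE ?exprn_gt0//.
have : x <= 1 + 5 * Tr ^+ 2.
  rewrite /x lerD2l ler_pdivrMr//.
  have e1 : Ga * Tr <= 5 * (l * h) * Tr by rewrite ler_pM2r.
  have e2 : l * h * Tr <= l * Tr * Tr by rewrite ler_pM2r// ler_pM2l//; plra.
  have e3 : 0 <= Tr * Tr by rewrite mulr_ge0//; plra.
  rewrite (_ : 5 * Tr ^+ 2 * A = 10 * (l * Tr * Tr) + 5 * (Tr * Tr)); last by rewrite /A; ring.
  lra.
have : 9 * Tr ^+ 2 <= Tr ^+ 2 * Tr ^+ 2 by rewrite ler_wpM2r//; have := T9; lra.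
rewrite -exprD; have := T9; lra.
Qed.

Let ln20 : 0 < ln 2 :> R. Proof. by have := @ln2_ge_half R; plra. Qed.

Lemma learners_gt0 : (0 < N)%N. Proof. by rewrite /N addn1. Qed.

Let ceil_ge0 : 0 <= 1 / 2 * (ln x / ln 2).
Proof.
have ln0 : 0 <= ln x by apply: ln_ge0.
by rewrite mulr_ge0 ?divr_ge0 ?(ltW ln20).
Qed.

Let N_ceil : (N%:R : R) = (Num.ceil (1 / 2 * (ln x / ln 2)))%:~R + 1.
Proof.
rewrite /N natrD; congr (_ + _); rewrite natr_absz ger0_norm// -(ler_int R).
exact: (le_trans ceil_ge0 (ceil_ge _)).
Qed.

Let N_le : N.+1%:R <= 7 * h.
Proof.
rewrite -natr1 N_ceil; set z := 1 / 2 * _.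
have c1 : (Num.ceil z)%:~R < z + 1 by have := ceilB1_lt z; rewrite intrB mulr1z; lra.
have z1 : z <= ln x.
  rewrite /z mulrA ler_pdivrMr//; have := @ln2_ge_half R.
  have : 0 <= ln x by exact: ln_ge0.
  nra.
have := ln_x; plra.
Qed.

(** The number of learners is chosen so that the largest step multiplier reaches [sqrt x], the ideal
    multiplier for the longest possible path. *)
Let N_ge : Num.sqrt x <= 2 ^+ N.-1.
Proof.
have x0 : 0 < x by have := x1; lra.
have p0 : 0 < 2 ^+ N.-1 :> R by rewrite exprn_gt0.
rewrite -[leRHS](ger0_norm (ltW p0)) -sqrtr_sqr ler_sqrt ?sqr_ge0//.
have p2 : 0 < (2 ^+ N.-1) ^+ 2 :> R by rewrite exprn_gt0.
suff : ln x <= ln ((2 ^+ N.-1) ^+ 2) by rewrite (ler_ln x0 p2).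
rewrite !lnXn ?exprn_gt0// {p0 p2}.
have : 1 / 2 * (ln x / ln 2) <= N.-1%:R.
  apply: (le_trans (ceil_ge _)).
  by rewrite -(lerD2r 1) -N_ceil natr1 prednK ?learners_gt0.
set m := N.-1; clearbody m => hm.
have : 1 / 2 * ln x <= m%:R * ln 2.
  by move: hm; rewrite mulrA (ler_pdivrMr _ _ ln20).
rewrite (mulr_natl (ln 2) m) -(mulr_natl (ln 2 *+ m) 2); lra.
Qed.

Let r2 : 2 <= 1 + Num.sqrt (2 : R) <= 5 / 2.
Proof.
have s0 : 0 <= Num.sqrt 2 :> R by exact: sqrtr_ge0.
have : Num.sqrt 2 ^+ 2 = 2 :> R by rewrite sqr_sqrtr.
by rewrite expr2 => s2; apply/andP; split; nra.
Qed.

Let r48 : 6 <= Num.sqrt (48 : R) <= 7.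
Proof.
have s0 : 0 <= Num.sqrt 48 :> R by exact: sqrtr_ge0.
have : Num.sqrt 48 ^+ 2 = 48 :> R by rewrite sqr_sqrtr.
by rewrite expr2 => s2; apply/andP; split; nra.
Qed.

Let B0 : 0 < 6 * (1 + Num.sqrt 2) ^+ 2 * G ^+ 2 * D * Tr.
Proof.
have /andP[a1 a2] := r2.
have r2_gt0 : 0 < 1 + Num.sqrt 2 :> R by lra.
have D0 : 0 < D by plra. have Tr0 : 0 < Tr by plra.
apply: mulr_gt0 => //; apply: mulr_gt0 => //; apply: mulr_gt0; last exact: exprn_gt0.
by apply: mulr_gt0 => //; exact: exprn_gt0.
Qed.

Lemma step_gt0 k : 0 < eta k.
Proof.
have b0 : 0 < Num.sqrt (A / (6 * (1 + Num.sqrt 2) ^+ 2 * G ^+ 2 * D * Tr)).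
  by rewrite sqrtr_gt0; exact: (divr_gt0 A0 B0).
apply: mulr_gt0; [exact: exprn_gt0|exact: b0].
Qed.

Let DT0 : 0 < D * Tr. Proof. by rewrite mulr_gt0; plra. Qed.

Lemma weight_rate_gt0 : 0 < gamma.
Proof.
have /andP[a1 a2] := r2; have /andP[b1 b2] := r48.
by rewrite /gamma divr_gt0// !mulr_gt0// ?sqrtr_gt0//; lra.
Qed.

(** Every initial weight is at least [(N + 1)^(-2)], and [N + 1 <= 7 ln T]. The crude estimate
    [ln n <= 2 sqrt n] suffices because the target contains the square root of [ln T]. *)
Lemma initial_weight_bound k : (1 <= k <= N)%N ->
  - ln (N.+1%:R / N%:R * (k * k.+1)%:R^-1 : R) <= 12 * Num.sqrt h.
Proof.
move=> /andP[k0 kN]; have N0 := learners_gt0; have h0 : 0 < h by plra.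
have n0 : 0 < N%:R :> R by rewrite ltr0n.
have n1 : 0 < N.+1%:R :> R by rewrite ltr0n.
have k1 : 0 < (k * k.+1)%:R :> R by rewrite ltr0n muln_gt0 k0.
rewrite -lnV ?posrE ?mulr_gt0 ?invr_gt0// invfM invrK invf_div.
apply: (@le_trans _ _ (ln (N.+1%:R ^+ 2))).
  rewrite ler_ln ?posrE ?exprn_gt0// ?mulr_gt0 ?invr_gt0//.
  rewrite mulrAC ler_pdivrMr// -natrM -natrX -natrM ler_nat.
  apply: (@leq_trans (N * (N * N.+1))); first by rewrite leq_mul// leq_mul.
  by rewrite mulnA leq_mul// expnS expn1 leq_mul.
rewrite lnXn// -(mulr_natl (ln _) 2).
apply: (@le_trans _ _ (2 * (2 * Num.sqrt (7 * h)))).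
  rewrite ler_pM2l//; apply: (le_trans (ln_le_2sqrt n1)).
  by rewrite ler_pM2l// ler_sqrt// mulr_ge0// ltW.
rewrite sqrtrM//; have s0 : 0 <= Num.sqrt h by exact: sqrtr_ge0.
have s7 : Num.sqrt 7 <= 3 :> R.
  have t0 : 0 <= Num.sqrt 7 :> R by exact: sqrtr_ge0.
  have : Num.sqrt 7 ^+ 2 = 7 :> R by rewrite sqr_sqrtr.
  by rewrite expr2 => s2; nra.
have : Num.sqrt 7 * Num.sqrt h <= 3 * Num.sqrt h by rewrite ler_wpM2r.
lra.
Qed.

(** Each of the terms is a constant times [G * S]: 210 for the choice of the learner, 2 and 14 for
    the second moments, 28 for the entropy and path term, 4 for smoothing and shrinking. *)
Lemma parameter_bound (p : R) : 0 <= p <= 2 * Tr ->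
  exists2 k, (1 <= k <= N)%N &
    12 * Num.sqrt h / gamma + (eta k)^-1 * (l + ln (D / mu) * p) +
    (8 * gamma + eta k) * (2 * D * G ^+ 2 * Tr) + 5 * G * mu * Tr <=
    1000 * (G * Num.sqrt (D * l * Tr * h * (1 + p))).
Proof.
move=> /andP[p0 pT]; have /andP[g1 g2] := Ga_bounds.
have /andP[a1 a2] := r2; have /andP[b1 b2] := r48.
have /andP[m0 m1] := smoothing_bounds; have /andP[c3 c5] := c35.
(* The multiplier of the base step [b] that balances the entropy and path cost, at most [A q^2],
   against the second-moment cost. *)
pose q := Num.sqrt (1 + Ga * p / A).
have gp0 : 0 <= Ga * p by rewrite mulr_ge0//; lra.
have gpA : 0 <= Ga * p / A by rewrite divr_ge0// ltW.
have q2 : A * q ^+ 2 = A + Ga * p.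
  by rewrite sqr_sqrtr; [rewrite mulrDr mulr1 mulrC divfK// gt_eqF|lra].
(* The path length is at most [2 T], so [q] is at most [sqrt x] and lies within the grid. *)
have /dyadic_bracket[j jN /andP[qj jq]] : 1 <= q <= 2 ^+ N.-1.
  rewrite -[leLHS](sqrtr1 R) ler_sqrt ?lerDl ?gpA/=; last by lra.
  apply: (le_trans _ N_ge); rewrite ler_sqrt; last by have := x1; lra.
  rewrite lerD2l ler_pM2r ?invr_gt0//.
  have : Ga * p <= Ga * (2 * Tr) by rewrite ler_pM2l//; lra.
  lra.
exists j.+1; first by rewrite ltnS/= -(prednK learners_gt0) ltnS.
pose S := Num.sqrt (D * l * Tr * h * (1 + p)).
pose r := Num.sqrt (D * Tr).
have D0 : 0 < D by plra. have Tr0 : 0 < Tr by plra.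
have l0 : 0 < l by plra. have h0 : 0 < h by plra.
have p1 : 1 <= 1 + p by lra.
have r0 : 0 < r by rewrite sqrtr_gt0.
have rr : r ^+ 2 = D * Tr by rewrite sqr_sqrtr// ltW.
have S0 : 0 <= S by exact: sqrtr_ge0.
have SS : S ^+ 2 = D * l * Tr * h * (1 + p).
  by rewrite sqr_sqrtr// !mulr_ge0//; lra.
have lh1 : 1 <= l * h * (1 + p).
  by apply: mulr_ege1 => //; apply: mulr_ege1; plra.
have sqrt_le (a b : R) : 0 <= b -> a ^+ 2 <= b ^+ 2 -> a <= b.
  by move=> b0; have [//|ab] := leP a b; rewrite !expr2; nra.
have SE : S ^+ 2 = r ^+ 2 * (l * h * (1 + p)) by rewrite SS rr; ring.
have rS : r <= S.
  by apply: sqrt_le => //; rewrite SE ler_peMr// sqr_ge0.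
have rhS : r * Num.sqrt h <= S.
  apply: sqrt_le => //; rewrite exprMn (sqr_sqrtr (ltW h0)) SE ler_pM2l ?exprn_gt0//.
  rewrite mulrAC; apply: ler_peMl; first exact: ltW.
  by apply: mulr_ege1 => //; plra.
have t1 : 12 * Num.sqrt h / gamma <= 210 * (G * S).
  rewrite /gamma div1r invrK -/r.
  have u1 : Num.sqrt 48 * (1 + Num.sqrt 2) <= 35 / 2 :> R.
    by apply: (@le_trans _ _ (7 * (5 / 2))); [rewrite ler_pM//; lra|lra].
  have u2 : 0 <= G * (r * Num.sqrt h) by rewrite !mulr_ge0 ?sqrtr_ge0 ?ltW.
  have u3 : Num.sqrt 48 * (1 + Num.sqrt 2) * (G * (r * Num.sqrt h)) <= 35 / 2 * (G * S).
    apply: (@le_trans _ _ (35 / 2 * (G * (r * Num.sqrt h)))).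
      by rewrite ler_wpM2r.
    by rewrite ler_pM2l// ler_pM2l.
  rewrite (_ : 12 * _ * _ = 12 * (Num.sqrt 48 * (1 + Num.sqrt 2) * (G * (r * Num.sqrt h)))); last by ring.
  lra.
have t2 : 8 * gamma * (2 * D * G ^+ 2 * Tr) <= 2 * (G * S).
  have -> : 8 * gamma * (2 * D * G ^+ 2 * Tr) =
      16 / (Num.sqrt 48 * (1 + Num.sqrt 2)) * (G * r).
    rewrite /gamma -/r (_ : 2 * D * G ^+ 2 * Tr = 2 * r ^+ 2 * G ^+ 2); last by rewrite rr; ring.
    by field; rewrite !gt_eqF//; lra.
  have v0 : 12 <= Num.sqrt 48 * (1 + Num.sqrt 2) :> R.
    by apply: (@le_trans _ _ (6 * 2)); [lra|rewrite ler_pM//; lra].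
  have v1 : 16 / (Num.sqrt 48 * (1 + Num.sqrt 2)) <= 2 :> R by rewrite ler_pdivrMr; lra.
  apply: (@le_trans _ _ (2 * (G * r))); last by rewrite !ler_pM2l.
  by rewrite ler_wpM2r// mulr_ge0// ltW.
pose B := 6 * (1 + Num.sqrt 2) ^+ 2 * G ^+ 2 * D * Tr.
have Bp : 0 < B := B0.
pose b := Num.sqrt (A / B).
have b0 : 0 < b by rewrite sqrtr_gt0 divr_gt0.
have bb : b ^+ 2 = A / B by rewrite sqr_sqrtr// divr_ge0 ?ltW.
have Ab : A = b ^+ 2 * B by rewrite bb divfK// gt_eqF.
have bB : b * B = A / b by rewrite Ab; field; rewrite gt_eqF.
have q1 : 1 <= q.
  by rewrite -[leLHS](sqrtr1 R) ler_sqrt; lra.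
have B36 : B <= 38 * (G ^+ 2 * r ^+ 2).
  have s2 : (1 + Num.sqrt 2) ^+ 2 <= 25 / 4 :> R by rewrite expr2; nra.
  rewrite rr /B.
  have w0 : 0 <= G ^+ 2 * (D * Tr) by rewrite mulr_ge0 ?sqr_ge0 ?ltW.
  have : (1 + Num.sqrt 2) ^+ 2 * (G ^+ 2 * (D * Tr)) <= 25 / 4 * (G ^+ 2 * (D * Tr)).
    by rewrite ler_wpM2r.
  set w := _ * (D * Tr) in w0 *.
  rewrite (_ : 6 * _ * _ * _ * _ = 6 * ((1 + Num.sqrt 2) ^+ 2 * w)); last by rewrite /w; ring.
  lra.
(* As [b^2 = A / B], the left side is [sqrt (B * (A q^2))], the common size of the two balanced
   costs. *)
have t3 : b * B * q <= 14 * (G * S).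
  apply: sqrt_le; first by apply: mulr_ge0 => //; apply: mulr_ge0 => //; exact: ltW.
  have AG : A * q ^+ 2 <= 5 * (l * h * (1 + p)).
    rewrite q2.
    have w1 : Ga * p <= 5 * (l * h) * p by rewrite ler_wpM2r.
    have w2 : l <= l * h by rewrite ler_peMr// ltW.
    have := A3l; lra.
  have -> : (b * B * q) ^+ 2 = B * (A * q ^+ 2).
    by rewrite Ab; ring.
  apply: (@le_trans _ _ (38 * (G ^+ 2 * r ^+ 2) * (5 * (l * h * (1 + p))))).
    apply: ler_pM => //; first exact: ltW.
    by apply: mulr_ge0; [exact: ltW|exact: sqr_ge0].
  rewrite (_ : 38 * _ * _ = 190 * (G ^+ 2 * S ^+ 2)); last by rewrite SE; ring.
  rewrite !exprMn (_ : 14 ^+ 2 = 196); last by ring.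
  have : 0 <= G ^+ 2 * S ^+ 2 by apply: mulr_ge0; exact: sqr_ge0.
  set w := G ^+ 2 * _; lra.
have eE : eta j.+1 = 2 ^+ j * b by [].
have e0 : 0 < eta j.+1 by exact: step_gt0.
(* The ideal multiplier is at most twice the chosen [2 ^ j]; this is the only loss from the dyadic
   grid. *)
have t4 : (eta j.+1)^-1 * (l + ln (D / mu) * p) <= 2 * (b * B * q).
  rewrite mulrC ler_pdivrMr//.
  apply: (@le_trans _ _ (A * q ^+ 2)).
    rewrite q2; have : ln (D / mu) * p <= Ga * p by rewrite ler_wpM2r// /Ga lerDr.
    by rewrite /A; lra.
  rewrite eE bB (_ : 2 * (A / b * q) * (2 ^+ j * b) = A * q * (2 ^+ j.+1)); last first.
    by rewrite exprS; field; rewrite gt_eqF.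
  by rewrite expr2 mulrA ler_pM2l// mulr_gt0//; lra.
have t5 : eta j.+1 * (2 * D * G ^+ 2 * Tr) <= b * B * q.
  apply: (@le_trans _ _ (eta j.+1 * B)).
    have w0 : 0 <= G ^+ 2 * (D * Tr) by apply: mulr_ge0; [exact: sqr_ge0|exact: ltW].
    have s1 : 1 <= (1 + Num.sqrt 2) ^+ 2 :> R by rewrite expr2; apply: mulr_ege1; lra.
    rewrite ler_pM2l// /B.
    have : 1 * (G ^+ 2 * (D * Tr)) <= (1 + Num.sqrt 2) ^+ 2 * (G ^+ 2 * (D * Tr)).
      by rewrite ler_wpM2r.
    set a := (1 + _) ^+ 2; set v := G ^+ 2 * _ in w0 * => s2.
    rewrite (_ : 2 * D * _ * _ = 2 * v); last by rewrite /v; ring.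
    rewrite (_ : 6 * a * _ * _ * _ = 6 * (a * v)); last by rewrite /v; ring.
    lra.
  rewrite eE (_ : 2 ^+ j * b * B = b * B * 2 ^+ j); last by ring.
  by rewrite ler_pM2l// mulr_gt0.
have t6 : 5 * G * mu * Tr <= 4 * (G * S).
  have w0 : 0 < Num.sqrt (A * D) by rewrite sqrtr_gt0 mulr_gt0.
  have w1 : mu * Tr <= Num.sqrt (A * D) * Num.sqrt Tr / 3.
    have : mu <= Num.sqrt (A * D) / (Num.sqrt Tr * c) by rewrite ge_min lexx.
    rewrite ler_pdivlMr; last by rewrite mulr_gt0//; lra.
    have Tq : Tr = Num.sqrt Tr ^+ 2 by rewrite sqr_sqrtr// ltW.
    move=> w2; rewrite ler_pdivlMr//.
    have -> : mu * Tr * 3 = mu * (Num.sqrt Tr * 3) * Num.sqrt Tr by rewrite [in LHS]Tq; ring.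
    rewrite ler_pM2r//.
    by apply: le_trans w2; rewrite !ler_pM2l.
  have w2 : Num.sqrt (A * D) * Num.sqrt Tr <= 2 * S.
    apply: sqrt_le; first by rewrite mulr_ge0.
    rewrite !exprMn (sqr_sqrtr (ltW (mulr_gt0 A0 D0))) (sqr_sqrtr (ltW Tr0)) SE rr.
    rewrite (_ : A * D * Tr = D * Tr * A); last by ring.
    rewrite (_ : 2 ^+ 2 * _ = D * Tr * (4 * (l * h * (1 + p)))); last by ring.
    rewrite ler_pM2l//; apply: (le_trans A3l).
    have : l * 1 <= l * (h * (1 + p)).
      by rewrite ler_pM2l//; apply: mulr_ege1 => //; plra.
    rewrite mulr1 mulrA; lra.
  have : G * (mu * Tr) <= G * (2 * S / 3).
    by rewrite ler_pM2l//; lra.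
  have : 0 <= G * S by rewrite mulr_ge0// ltW.
  lra.
have -> : (8 * gamma + eta j.+1) * (2 * D * G ^+ 2 * Tr) =
  8 * gamma * (2 * D * G ^+ 2 * Tr) + eta j.+1 * (2 * D * G ^+ 2 * Tr) by ring.
rewrite -/S; have : 0 <= G * S by rewrite mulr_ge0// ltW.
lra.
Qed.

End parameters.

(** * Expected regret *)

Section real_integrals.
Context {disp : measure_display} {Omega : measurableType disp} {R : realType}.
Variable P : probability Omega R.

(* [h] itself need not be integrable: only its positive part is controlled. *)
Lemma ae_integral_le_integrable (h k : Omega -> R) : measurable_fun setT h ->
  P.-integrable setT (fun w => (k w)%:E) -> {ae P, forall w, h w <= k w} ->
  (\int[P]_w (h w)%:E <= \int[P]_w (k w)%:E)%E.
Proof.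
move=> mh ik hk.
have mk : measurable_fun setT (fun w => (k w)%:E) := measurable_int _ ik.
have mh' : measurable_fun setT (fun w => (h w)%:E) by exact/measurable_EFinP.
rewrite integralE [leRHS]integralE; apply: leeB.
  apply: ae_ge0_le_integral => //.
  - exact: measurable_funepos.
  - exact: measurable_funepos.
  - apply: filterS hk => w hw _; rewrite !funeposE.
    by rewrite -!EFin_max lee_fin ge_max !le_max lexx hw orbT.
apply: ae_ge0_le_integral => //.
- exact: measurable_funeneg.
- exact: measurable_funeneg.
- apply: filterS hk => w hw _; rewrite !funenegE.
  by rewrite -!EFinN -!EFin_max lee_fin ge_max !le_max lexx lerN2 hw orbT.
Qed.

Lemma integral_shift (F : Omega -> R) (c : R) :
  P.-integrable setT (fun w => (F w)%:E) ->
  P.-integrable setT (fun w => (F w + c)%:E) /\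
  (\int[P]_w (F w + c)%:E = \int[P]_w (F w)%:E + c%:E)%E.
Proof.
move=> iF.
have ic : P.-integrable setT (fun _ : Omega => c%:E).
  by apply: (@bounded_integrable _ _ _ P (fun _ => c) `|c|).
have -> : (fun w => (F w + c)%:E) = (fun w => (F w)%:E + c%:E)%E by [].
split; first exact: integrableD.
rewrite integralD//; congr (_ + _)%E.
rewrite integral_cst// -[RHS]mule1; congr (_ * _)%E; exact: probability_setT.
Qed.

Lemma integral_sum_nat (T : nat) (F : nat -> Omega -> R) :
  (forall t, (1 <= t <= T)%N -> P.-integrable setT (fun w => (F t w)%:E)) ->
  P.-integrable setT (fun w => (\sum_(1 <= t < T.+1) F t w)%:E) /\
  (\int[P]_w (\sum_(1 <= t < T.+1) F t w)%:E =
   \sum_(1 <= t < T.+1) \int[P]_w (F t w)%:E)%E.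
Proof.
move=> iF; pose F' t w := if (1 <= t <= T)%N then F t w else 0.
have iF' t : P.-integrable setT (fun w => (F' t w)%:E).
  rewrite /F'; case: (boolP (1 <= t <= T)%N) => ht; first exact: iF.
  exact: integrable0.
have FE : (fun w => (\sum_(1 <= t < T.+1) F t w)%:E) =
    (fun w => (\sum_(1 <= t < T.+1) (F' t w)%:E)%E).
  apply/funext => w; rewrite sumEFin; congr (_%:E).
  by apply: eq_big_nat => t; rewrite ltnS /F' => ->.
rewrite FE; split; first by apply: integrable_sum => //.
rewrite (integral_sum measurableT iF'); apply: eq_big_nat => t.
by rewrite ltnS /F' => ->.
Qed.

End real_integrals.

Section expected_regret.
Context {disp : measure_display} {Omega : measurableType disp} {R : realType}.
Context {n : nat}.
Local Notation d := n.+1.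
Variables (P : probability Omega R) (T N : nat) (alpha mu gamma G : R) (eta : nat -> R).
Hypothesis n0 : (0 < n)%N.
Hypothesis T1 : (1 <= T)%N.
Hypothesis N0 : (0 < N)%N.
Hypothesis alpha01 : 0 < alpha <= 1.
Hypothesis mu0 : 0 < mu.
Hypothesis gamma0 : 0 < gamma.
Hypothesis G0 : 0 < G.
Hypothesis eta0 : forall k, 0 < eta k.
Local Notation X := (@shrunk_simplex R d alpha).
Local Notation V := (borel_rV R d).
Variables (U : set 'rV[R]_d) (s : nat -> Omega -> 'rV[R]_d).
Variables (f : nat -> Omega -> 'rV[R]_d -> R).
Variables (xp xm y g : nat -> Omega -> 'rV[R]_d).
Variables (yb : nat -> nat -> Omega -> 'rV[R]_d) (om : nat -> nat -> Omega -> R).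
Hypothesis oU : open U.
Hypothesis XU : [set x + mu *: z | x in X & z in l1_ball] `<=` U.
Hypothesis us : uniform_draws P T s.
Hypothesis na : nonanticipating T s f.
Hypothesis cf : forall t w, (1 <= t <= T)%N -> cvx (f t w).
Hypothesis lf : forall t w, (1 <= t <= T)%N -> l1_lipschitz G U (f t w).
Hypothesis run : forall w, PBMD_run T mu gamma N eta neg_entropy X barycenter
    (fun t => f t w) (fun t => s t w) (fun t => xp t w) (fun t => xm t w)
    (fun t => y t w) (fun t => g t w) (fun k t => yb k t w) (fun k t => om k t w).
Variable u : nat -> 'rV[R]_d.
Hypothesis su : forall t, (1 <= t <= T)%N -> simplex (u t).

Let d0 : (0 < d)%N. Proof. by []. Qed.
Let v t : 'rV[R]_d := (1 - alpha) *: u t + alpha *: barycenter.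

Let Xv t : (1 <= t <= T)%N -> X (v t).
Proof. by move=> ht; exists (u t) => //; exact: su. Qed.

Let Xy t w : (1 <= t <= T)%N -> X (y t w).
Proof. by move=> ht; exact: (run_average_in d0 alpha01 N0 (run w) ht). Qed.

Let my t : (1 <= t <= T)%N -> measurable_fun setT (y t : past_type s t -> V).
Proof. by move=> ht; exact: (run_average_measurable d0 N0 alpha01 eta0 na cf run ht). Qed.

(* [u t] may lie outside [U]: extrapolate from [U] through [v t] by convexity. *)
Lemma comparator_shrink t w : (1 <= t <= T)%N ->
  f t w (v t) - 2 * G * alpha <= f t w (u t).
Proof.
move=> ht; case/andP: (alpha01) => a0 a1; have Uv := shrunk_in XU (Xv ht).
pose e := u t - v t.
have ne : l1norm e <= 2 * alpha.
  have -> : e = alpha *: (u t - barycenter).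
    by apply/rowP => j; rewrite !mxE; ring.
  rewrite l1normZ gtr0_norm// mulrC; apply: ler_wpM2r; first exact: ltW.
  apply: (le_trans (l1normB _ _)).
  by rewrite (simplex_l1norm (su ht)) (simplex_l1norm (barycenter_simplex d0)).
have [r /= r0 rU] : exists2 r : R, 0 < r & forall h : R, `|h| < r -> U (v t - h *: e).
  have ch : continuous (fun h : R => v t - h *: e).
    move=> h; apply: cvgB; first exact: cvg_cst.
    apply: cvgZl; exact: cvg_id.
  have : \forall h \near (0 : R), U (v t - h *: e).
    by apply: ch; rewrite scale0r subr0; exact: open_nbhs_nbhs.
  move=> /nbhs_ballP[r /= r0 hr]; exists r => // h hr'.
  by apply: hr; rewrite /ball/= sub0r normrN.
pose h := r / 2; have h0 : 0 < h by rewrite divr_gt0.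
have Uh : U (v t - h *: e) by apply: rU; rewrite gtr0_norm// /h; lra.
have h1 : 0 < 1 + h by lra.
(* [v t] is the combination of [u t] and the point [v t - h e] of [U] with these weights, so the
   slope of [f] on the [U] side of [v t] controls the slope beyond it. *)
have h01 : 0 <= h / (1 + h) <= 1.
  by rewrite (divr_ge0 (ltW h0) (ltW h1))/= ler_pdivrMr// mul1r; lra.
have := cf w ht (u t) (v t - h *: e) h01.
have -> : (h / (1 + h)) *: u t + (1 - h / (1 + h)) *: (v t - h *: e) = v t.
  have gen (a b : 'rV[R]_d) : (h / (1 + h)) *: a + (1 - h / (1 + h)) *: (b - h *: (a - b)) = b.
    by apply/rowP => j; rewrite !mxE; field; rewrite gt_eqF.
  exact: gen.
set fu := f t w (u t); set fv := f t w (v t).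
have := lf w ht Uh Uv; rewrite -/fv; set fh := f t w _.
rewrite addrAC subrr add0r l1normN l1normZ (gtr0_norm h0) => lip cv.
have lip' : fh <= fv + h * (2 * G * alpha).
  have : G * (h * l1norm e) <= h * (2 * G * alpha).
    have : G * (h * l1norm e) <= G * (h * (2 * alpha)) by rewrite !ler_pM2l.
    lra.
  by move: lip; rewrite ler_norml => /andP[_]; lra.
have cv' : fv * (1 + h) <= h * fu + fh.
  move: cv; rewrite -(ler_pM2r h1); congr (_ <= _); field; rewrite gt_eqF//.
rewrite -(ler_pM2l h0); lra.
Qed.

Let loss w := \sum_(1 <= t < T.+1) ((f t w (xp t w) + f t w (xm t w)) / 2 - f t w (u t)).

Let measurable_loss_sum : measurable_fun setT loss.
Proof.
rewrite /loss.
have -> : (fun w => \sum_(1 <= t < T.+1) ((f t w (xp t w) + f t w (xm t w)) / 2 - f t w (u t))) =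
  (fun w => \sum_(1 <= t < T.+1) (if (1 <= t <= T)%N then
     (f t w (y t w + mu *: s t w) + f t w (y t w + (- mu) *: s t w)) / 2 - f t w (u t) else 0)).
  apply/funext => w; apply: eq_big_nat => t; rewrite ltnS => ht; rewrite ht.
  by rewrite (run_plus (run w) ht) (run_minus (run w) ht) scaleNr.
apply: measurable_sum => t; case: (boolP (1 <= t <= T)%N) => ht //.
have m a := measurable_at_draw us ht (measurable_loss_shift na cf ht (my ht) a).
apply: measurable_funB.
  by apply: measurable_funM => //; apply: measurable_funD; exact: m.
apply: (past_measurable_fun us ht).
exact: (measurable_loss na cf ht (measurable_cst (u t : V))).
Qed.

(** The pathwise bound for any one learner [k], integrated. The coefficient [3 mu] collects the bias
    [2 mu] of the estimator and the distance [mu] between queries and [y^t]; [2 alpha] pays for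
    shrinking the comparator. *)
Lemma expected_regret_le k : (1 <= k <= N)%N ->
  (\int[P]_w (loss w)%:E <=
   (- ln (N.+1%:R / N%:R * (k * k.+1)%:R^-1) / gamma +
    (eta k)^-1 * (ln d%:R + ln (d%:R / alpha) *
       \sum_(1 <= t < T) l1norm (u t.+1 - u t)) +
    (8 * gamma + eta k) * (2 * d%:R * G ^+ 2 * T%:R) +
    (3 * mu + 2 * alpha) * G * T%:R)%:E)%E.
Proof.
move=> hk; case/andP: (alpha01) => a0 a1.
pose b t w := f t w (y t w) - f t w (v t).
pose D t w := d%:R / (2 * mu) * loss_diff mu f t (y t) w (s t w).
have gE t w : (1 <= t <= T)%N -> g t w = D t w *: signv (s t w).
  move=> ht; rewrite (run_gradient (run w) ht) (run_plus (run w) ht).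
  by rewrite (run_minus (run w) ht).
have round1 t (ht : (1 <= t <= T)%N) := gradient_round n0 alpha01 mu0 G0 XU us na cf lf ht (my ht)
  (fun w => Xy w ht) (Xv ht) (fun w => gE t w ht).
have round2 t (ht : (1 <= t <= T)%N) := second_moment_round mu0 G0 XU us na cf lf ht (my ht)
  (fun w => Xy w ht).
have ib t (ht : (1 <= t <= T)%N) : P.-integrable setT (fun w => (b t w - 2 * G * mu)%:E).
  exact: (integral_shift (- (2 * G * mu)) (round1 t ht).2.1).1.
have [ibs Ib] := integral_sum_nat ib.
have [ids Id] := integral_sum_nat (fun t ht => (round1 t ht).2.2).
have [ims Im] := integral_sum_nat (fun t ht => (round2 t ht).2).
pose c1 := (3 * mu + 2 * alpha) * G * T%:R.
have [ibc Ibc] := integral_shift c1 ibs.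
(* The loss at [u t] has no integrable upper bound here, so the regret is compared with an
   integrable majorant instead of being split into expectations. *)
have step1 : (\int[P]_w (loss w)%:E <=
    \int[P]_w (\sum_(1 <= t < T.+1) (b t w - 2 * G * mu) + c1)%:E)%E.
  apply: ae_integral_le_integrable => //.
  have ae1 : {ae P, forall w, forall t, (1 <= t <= T)%N -> l1norm (s t w) = 1}.
    apply/ae_foralln => t; case: (boolP (1 <= t <= T)%N) => ht.
      by apply: filterS (draw_ae us ht) => w.
    by apply: aeW.
  apply: filterS ae1 => w sw.
  have -> : c1 = \sum_(1 <= t < T.+1) ((3 * mu + 2 * alpha) * G).
    by rewrite sumr_const_nat subn1 -[RHS]mulr_natr.
  rewrite -big_split/=; apply: ler_sum_nat => t; rewrite ltnS => ht.
  have s1 : l1norm (s t w) <= 1 by rewrite sw.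
  have := comparator_shrink w ht.
  have := lf w ht (shrunk_ball_in XU (Xy w ht) s1) (shrunk_in XU (Xy w ht)).
  have := lf w ht (shrunk_ball_inN XU (Xy w ht) s1) (shrunk_in XU (Xy w ht)).
  rewrite (run_plus (run w) ht) (run_minus (run w) ht).
  rewrite ![y t w + _ - y t w]addrAC subrr !add0r l1normN l1normZ (sw t ht) (gtr0_norm mu0) mulr1.
  by rewrite !ler_norml /b => /andP[_ e1] /andP[_ e2] e3; lra.
have step2 : (\int[P]_w (\sum_(1 <= t < T.+1) (b t w - 2 * G * mu))%:E <=
    \int[P]_w (\sum_(1 <= t < T.+1) dotp (g t w) (y t w - v t))%:E)%E.
  rewrite Ib Id !big_nat; apply: lee_sum => t; rewrite ltnS => ht.
  exact: (round1 t ht).1.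
pose c2 := - ln (N.+1%:R / N%:R * (k * k.+1)%:R^-1) / gamma +
    (eta k)^-1 * (ln d%:R + ln (d%:R / alpha) * \sum_(1 <= t < T) l1norm (u t.+1 - u t)).
pose c3 := 8 * gamma + eta k; have c30 : 0 < c3 by rewrite addr_gt0// mulr_gt0.
have im3 : P.-integrable setT (fun w => (c3 * \sum_(1 <= t < T.+1) D t w ^+ 2)%:E).
  by have := integrableZl measurableT c3 ims.
have [imc Imc] := integral_shift c2 im3.
have lam0 : 0 <= ln (d%:R / alpha).
  have d1 : 1 <= d%:R :> R by rewrite ler1n.
  by apply: ln_ge0; rewrite ler_pdivlMr// mul1r; lra.
have step3 : (\int[P]_w (\sum_(1 <= t < T.+1) dotp (g t w) (y t w - v t))%:E <=
    \int[P]_w (c3 * \sum_(1 <= t < T.+1) D t w ^+ 2 + c2)%:E)%E.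
  apply: le_integral => // w _; rewrite lee_fin.
  (* Signs have modulus 1, so every coordinate of [g t] is bounded by the same scalar. *)
  have hM t j : (1 <= t <= T)%N -> `|g t w 0 j| <= `|D t w|.
    move=> ht; rewrite (gE t w ht) !mxE normrM ler_piMr//.
    by rewrite /sign1; case: ifPn => _; rewrite ?normrN normr1.
  have := run_regret d0 alpha01 N0 (run w) T1 gamma0 (eta0 k) hk hM Xv.
  rewrite (run_init_weight (run w) hk) => rr; apply: (le_trans rr).
  rewrite (eq_bigr (fun t => D t w ^+ 2) (fun t _ => real_normK (num_real (D t w)))).
  rewrite addrC lerD2l /c2 lerD2l ler_pM2l ?invr_gt0// lerD2l ler_wpM2l//.
  apply: ler_sum => t _.
  (* Shrinking contracts the comparator path by the factor [1 - alpha]. *)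
  have -> : v t.+1 - v t = (1 - alpha) *: (u t.+1 - u t).
    by apply/rowP => j; rewrite !mxE; ring.
  rewrite l1normZ ger0_norm; last by lra.
  by rewrite ler_piMl ?l1norm_ge0//; lra.
apply: (le_trans step1); rewrite Ibc.
rewrite [X in (_ <= X)%E](_ : _ = (c3%:E * (2 * d%:R * G ^+ 2 * T%:R)%:E + c2%:E + c1%:E)%E).
  apply: leeD => //; apply: (le_trans step2); apply: (le_trans step3).
  rewrite Imc; apply: leeD => //.
  under eq_integral do rewrite EFinM.
  rewrite (integralZl measurableT ims); apply: lee_wpmul2l; first by rewrite lee_fin ltW.
  have -> : ((2 * d%:R * G ^+ 2 * T%:R)%:E =
      \sum_(1 <= t < T.+1) (2 * d%:R * G ^+ 2)%:E)%E.
    by rewrite sumEFin; congr (_%:E); rewrite sumr_const_nat subn1 -[RHS]mulr_natr.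
  rewrite Im.
  rewrite !big_nat; apply: lee_sum => t; rewrite ltnS => ht.
  exact: (round2 t ht).1.
by rewrite -!EFinM -!EFinD; congr (_%:E); rewrite /c1 /c2 /c3; ring.
Qed.

End expected_regret.

Theorem theorem4p1 (R : realType) :
  exists C : R, 0 < C /\
  forall (d T : nat) (G : R),
  (3 <= d)%N -> (3 <= T)%N -> 0 < G ->
  let A : R := 2 * ln d%:R + 1 in
  let zeta1 : R := d%:R / d.+1%:R in
  let c : R := 3 + 2 * zeta1 in
  let mu : R := Num.min (Num.sqrt (A * d%:R) / (Num.sqrt T%:R * c)) (1 / 2) in
  let alpha : R := mu in
  let gamma : R :=
    1 / (Num.sqrt 48 * (1 + Num.sqrt 2) * G * Num.sqrt (d%:R * T%:R)) in
  let Ga : R := 1 + ln (d%:R / alpha) in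
  let N : nat :=
    (`|Num.ceil (1 / 2 * (ln (1 + 2 * Ga * T%:R / A) / ln 2) : R)| + 1)%N in
  let eta (k : nat) : R :=
    2 ^+ k.-1 *
    Num.sqrt (A / (6 * (1 + Num.sqrt 2) ^+ 2 * G ^+ 2 * d%:R * T%:R)) in
  let X : set 'rV[R]_d := shrunk_simplex alpha in
  forall (U : set 'rV[R]_d)
    (disp : measure_display) (Omega : measurableType disp)
    (P : probability Omega R)
    (s : nat -> Omega -> 'rV[R]_d) (f : nat -> Omega -> 'rV[R]_d -> R)
    (xp xm y g : nat -> Omega -> 'rV[R]_d)
    (yb : nat -> nat -> Omega -> 'rV[R]_d) (om : nat -> nat -> Omega -> R)
    (u : nat -> 'rV[R]_d),
  open U -> convex_set U ->
  [set x + mu *: z | x in X & z in l1_ball] `<=` U ->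
  uniform_draws P T s ->
  nonanticipating T s f ->
  (forall t w, (1 <= t <= T)%N -> convex_function setT (f t w)) ->
  (forall t w, (1 <= t <= T)%N -> l1_lipschitz G U (f t w)) ->
  (forall w, PBMD_run T mu gamma N eta neg_entropy X barycenter
    (fun t => f t w) (fun t => s t w) (fun t => xp t w) (fun t => xm t w)
    (fun t => y t w) (fun t => g t w) (fun k t => yb k t w)
    (fun k t => om k t w)) ->
  (forall t, (1 <= t <= T)%N -> simplex (u t)) ->
  let path_length : R := \sum_(1 <= t < T) l1norm (u t.+1 - u t) in
  ('E_P[(fun w => \sum_(1 <= t < T.+1)
      ((f t w (xp t w) + f t w (xm t w)) / 2 - f t w (u t)))%R]
   <= (C * (G * Num.sqrt (d%:R * ln d%:R * T%:R * ln T%:R *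
                          (1 + path_length))))%:E)%E.
Proof.
(* The individual constants of [parameter_bound] add up to 258; 1000 leaves slack. *)
exists 1000; split; first by rewrite ltr0n.
move=> [T G //|n T G] d3 T3 G0 A zeta1 c mu alpha gamma Ga N eta X
  U disp Omega P s f xp xm y g yb om u oU _ XU us na cf lf run su.
cbv zeta; set path_length := \sum_(1 <= t < T) _.
have cf' t w : (1 <= t <= T)%N -> cvx (f t w).
  by move=> ht; exact: (convex_function_cvx (cf t w ht)).
have T1 : (1 <= T)%N by exact: ltn_trans T3.
have /andP[mu0 mu1] : 0 < mu <= 1 / 2 := smoothing_bounds d3 T3.
have alpha01 : 0 < alpha <= 1 by rewrite /alpha mu0/=; lra.
have gamma0 : 0 < gamma := weight_rate_gt0 d3 T3 G0.
have eta0 k : 0 < eta k := step_gt0 d3 T3 G0 k.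
have N0 : (0 < N)%N by rewrite /N addn1.
have p0 : 0 <= path_length by apply: sumr_ge0 => t _; exact: l1norm_ge0.
(* Two points of the simplex are at l1-distance at most 2; this bound on the path is what the size
   of the step grid is designed for. *)
have pT : path_length <= 2 * T%:R.
  apply: (@le_trans _ _ (\sum_(1 <= t < T) 2)).
    apply: ler_sum_nat => t /andP[t1 tT]; apply: (le_trans (l1normB _ _)).
    have st : simplex (u t) by apply: su; rewrite t1 ltnW.
    have st1 : simplex (u t.+1) by apply: su.
    by rewrite (simplex_l1norm st) (simplex_l1norm st1).
  by rewrite sumr_const_nat -[leLHS]mulr_natr ler_pM2l// ler_nat leq_subr.
have p0T : 0 <= path_length <= 2 * T%:R by rewrite p0.
have [k hk bound] := parameter_bound d3 T3 G0 p0T.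
have weight := initial_weight_bound d3 T3 hk.
rewrite unlock.
have n0 : (0 < n)%N by rewrite -ltnS; exact: ltn_trans d3.
apply: (le_trans (expected_regret_le n0 T1 N0 alpha01 mu0 gamma0 G0 eta0 oU XU us na cf' lf
  run su hk)).
rewrite lee_fin; apply: le_trans bound.
have e1 : - ln (N.+1%:R / N%:R * (k * k.+1)%:R^-1) / gamma <= 12 * Num.sqrt (ln T%:R) / gamma.
  by rewrite ler_pM2r ?invr_gt0.
apply: lerD; first by rewrite lerD2r lerD2r.
have e2 m : (3 * m + 2 * m) * G * T%:R = 5 * G * m * T%:R :> R by ring.
by rewrite [leLHS]e2.
Qed.
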